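(* Let $(\mathcal{M},\varphi,\xi,\eta,g)$ be a 5-dimensional elliptic ($\sigma=1$) or hyperbolic ($\sigma=-1$) weakly para-cosymplectic manifold with para-K\''ahler leaves which is locally flat ($R=0$). Then near each point $p\in\mathcal{M}$ there are local coordinates $(t,x^1,x^2,y^1,y^2)$ and a local adopted coframe $(\theta^0=\eta,\theta^1,\ldots,\theta^4)$ such that $$\theta^0=dt,\quad\theta^1=dx^1,\quad\theta^2=dx^2,\quad\theta^3=u\theta^1+dy^1,\quad\theta^4=v\theta^2+dy^2,$$ where the functions $u,v$ have the form $$u=\alpha_1y^1-t+A(x^1,x^2),\qquad v=\alpha_2y^2-\sigma t+B(x^1,x^2),$$ with $\tau_1=\alpha_1\theta^1$, $\tau_2=\alpha_2\theta^2$, $d\tau_1=d\tau_2=0$, and the functions $A,B$ satisfy $$\partial^2_{x^2}A+\partial^2_{x^1}B+\alpha_2\,\partial_{x^2}A+\alpha_1\,\partial_{x^1}B=-\sigma.$$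
   Context: All manifolds, tensor fields and functions are smooth. An almost para-contact metric structure on $\mathcal{M}$, $\dim\mathcal{M}=2n+1$, is a quadruple $(\varphi,\xi,\eta,g)$ ($\varphi$ a $(1,1)$-tensor field, $\xi$ a vector field, $\eta$ a 1-form, $g$ a pseudo-Riemannian metric) with $\varphi^2=Id-\eta\otimes\xi$, $\eta(\xi)=1$, $g(\varphi X,\varphi Y)=-g(X,Y)+\eta(X)\eta(Y)$, $\eta(X)=g(\xi,X)$. With $\varPhi(X,Y)=g(\varphi X,Y)$, the manifold is almost para-cosymplectic if $d\eta=0$ and $d\varPhi=0$; it is then weakly para-cosymplectic if $R(X,Y)\varphi Z=\varphi R(X,Y)Z$ for all $X,Y,Z$, where $R(X,Y)Z=\nabla_X\nabla_YZ-\nabla_Y\nabla_XZ-\nabla_{[X,Y]}Z$ and $\nabla$ is the Levi-Civita connection. Put $\mathsf{A}X=-\nabla_X\xi$ (not to be confused with the function $A$ in the claim). Each leaf of the foliation $\eta=0$ inherits an almost para-Hermitian structure $(P,H)$ by restricting $\varphi$ and $g$; the manifold has para-K\''ahler leaves if $P$ is parallel for the Levi-Civita connection of $H$ on every leaf, equivalently $(\nabla_X\varphi)Y=g(\mathsf{A}\varphi X,Y)\xi-\eta(Y)\mathsf{A}\varphi X$. Elliptic/hyperbolic (dimension 5): near each point there are smooth nowhere zero vector fields $V_1,V_2$ (unique up to sign) with $\varphi V_1=-V_1$, $\varphi V_2=V_2$, $g(V_1,V_2)=0$ and $\mathsf{A}X=\varepsilon\left(g(X,V_1)V_1+\sigma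 g(X,V_2)V_2\right)$, $\varepsilon=\pm1$, where $\sigma=1$ in the elliptic and $\sigma=-1$ in the hyperbolic case. Replacing $(\xi,\eta)$ by $(-\xi,-\eta)$ if necessary, it is always assumed that $\varepsilon=1$. An adopted frame is a local frame $(V_0=\xi,V_1,V_2,V_3,V_4)$ extending $(\xi,V_1,V_2)$ with $\varphi V_3=V_3$, $\varphi V_4=-V_4$ and such that the only non-zero coefficients of the metric are $g(\xi,\xi)=g(V_1,V_3)=g(V_2,V_4)=1$ (and the symmetric ones). The corresponding adopted coframe is the metric-dual coframe $\theta^i=g(\cdot,V_i)$. The 1-forms $\tau_1,\tau_2$ are determined by $\nabla_XV_1=\tau_1(X)V_1$, $\nabla_XV_2=\tau_2(X)V_2$; $\tau_1$ is always a multiple of $\theta^1$ and $\tau_2$ a multiple of $\theta^2$. *)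

(* Defs.v *)
(* A smooth manifold is a Hausdorff second countable space with a maximal
   smooth atlas. A tensor field is the family of its component functions in the
   charts of the atlas, related by the transformation law. Conditions on
   arbitrary vector fields are imposed on the fields defined on the domain of
   some chart; the atlas being maximal, such domains are arbitrarily small.

   Row-vector conventions: points of R^m and components of tangent vectors are
   rows, components of 1-forms are columns, and matrices act on the right:
     w(v) = v *m w,   phi(v) = v *m phi,   g(v, w) = v *m g *m w^T.
   With these, 'J f x maps a tangent vector v at x to v *m 'J f x at f x. *)
From HB Require Import structures.
From mathcomp Require Import all_boot all_order all_algebra.
From mathcomp Require Import all_classical all_reals all_analysis.

Set Implicit Arguments.
Unset Strict Implicit.
Unset Printing Implicit Defensive.

Import Order.TTheory GRing.Theory Num.Theory.
Import numFieldNormedType.Exports.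

Local Open Scope classical_set_scope.
Local Open Scope ring_scope.

Section EuclideanCalculus.
Variables (R : realType) (m : nat).
Implicit Types (U : set 'rV[R]_m) (f : 'rV[R]_m -> R) (x : 'rV[R]_m).

Definition partial (i : 'I_m) f x : R := 'D_(delta_mx 0 i) f x.

Definition iter_partial (s : seq 'I_m) f : 'rV[R]_m -> R := foldr partial f s.

(* Used for open U only. Each iterated partial derivative being differentiable
   makes all of them continuous, so this is the usual notion of C^oo. *)
Definition smooth_on U f : Prop :=
  forall (s : seq 'I_m) x, U x -> differentiable (iter_partial s f) x.

Definition smooth_mx_on p q U (F : 'rV[R]_m -> 'M[R]_(p, q)) : Prop :=
  forall i j, smooth_on U (fun x => F x i j).

Definition differential f x : 'cV[R]_m := \col_i partial i f x.

Definition closed_1form U (w : 'rV[R]_m -> 'cV[R]_m) : Prop :=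
  forall x, U x -> forall i j,
    partial i (fun y => w y j 0) x - partial j (fun y => w y i 0) x = 0.

(* The 2-form with components F i j, for an antisymmetric F. *)
Definition closed_2form U (F : 'rV[R]_m -> 'M[R]_m) : Prop :=
  forall x, U x -> forall i j k,
    partial i (fun y => F y j k) x + partial j (fun y => F y k i) x
    + partial k (fun y => F y i j) x = 0.

Section LeviCivita.
Variable g : 'rV[R]_m -> 'M[R]_m.
Implicit Types X Y Z : 'rV[R]_m -> 'rV[R]_m.

Definition inner x (v w : 'rV[R]_m) : R := (v *m g x *m w^T) 0 0.

Definition metric_dual X x : 'cV[R]_m := g x *m (X x)^T.

(* Gamma^k_{ij} *)
Definition christoffel x (i j k : 'I_m) : R :=
  2^-1 * \sum_l invmx (g x) k l *
    (partial i (fun y => g y j l) x + partial j (fun y => g y i l) x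
     - partial l (fun y => g y i j) x).

Definition nabla X Y x : 'rV[R]_m :=
  X x *m 'J Y x +
  \row_k \sum_i \sum_j christoffel x i j k * X x 0 i * Y x 0 j.

Definition lie_bracket X Y x : 'rV[R]_m := X x *m 'J Y x - Y x *m 'J X x.

Definition curvature X Y Z x : 'rV[R]_m :=
  nabla X (nabla Y Z) x - nabla Y (nabla X Z) x - nabla (lie_bracket X Y) Z x.

End LeviCivita.
End EuclideanCalculus.

Section Manifolds.
Variables (R : realType) (m : nat) (M : topologicalType).

(* [cinv] is only meaningful on the image of [cdom] under [cmap]. *)
Record chart := Chart {
  cdom : set M;
  cmap : M -> 'rV[R]_m;
  cinv : 'rV[R]_m -> M }.

Definition cimg (c : chart) : set 'rV[R]_m := cmap c @` cdom c.

Definition is_chart (c : chart) : Prop :=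
  [/\ open (cdom c), open (cimg c),
      {in cdom c, cancel (cmap c) (cinv c)},
      {in cdom c, continuous (cmap c)} &
      {in cimg c, continuous (cinv c)}].

Definition transition (c d : chart) : 'rV[R]_m -> 'rV[R]_m := cmap d \o cinv c.

Definition overlap (c d : chart) : set 'rV[R]_m :=
  cmap c @` (cdom c `&` cdom d).

Definition compatible (c d : chart) : Prop :=
  smooth_mx_on (overlap c d) (transition c d) /\
  smooth_mx_on (overlap d c) (transition d c).

Record smooth_manifold (S : set chart) : Prop := SmoothManifold {
  manifold_hausdorff : hausdorff_space M;
  manifold_second_countable : @second_countable M;
  atlas_chart : forall c, S c -> is_chart c;
  atlas_cover : forall p, exists2 c, S c & cdom c p;
  atlas_compatible : forall c d, S c -> S d -> compatible c d;
  atlas_maximal : forall c, is_chart c ->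
    (forall d, S d -> compatible c d) -> S c }.

Definition field_components p q := chart -> 'rV[R]_m -> 'M[R]_(p, q).

Variable S : set chart.

Definition smooth_components p q (T : field_components p q) : Prop :=
  forall c, S c -> smooth_mx_on (cimg c) (T c).

Definition vector_field (X : field_components 1 m) : Prop :=
  smooth_components X /\
  forall c d x, S c -> S d -> overlap c d x ->
    X d (transition c d x) = X c x *m 'J (transition c d) x.

Definition one_form (w : field_components m 1) : Prop :=
  smooth_components w /\
  forall c d x, S c -> S d -> overlap c d x ->
    w c x = 'J (transition c d) x *m w d (transition c d x).

Definition endomorphism_field (phi : field_components m m) : Prop :=
  smooth_components phi /\
  forall c d x, S c -> S d -> overlap c d x ->
    phi c x *m 'J (transition c d) x
    = 'J (transition c d) x *m phi d (transition c d x).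

Definition bilinear_field (g : field_components m m) : Prop :=
  smooth_components g /\
  forall c d x, S c -> S d -> overlap c d x ->
    g c x = 'J (transition c d) x *m g d (transition c d x)
            *m ('J (transition c d) x)^T.

Definition pseudo_riemannian_metric (g : field_components m m) : Prop :=
  bilinear_field g /\
  forall c x, S c -> cimg c x -> (g c x)^T = g c x /\ g c x \in unitmx.

Definition locally_flat (g : field_components m m) : Prop :=
  forall c (X Y Z : 'rV[R]_m -> 'rV[R]_m), S c ->
    smooth_mx_on (cimg c) X -> smooth_mx_on (cimg c) Y ->
    smooth_mx_on (cimg c) Z ->
    forall x, cimg c x -> curvature (g c) X Y Z x = 0.

Section ParaContact.
Variables (phi : field_components m m) (xi : field_components 1 m)
          (eta : field_components m 1) (g : field_components m m).

Record almost_para_contact_metric : Prop := AlmostParaContactMetric {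
  para_contact_dim : odd m;
  para_contact_phi : endomorphism_field phi;
  para_contact_xi : vector_field xi;
  para_contact_eta : one_form eta;
  para_contact_g : pseudo_riemannian_metric g;
  para_contact_sqr : forall c x, S c -> cimg c x -> forall v : 'rV[R]_m,
    v *m phi c x *m phi c x = v - (v *m eta c x) 0 0 *: xi c x;
  para_contact_eta_xi : forall c x, S c -> cimg c x ->
    (xi c x *m eta c x) 0 0 = 1;
  para_contact_compat : forall c x, S c -> cimg c x -> forall v w : 'rV[R]_m,
    inner (g c) x (v *m phi c x) (w *m phi c x)
    = - inner (g c) x v w + (v *m eta c x) 0 0 * (w *m eta c x) 0 0;
  para_contact_dual : forall c x, S c -> cimg c x -> forall v : 'rV[R]_m,
    (v *m eta c x) 0 0 = inner (g c) x (xi c x) v }.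

(* Phi(X, Y) = g(phi X, Y) *)
Definition fundamental_form (c : chart) x : 'M[R]_m := phi c x *m g c x.

Definition almost_para_cosymplectic : Prop :=
  [/\ almost_para_contact_metric,
      forall c, S c -> closed_1form (cimg c) (eta c) &
      forall c, S c -> closed_2form (cimg c) (fundamental_form c)].

Definition weakly_para_cosymplectic : Prop :=
  almost_para_cosymplectic /\
  forall c (X Y Z : 'rV[R]_m -> 'rV[R]_m), S c ->
    smooth_mx_on (cimg c) X -> smooth_mx_on (cimg c) Y ->
    smooth_mx_on (cimg c) Z ->
    forall x, cimg c x ->
      curvature (g c) X Y (fun y => Z y *m phi c y) x
      = curvature (g c) X Y Z x *m phi c x.

(* [f] is a local parametrization, read in the chart [c], of a leaf of the
   foliation eta = 0. *)
Definition leaf_parametrization (c : chart) (W : set 'rV[R]_m.-1)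
    (f : 'rV[R]_m.-1 -> 'rV[R]_m) : Prop :=
  [/\ open W, smooth_mx_on W f, f @` W `<=` cimg c,
      forall w, W w -> row_free ('J f w) &
      forall w, W w -> 'J f w *m eta c (f w) = 0].

Definition leaf_metric (c : chart) (f : 'rV[R]_m.-1 -> 'rV[R]_m) w
    : 'M[R]_m.-1 :=
  'J f w *m g c (f w) *m ('J f w)^T.

(* The hypothesis on [P] says df (P X) = phi (df X): [P] is the restriction of
   phi to the leaf. *)
Definition para_kahler_leaves : Prop :=
  forall c (W : set 'rV[R]_m.-1) (f : 'rV[R]_m.-1 -> 'rV[R]_m)
         (P : 'rV[R]_m.-1 -> 'M[R]_m.-1),
    S c -> leaf_parametrization c W f ->
    (forall w, W w -> P w *m 'J f w = 'J f w *m phi c (f w)) ->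
    forall X Y : 'rV[R]_m.-1 -> 'rV[R]_m.-1,
      smooth_mx_on W X -> smooth_mx_on W Y ->
      forall w, W w ->
        nabla (leaf_metric c f) X (fun y => Y y *m P y) w
        = nabla (leaf_metric c f) X Y w *m P w.

(* The vector fields (V1, V2) on the domain of [c] diagonalizing
   A X = - nabla_X xi, for the orientation of (xi, eta) that gives
   A X = + (g(X, V1) V1 + sigma g(X, V2) V2). *)
Definition distinguished_pair (sigma : R) (c : chart)
    (V1 V2 : 'rV[R]_m -> 'rV[R]_m) : Prop :=
  [/\ smooth_mx_on (cimg c) V1 /\ smooth_mx_on (cimg c) V2,
      forall x, cimg c x -> V1 x != 0 /\ V2 x != 0,
      forall x, cimg c x ->
        V1 x *m phi c x = - V1 x /\ V2 x *m phi c x = V2 x,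
      forall x, cimg c x -> inner (g c) x (V1 x) (V2 x) = 0 &
      forall X : 'rV[R]_m -> 'rV[R]_m, smooth_mx_on (cimg c) X ->
        forall x, cimg c x ->
        - nabla (g c) X (xi c) x
        = inner (g c) x (X x) (V1 x) *: V1 x
          + sigma *: (inner (g c) x (X x) (V2 x) *: V2 x)].

(* Elliptic for sigma = 1, hyperbolic for sigma = -1. *)
Definition elliptic_hyperbolic (sigma : R) : Prop :=
  forall p, exists c, [/\ S c, cdom c p &
    exists V1 V2, distinguished_pair sigma c V1 V2].

End ParaContact.
End Manifolds.

Definition adopted_gram (R : realType) : 'M[R]_5 :=
  \matrix_(i, j) (((i : nat), (j : nat)) \in
    [:: (0, 0); (1, 3); (3, 1); (2, 4); (4, 2)]%N)%:R.

Definition adopted_frame (R : realType) (M : topologicalType)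
    (phi : field_components R 5 M 5 5) (xi : field_components R 5 M 1 5)
    (g : field_components R 5 M 5 5) (sigma : R) (c : chart R 5 M)
    (V : 'I_5 -> 'rV[R]_5 -> 'rV[R]_5) : Prop :=
  [/\ forall i, smooth_mx_on (cimg c) (V i),
      forall x, cimg c x -> V 0 x = xi c x,
      distinguished_pair phi xi g sigma c (V 1) (V 2),
      forall x, cimg c x ->
        V 3 x *m phi c x = V 3 x /\ V 4 x *m phi c x = - V 4 x &
      forall x, cimg c x -> forall i j,
        inner (g c) x (V i x) (V j x) = adopted_gram R i j].

Definition row2 (R : realType) (a b : R) : 'rV[R]_2 :=
  \row_j (if j == 0 then a else b).

(* Main.v *)
(* Work in a frame (xi, V1, V2, V3, V4) with the adopted products, V3 and V4
   being eigenvectors of phi, and let theta^i be the metric duals. The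
   para-Kaehler leaves give g(nabla_X V1, V4) = g(nabla_X V2, V3) = 0 for X
   tangent to the leaves, and d Phi = 0 gives it for X = xi. Since R = 0, the
   second covariant derivative of xi is symmetric; this Codazzi equation yields
   nabla V1 = tau1 V1 and nabla V2 = tau2 V2 with tau1 = alpha1 theta^1,
   tau2 = alpha2 theta^2, and d theta^1 = d theta^2 = 0. Applying R = 0 to V1,
   V2, V3 gives d tau1 = d tau2 = 0 and, for omega(X) = g(nabla_X V3, V4),
     d omega = - sigma theta^1 /\ theta^2 - (tau1 + tau2) /\ omega.
   Let d h1 = tau1, d h2 = tau2, d H = e^h1 theta^1. Then
   e^(h1 + h2) omega + sigma H e^h2 theta^2 is closed, with a primitive F. Put
   f = e^(- h1 - h2) F, q = - sigma e^(- h1) H and d Q = q theta^1. After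
   replacing V3 by V3 - f V2 and V4 by V4 + f V1, the forms
   e^h1 (theta^3 + t theta^1) and e^h2 (theta^4 + (sigma t - Q) theta^2) are
   closed; y^1 and y^2 are their primitives divided by e^h1 and e^h2. Thus
   A = 0 and B = Q, a function of x^1 only with Q' = q, and
   q' + alpha1 q = - sigma is the differential equation. *)
Require Import Defs.
From HB Require Import structures.
From mathcomp Require Import all_boot all_order all_algebra.
From mathcomp Require Import all_classical all_reals all_analysis.
From mathcomp Require Import ring lra.

Set Implicit Arguments.
Unset Strict Implicit.
Unset Printing Implicit Defensive.

Import Order.TTheory GRing.Theory Num.Theory.
Import numFieldNormedType.Exports.

Local Open Scope classical_set_scope.
Local Open Scope ring_scope.

(** * Frechet and partial derivatives *)

Section Frechet.
Variables (R : realType) (V W : normedModType R).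

Lemma is_diff_eps (f : V -> W) (L : {linear V -> W}) (x : V) :
  continuous L ->
  (forall e, 0 < e ->
     \forall y \near x, `|f y - f x - L (y - x)| <= e * `|y - x|) ->
  is_diff x f L.
Proof.
move=> Lc fL.
have fE : f \o shift x = cst (f x) + L +o_ 0 id.
  apply/eqaddoP => e e0.
  move/(_ e e0): fL; rewrite (near_shift 0).
  apply: filterS => h /=.
  by rewrite subr0 addrK -!fctE /= opprD addrA.
have dfL := diff_unique Lc fE.
apply: DiffDef => //; apply/diff_locallyP.
by rewrite dfL.
Qed.

Lemma diff_eps (f : V -> W) (x : V) : differentiable f x ->
  forall e, 0 < e ->
     \forall y \near x, `|f y - f x - 'd f x (y - x)| <= e * `|y - x|.
Proof.
move=> /diff_locallyP[_ fE] e e0.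
rewrite (near_shift 0).
have /eqaddoP/(_ e e0) := fE.
apply: filterS => h /=.
by rewrite subr0 addrK -!fctE /= opprD addrA.
Qed.

Lemma near_eq_is_diff (f g : V -> W) (x : V) :
  (\forall y \near x, f y = g y) -> differentiable f x ->
  is_diff x g ('d f x).
Proof.
move=> fg df; apply: is_diff_eps; first exact: diff_continuous.
have fgx := nbhs_singleton fg.
move=> e e0; have := diff_eps df e0.
by apply: filterS2 fg => y <-; rewrite -fgx.
Qed.

End Frechet.

Section Coordinates.
Variable R : realType.

Lemma coord_le_norm m n (A : 'M[R]_(m, n)) i j : `|A i j| <= `|A|.
Proof.
by rewrite [leRHS]/Num.Def.normr/= mx_normrE; exact: (le_bigmax _ _ (i, j)).
Qed.

Lemma norm_le_coord m n (A : 'M[R]_(m, n)) e :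
  0 <= e -> (forall i j, `|A i j| <= e) -> `|A| <= e.
Proof.
move=> e0 Ae; rewrite /Num.Def.normr/= mx_normrE.
by apply: bigmax_le => // -[i j] _ /=.
Qed.

Lemma norm_lt_coord m n (A : 'M[R]_(m, n)) e :
  0 < e -> (forall i j, `|A i j| < e) -> `|A| < e.
Proof.
move=> e0 Ae; rewrite /Num.Def.normr/= mx_normrE.
by apply: bigmax_lt => // -[i j] _ /=.
Qed.

Lemma norm_mulmx m n p (A : 'M[R]_(m, n)) (B : 'M[R]_(n, p)) :
  `|A *m B| <= n%:R * (`|A| * `|B|).
Proof.
apply: norm_le_coord => [|i j]; first by rewrite !mulr_ge0.
rewrite mxE (le_trans (ler_norm_sum _ _ _))//.
have -> : n%:R * (`|A| * `|B|) = \sum_(k < n) `|A| * `|B|.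
  by rewrite sumr_const card_ord mulr_natl.
by rewrite ler_sum// => k _; rewrite normrM ler_pM// coord_le_norm.
Qed.

Lemma mulmxr_continuous m n p (B : 'M[R]_(n, p)) :
  continuous (fun A : 'M[R]_(m, n) => A *m B).
Proof.
have -> : (fun A : 'M[R]_(m, n) => A *m B) = mulmxr B by [].
apply: (@linear_bounded_continuous R 'M[R]_(m, n) 'M[R]_(m, p) (mulmxr B)).1.
apply/linear_boundedP.
exists (n%:R * `|B|); split; first exact: num_real.
move=> r Br A /=.
by rewrite (le_trans (norm_mulmx _ _))// mulrCA mulrC ler_wpM2r// ltW.
Qed.

Lemma diff_coord m n (M : 'M[R]_(m, n)) i j :
  'd (fun N : 'M[R]_(m, n) => N i j) M = (fun N => N i j) :> (_ -> R).
Proof.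
have lin : linear (fun N : 'M[R]_(m, n) => N i j : R) by move=> a A B; rewrite !mxE.
pose fM := GRing.isLinear.Build _ _ _ _ _ lin.
pose f : {linear _ -> _} := HB.pack (fun N : 'M[R]_(m, n) => N i j : R) fM.
rewrite (_ : (fun _ => _) = f :> (_ -> _))//.
by rewrite diff_lin//; exact: coord_continuous.
Qed.

End Coordinates.

Section Partial.
Variables (R : realType) (m : nat).
Implicit Types (U : set 'rV[R]_m) (f g : 'rV[R]_m -> R) (x : 'rV[R]_m).

Lemma partialE i f x : differentiable f x -> partial i f x = 'd f x (delta_mx 0 i).
Proof. exact: deriveE. Qed.

Lemma diff_differential f x v : differentiable f x ->
  'd f x v = (v *m differential f x) 0 0.
Proof.
move=> df; rewrite {1}(row_sum_delta v) linear_sum mxE.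
by apply: eq_bigr => i _; rewrite linearZ/= mxE partialE.
Qed.

Lemma differential_eps f x : differentiable f x ->
  forall e, 0 < e -> \forall y \near x,
    `|f y - f x - ((y - x) *m differential f x) 0 0| <= e * `|y - x|.
Proof.
move=> df e e0; have := diff_eps df e0.
by apply: filterS => y; rewrite diff_differential.
Qed.

Definition pairing (c : 'cV[R]_m) (v : 'rV[R]_m) : R := (v *m c) 0 0.

Fact pairing_is_linear (c : 'cV[R]_m) : linear (pairing c).
Proof. by move=> a u v; rewrite /pairing mulmxDl -scalemxAl !mxE. Qed.

HB.instance Definition _ (c : 'cV[R]_m) :=
  GRing.isLinear.Build R 'rV[R]_m R _ _ (pairing_is_linear c).

Lemma eps_differential f x (c : 'cV[R]_m) :
  (forall e, 0 < e -> \forall y \near x,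
    `|f y - f x - ((y - x) *m c) 0 0| <= e * `|y - x|) ->
  differentiable f x /\ differential f x = c.
Proof.
move=> fc.
have Lc : continuous (pairing c).
  move=> v; apply: (@continuous_comp _ _ _ (fun v : 'rV[R]_m => v *m c)
    (fun A : 'M[R]_1 => A 0 0)); first exact: mulmxr_continuous.
  exact: coord_continuous.
have [df dfL] := is_diff_eps Lc fc.
split => //; apply/colP => i; rewrite !mxE partialE// dfL /= /pairing mxE (bigD1 i)//=.
rewrite mxE !eqxx mul1r big1 ?addr0// => j ji.
by rewrite mxE eqxx (negbTE ji) mul0r.
Qed.

Lemma near_eq_differentiable f g x :
  (\forall y \near x, f y = g y) -> differentiable f x -> differentiable g x.
Proof. by move=> fg /(near_eq_is_diff fg)[]. Qed.

Lemma near_eq_partial i f g x :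
  (\forall y \near x, f y = g y) -> partial i f x = partial i g x.
Proof. exact: near_eq_derive. Qed.

Lemma partial_cst i (a : R) x : partial i (fun=> a) x = 0.
Proof. exact: derive_cst. Qed.

Lemma partialD i f g x : differentiable f x -> differentiable g x ->
  partial i (fun y => f y + g y) x = partial i f x + partial i g x.
Proof. by move=> df dg; apply: deriveD; exact: diff_derivable. Qed.

Lemma partialN i f x : differentiable f x ->
  partial i (fun y => - f y) x = - partial i f x.
Proof. by move=> df; apply: deriveN; exact: diff_derivable. Qed.

Lemma partialB i f g x : differentiable f x -> differentiable g x ->
  partial i (fun y => f y - g y) x = partial i f x - partial i g x.
Proof. by move=> df dg; apply: deriveB; exact: diff_derivable. Qed.

Lemma partialM i f g x : differentiable f x -> differentiable g x ->
  partial i (fun y => f y * g y) x = partial i f x * g x + f x * partial i g x.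
Proof.
move=> df dg; rewrite [LHS](@deriveM _ _ f g x)//; do ?exact: diff_derivable.
by rewrite addrC mulrC; congr (_ + _).
Qed.

Lemma partialV i f x : differentiable f x -> f x != 0 ->
  partial i (fun y => (f y)^-1) x = - partial i f x * ((f x)^-1 * (f x)^-1).
Proof.
move=> df f0; rewrite [LHS]deriveV//; last exact: diff_derivable.
by rewrite [LHS]mulNr mulNr mulrC -expr2 exprVn.
Qed.

Lemma partial_sum (I : Type) (r : seq I) i (F : I -> 'rV[R]_m -> R) x :
  (forall k, differentiable (F k) x) ->
  differentiable (fun y => \sum_(k <- r) F k y) x /\
  partial i (fun y => \sum_(k <- r) F k y) x = \sum_(k <- r) partial i (F k) x.
Proof.
move=> dF; elim: r => [|k r [dr pr]].
  have -> : (fun y => \sum_(k <- [::]) F k y) = (fun=> 0).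
    by apply/funext => y; rewrite big_nil.
  by rewrite big_nil partial_cst; split=> //; exact: differentiable_cst.
have -> : (fun y => \sum_(k <- k :: r) F k y) =
    (fun y => F k y + \sum_(k <- r) F k y).
  by apply/funext => y; rewrite big_cons.
by rewrite big_cons partialD// pr; split=> //; exact: differentiableD.
Qed.

Lemma partial_coord i j x : partial i (fun y => y 0 j) x = (i == j)%:R.
Proof.
rewrite partialE; last exact: differentiable_coord.
by rewrite diff_coord mxE eqxx eq_sym.
Qed.

Lemma differentiable_rV n (G : 'rV[R]_m -> 'rV[R]_n) x :
  (forall j, differentiable (fun y => G y 0 j) x) -> differentiable G x.
Proof.
move=> dG.
have -> : G = \sum_(j < n) (fun y => G y 0 j *: delta_mx 0 j).
  by apply/funext => y; rewrite fct_sumE -row_sum_delta.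
by apply: differentiable_sum => j; exact: differentiableZl.
Qed.

Lemma differentiable_row n (G : 'rV[R]_m -> 'rV[R]_n) x j :
  differentiable G x -> differentiable (fun y => G y 0 j) x.
Proof.
by move=> dG; apply: (@differentiable_comp _ _ _ _ G (fun A => A 0 j))
  => //; exact: differentiable_coord.
Qed.

End Partial.

Section Chain.
Variables (R : realType) (m n : nat).

Lemma jacobianE (G : 'rV[R]_m -> 'rV[R]_n) x i j :
  differentiable G x -> ('J G x) i j = partial i (fun y => G y 0 j) x.
Proof.
move=> dG; rewrite mxE partialE; last exact: differentiable_row.
rewrite (@diff_comp _ _ _ _ G (fun A => A 0 j))//=; last exact: differentiable_coord.
by rewrite diff_coord.
Qed.

Lemma partial_comp (f : 'rV[R]_n -> R) (G : 'rV[R]_m -> 'rV[R]_n) x i :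
  differentiable f (G x) -> differentiable G x ->
  differentiable (fun y => f (G y)) x /\
  partial i (fun y => f (G y)) x =
    \sum_j partial i (fun y => G y 0 j) x * partial j f (G x).
Proof.
move=> df dG; have dfG : differentiable (f \o G) x by exact: differentiable_comp.
split=> //; rewrite partialE// (@diff_comp _ _ _ _ G f)//=.
rewrite (diff_differential _ df) mxE; apply: eq_bigr => j _.
by rewrite -(jacobianE _ _ dG) !mxE.
Qed.

Lemma partial_comp1 (h : R -> R) (f : 'rV[R]_m -> R) x i :
  differentiable f x -> derivable h (f x) 1 ->
  differentiable (fun y => h (f y)) x /\
  partial i (fun y => h (f y)) x = h^`()%classic (f x) * partial i f x.
Proof.
move=> df /derivable1_diffP dh.
have dhf : differentiable (h \o f) x by exact: differentiable_comp.
split=> //; rewrite partialE// (@diff_comp _ _ _ _ f h)//= partialE//.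
by rewrite derive1E' // -[X in 'd h _ X = _]mulr1 [LHS]linearZ mulrC.
Qed.

End Chain.

(** * Smooth functions *)

Section Ck.
Variables (R : realType) (m : nat).
Implicit Types (U : set 'rV[R]_m) (f g : 'rV[R]_m -> R) (x : 'rV[R]_m).

Fixpoint ck_on (k : nat) U f : Prop :=
  (forall x, U x -> differentiable f x) /\
  (if k is k'.+1 then forall i, ck_on k' U (partial i f) else True).

Lemma ck_on_diff k U f x : ck_on k U f -> U x -> differentiable f x.
Proof. by case: k => [|k] [+ _]; exact. Qed.

Lemma ck_onS k U f : ck_on k.+1 U f -> ck_on k U f.
Proof.
elim: k f => [|k IH] f [df kf]; split => //.
by move=> i; apply: IH; exact: kf.
Qed.

Lemma smooth_onP U f : smooth_on U f <-> forall k, ck_on k U f.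
Proof.
split=> [Uf k|Uf s].
  elim: k f Uf => [|k IH] f Uf.
    by split=> // x Ux; exact: (Uf [::]).
  split=> [x Ux|i]; first exact: (Uf [::]).
  apply: IH => s x Ux; have := Uf (rcons s i) x Ux.
  by rewrite /iter_partial foldr_rcons.
elim/last_ind: s f Uf => [|s i IH] f Uf x Ux.
  exact: ck_on_diff (Uf 0%N) Ux.
rewrite /iter_partial foldr_rcons; apply: IH => // k.
by have [_] := Uf k.+1; apply.
Qed.

Lemma smooth_diff U f x : smooth_on U f -> U x -> differentiable f x.
Proof. by move=> Uf Ux; exact: (Uf [::]). Qed.

Lemma smooth_partial U f i : smooth_on U f -> smooth_on U (partial i f).
Proof.
move=> Uf s x Ux; have := Uf (rcons s i) x Ux.
by rewrite /iter_partial foldr_rcons.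
Qed.

Lemma smooth_sub U U' f : U' `<=` U -> smooth_on U f -> smooth_on U' f.
Proof. by move=> sU Uf s x /sU; exact: Uf. Qed.

Section OpenSet.
Variable U : set 'rV[R]_m.
Hypothesis Uo : open U.

Lemma near_eq_open T (f g : 'rV[R]_m -> T) x : (forall y, U y -> f y = g y) -> U x ->
  \forall y \near x, f y = g y.
Proof.
by move=> fg Ux; have := open_nbhs_nbhs (conj Uo Ux); apply: filterS.
Qed.

Lemma open_eq_partial f g x i : (forall y, U y -> f y = g y) -> U x ->
  partial i f x = partial i g x.
Proof. by move=> fg Ux; apply: near_eq_partial; exact: near_eq_open. Qed.

Lemma ck_eq k f g : (forall y, U y -> f y = g y) -> ck_on k U f -> ck_on k U g.
Proof.
elim: k f g => [|k IH] f g fg [df kf]; (split=> [x Ux|//];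
  first by apply: near_eq_differentiable (df x Ux); exact: near_eq_open).
by move=> i; apply: IH (kf i) => y Uy; exact: open_eq_partial.
Qed.

Lemma ck_cst k (a : R) : ck_on k U (fun=> a).
Proof.
elim: k a => [|k IH] a; (split=> [x _|//]; first by exact: differentiable_cst).
by move=> i; apply: (ck_eq _ (IH 0)) => y _; rewrite partial_cst.
Qed.

Lemma ckD k f g : ck_on k U f -> ck_on k U g -> ck_on k U (fun x => f x + g x).
Proof.
elim: k f g => [|k IH] f g kf kg; (split=> [x Ux|//];
  first by apply: differentiableD; apply: (ck_on_diff _ Ux); eassumption).
move=> i; have := IH _ _ (kf.2 i) (kg.2 i).
apply: ck_eq => y Uy; rewrite partialD//; apply: (ck_on_diff _ Uy); eassumption.
Qed.

Lemma ck_sum k (I : Type) (r : seq I) (F : I -> 'rV[R]_m -> R) :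
  (forall i, ck_on k U (F i)) -> ck_on k U (fun x => \sum_(i <- r) F i x).
Proof.
move=> kF; elim: r => [|i r IH].
  by apply: (ck_eq _ (ck_cst k 0)) => y _; rewrite big_nil.
by apply: (ck_eq _ (ckD (kF i) IH)) => y _; rewrite big_cons.
Qed.

Lemma ckM k f g : ck_on k U f -> ck_on k U g -> ck_on k U (fun x => f x * g x).
Proof.
elim: k f g => [|k IH] f g kf kg; (split=> [x Ux|//];
  first by apply: differentiableM; apply: (ck_on_diff _ Ux); eassumption).
move=> i; have := ckD (IH _ _ (kf.2 i) (ck_onS kg)) (IH _ _ (ck_onS kf) (kg.2 i)).
apply: ck_eq => y Uy; rewrite partialM//; apply: (ck_on_diff _ Uy); eassumption.
Qed.

Lemma ckN k f : ck_on k U f -> ck_on k U (fun x => - f x).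
Proof.
move=> kf; apply: (ck_eq _ (ckM (ck_cst k (-1)) kf)) => y _.
by rewrite mulN1r.
Qed.

Lemma ckV k f : (forall x, U x -> f x != 0) -> ck_on k U f ->
  ck_on k U (fun x => (f x)^-1).
Proof.
move=> f0; elim: k => [|k IH] kf; (split=> [x Ux|//];
  first by apply: differentiableV; [apply: (ck_on_diff _ Ux); eassumption|exact: f0]).
move=> i; have If := IH (ck_onS kf).
apply: (ck_eq _ (ckM (ckN (kf.2 i)) (ckM If If))) => y Uy.
by rewrite partialV//; [apply: (ck_on_diff _ Uy); eassumption|exact: f0].
Qed.

Lemma ck_exp k f : ck_on k U f -> ck_on k U (fun x => expR (f x)).
Proof.
have dexp x : ck_on 0 U f -> U x -> differentiable (fun x => expR (f x)) x /\
    forall i, partial i (fun x => expR (f x)) x = expR (f x) * partial i f x.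
  move=> kf Ux; have fx := ck_on_diff kf Ux.
  have dex : differentiable expR (f x) by exact/derivable1_diffP/derivable_expR.
  split=> [|i]; first exact: (@differentiable_comp _ _ _ _ f expR).
  have [_ ->] := @partial_comp1 _ _ expR f x i fx (@derivable_expR R (f x)).
  by rewrite derive1E; congr (_ * _); exact: (@derive_val _ _ _ _ _ _ _ (is_derive_expR (f x))).
have ck0 j : ck_on j U f -> ck_on 0 U f by case: j => // j [].
elim: k => [|k IH] kf; (split=> [x Ux|//];
  first by have [] := dexp x (ck0 _ kf) Ux).
move=> i; apply: (ck_eq _ (ckM (IH (ck_onS kf)) (kf.2 i))) => y Uy.
by have [_ ->] := dexp y (ck0 _ kf) Uy.
Qed.

Lemma ck_coord k j : ck_on k U (fun x => x 0 j).
Proof.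
elim: k => [|k IH]; (split=> [x Ux|//]; first by exact: differentiable_coord).
by move=> i; apply: (ck_eq _ (ck_cst k (i == j)%:R)) => y _; rewrite partial_coord.
Qed.

End OpenSet.
End Ck.

Section Composition.
Variables (R : realType) (m n : nat).

Lemma ck_comp k (U : set 'rV[R]_m) (V : set 'rV[R]_n) (f : 'rV[R]_n -> R)
    (G : 'rV[R]_m -> 'rV[R]_n) : open U ->
  (forall x, U x -> V (G x)) -> ck_on k V f ->
  (forall j, ck_on k U (fun x => G x 0 j)) -> ck_on k U (fun x => f (G x)).
Proof.
move=> Uo UV; have dG j : (forall i, ck_on j U (fun x => G x 0 i)) ->
    forall x, U x -> differentiable G x.
  by move=> kG x Ux; apply: differentiable_rV => i; exact: (ck_on_diff (kG i) Ux).
elim: k f => [|k IH] f kf kG.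
  split=> // x Ux.
  by apply: (@differentiable_comp _ _ _ _ G f); [exact: (dG _ kG x Ux)|apply: (ck_on_diff _ (UV _ Ux)); eassumption].
split=> [x Ux|i].
  by apply: (@differentiable_comp _ _ _ _ G f); [exact: (dG _ kG x Ux)|apply: (ck_on_diff _ (UV _ Ux)); eassumption].
have := @ck_sum R m U Uo k _ (index_enum 'I_n)
  (fun j x => partial i (fun y => G y 0 j) x * partial j f (G x)).
move=> H; apply: (ck_eq Uo _ (H _)) => [y Uy|j].
  by have [|_ ->//] := @partial_comp _ _ _ f G y i (ck_on_diff kf (UV _ Uy)); exact: (dG _ kG y Uy).
apply: ckM => //; first exact: (kG j).2.
by apply: IH; [exact: kf.2|move=> l; exact/ck_onS].
Qed.

End Composition.

Section SmoothClosure.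
Variables (R : realType) (m : nat) (U : set 'rV[R]_m).
Hypothesis Uo : open U.
Implicit Types (f g : 'rV[R]_m -> R).

Lemma smooth_eq f g : (forall y, U y -> f y = g y) -> smooth_on U f -> smooth_on U g.
Proof. by move=> fg /smooth_onP Uf; apply/smooth_onP => k; exact: ck_eq (Uf k). Qed.

Lemma smooth_cst (a : R) : smooth_on U (fun=> a).
Proof. by apply/smooth_onP => k; exact: ck_cst. Qed.

Lemma smooth_coord j : smooth_on U (fun x => x 0 j).
Proof. by apply/smooth_onP => k; exact: ck_coord. Qed.

Lemma smoothD f g : smooth_on U f -> smooth_on U g -> smooth_on U (fun x => f x + g x).
Proof. by move=> /smooth_onP Uf /smooth_onP Ug; apply/smooth_onP => k; exact: ckD. Qed.

Lemma smoothN f : smooth_on U f -> smooth_on U (fun x => - f x).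
Proof. by move=> /smooth_onP Uf; apply/smooth_onP => k; exact: ckN. Qed.

Lemma smoothB f g : smooth_on U f -> smooth_on U g -> smooth_on U (fun x => f x - g x).
Proof. by move=> Uf Ug; exact/smoothD/smoothN. Qed.

Lemma smoothM f g : smooth_on U f -> smooth_on U g -> smooth_on U (fun x => f x * g x).
Proof. by move=> /smooth_onP Uf /smooth_onP Ug; apply/smooth_onP => k; exact: ckM. Qed.

Lemma smoothV f : (forall x, U x -> f x != 0) -> smooth_on U f ->
  smooth_on U (fun x => (f x)^-1).
Proof. by move=> f0 /smooth_onP Uf; apply/smooth_onP => k; exact: ckV. Qed.

Lemma smooth_exp f : smooth_on U f -> smooth_on U (fun x => expR (f x)).
Proof. by move=> /smooth_onP Uf; apply/smooth_onP => k; exact: ck_exp. Qed.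

Lemma smooth_sum (I : Type) (r : seq I) (F : I -> 'rV[R]_m -> R) :
  (forall i, smooth_on U (F i)) -> smooth_on U (fun x => \sum_(i <- r) F i x).
Proof.
by move=> UF; apply/smooth_onP => k; apply: ck_sum => // i; have /smooth_onP := UF i.
Qed.

Lemma smooth_prod (I : Type) (r : seq I) (F : I -> 'rV[R]_m -> R) :
  (forall i, smooth_on U (F i)) -> smooth_on U (fun x => \prod_(i <- r) F i x).
Proof.
move=> UF; elim: r => [|i r IH].
  by apply: smooth_eq (smooth_cst 1) => y _; rewrite big_nil.
by apply: smooth_eq (smoothM (UF i) IH) => y _; rewrite big_cons.
Qed.

Lemma smooth_comp n (V : set 'rV[R]_n) (h : 'rV[R]_n -> R) (G : 'rV[R]_m -> 'rV[R]_n) :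
  (forall x, U x -> V (G x)) -> smooth_on V h -> smooth_mx_on U G ->
  smooth_on U (fun x => h (G x)).
Proof.
move=> UV /smooth_onP Vh UG; apply/smooth_onP => k; apply: (ck_comp Uo UV (Vh k)).
by move=> j; have /smooth_onP := UG 0 j.
Qed.

Lemma smooth_mx_eq p q (F G : 'rV[R]_m -> 'M[R]_(p, q)) :
  (forall y, U y -> F y = G y) -> smooth_mx_on U F -> smooth_mx_on U G.
Proof. by move=> FG UF i j; apply: smooth_eq (UF i j) => y /FG ->. Qed.

Lemma smooth_mx_cst p q (A : 'M[R]_(p, q)) : smooth_mx_on U (fun=> A).
Proof. by move=> i j; exact: smooth_cst. Qed.

Lemma smooth_mxD p q (F G : 'rV[R]_m -> 'M[R]_(p, q)) :
  smooth_mx_on U F -> smooth_mx_on U G -> smooth_mx_on U (fun x => F x + G x).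
Proof.
move=> UF UG i j; apply: smooth_eq (smoothD (UF i j) (UG i j)) => y _.
by rewrite mxE.
Qed.

Lemma smooth_mxN p q (F : 'rV[R]_m -> 'M[R]_(p, q)) :
  smooth_mx_on U F -> smooth_mx_on U (fun x => - F x).
Proof. by move=> UF i j; apply: smooth_eq (smoothN (UF i j)) => y _; rewrite mxE. Qed.

Lemma smooth_mxB p q (F G : 'rV[R]_m -> 'M[R]_(p, q)) :
  smooth_mx_on U F -> smooth_mx_on U G -> smooth_mx_on U (fun x => F x - G x).
Proof. by move=> UF UG; exact/smooth_mxD/smooth_mxN. Qed.

Lemma smooth_mxZ p q f (F : 'rV[R]_m -> 'M[R]_(p, q)) :
  smooth_on U f -> smooth_mx_on U F -> smooth_mx_on U (fun x => f x *: F x).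
Proof.
by move=> Uf UF i j; apply: smooth_eq (smoothM Uf (UF i j)) => y _; rewrite mxE.
Qed.

Lemma smooth_mxM p q r (F : 'rV[R]_m -> 'M[R]_(p, q)) (G : 'rV[R]_m -> 'M[R]_(q, r)) :
  smooth_mx_on U F -> smooth_mx_on U G -> smooth_mx_on U (fun x => F x *m G x).
Proof.
move=> UF UG i j.
have := @smooth_sum _ (index_enum 'I_q) (fun k x => F x i k * G x k j).
move=> H; apply: smooth_eq (H _) => [y _|k]; first by rewrite mxE.
exact: smoothM.
Qed.

Lemma smooth_trmx p q (F : 'rV[R]_m -> 'M[R]_(p, q)) :
  smooth_mx_on U F -> smooth_mx_on U (fun x => (F x)^T).
Proof. by move=> UF i j; apply: smooth_eq (UF j i) => y _; rewrite mxE. Qed.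

Lemma smooth_id : smooth_mx_on U id.
Proof.
by move=> i j; apply: smooth_eq (smooth_coord j) => y _; rewrite (ord1 i).
Qed.

Lemma smooth_mx_comp n p q (V : set 'rV[R]_n) (F : 'rV[R]_n -> 'M[R]_(p, q))
    (G : 'rV[R]_m -> 'rV[R]_n) :
  (forall x, U x -> V (G x)) -> smooth_mx_on V F -> smooth_mx_on U G ->
  smooth_mx_on U (fun x => F (G x)).
Proof. by move=> UV VF UG i j; exact: (smooth_comp UV (VF i j) UG). Qed.

Lemma smooth_det n (F : 'rV[R]_m -> 'M[R]_n) :
  smooth_mx_on U F -> smooth_on U (fun x => \det (F x)).
Proof.
move=> UF; apply: smooth_sum => s; apply: smoothM; first exact: smooth_cst.
by apply: smooth_prod => i; exact: UF.
Qed.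

Lemma smooth_invmx n (F : 'rV[R]_m -> 'M[R]_n) :
  (forall x, U x -> F x \in unitmx) -> smooth_mx_on U F ->
  smooth_mx_on U (fun x => invmx (F x)).
Proof.
move=> Fu UF; apply: (@smooth_mx_eq _ _ (fun x => (\det (F x))^-1 *: \adj (F x))).
  by move=> x Ux; rewrite /invmx Fu.
apply: smooth_mxZ => [|i j].
  apply: smoothV; last exact: smooth_det.
  by move=> x /Fu; rewrite unitmxE unitfE.
apply: (@smooth_eq (fun x => cofactor (F x) j i)) => [x _|]; first by rewrite mxE.
apply: smoothM; first exact: smooth_cst.
apply: smooth_det => k l.
by apply: (smooth_eq _ (UF (lift j k) (lift i l))) => x _; rewrite !mxE.
Qed.

Lemma smooth_mx_diff n (G : 'rV[R]_m -> 'rV[R]_n) x :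
  smooth_mx_on U G -> U x -> differentiable G x.
Proof.
by move=> UG Ux; apply: differentiable_rV => j; exact: (smooth_diff (UG _ _) Ux).
Qed.

Lemma smooth_jacobian n (G : 'rV[R]_m -> 'rV[R]_n) :
  smooth_mx_on U G -> smooth_mx_on U (fun x => 'J G x).
Proof.
move=> UG i j; have := smooth_partial i (UG 0 j).
by apply: smooth_eq => y Uy; rewrite jacobianE//; exact: smooth_mx_diff.
Qed.

Lemma smooth_differential f : smooth_on U f -> smooth_mx_on U (differential f).
Proof.
move=> Uf i j; have := smooth_partial i Uf.
by apply: smooth_eq => y Uy; rewrite mxE.
Qed.

End SmoothClosure.

Section MeanValue.
Variables (R : realType) (m : nat).
Implicit Types (f : 'rV[R]_m -> R) (x v : 'rV[R]_m).

Lemma is_derive_line f x v (s : R) : differentiable f (x + s *: v) ->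
  is_derive s 1 (fun s => f (x + s *: v)) ((v *m differential f (x + s *: v)) 0 0).
Proof.
move=> df.
have dl : is_diff s (fun s : R => x + s *: v) (fun h => h *: v).
  have := @is_diffD R R _ (cst x) (fun s => s *: v) _ _ s _ _.
  have /= := @is_diff_scalel R _ s v.
  move=> d1 /(_ _ _ (is_diff_cst x s) d1).
  rewrite /GRing.add/= => d; apply: is_diff_eq; apply/funext => h; exact: add0r.
have dc : differentiable (f \o (fun s => x + s *: v)) s.
  by apply: differentiable_comp => //; case: dl.
split; first exact: (@diff_derivable _ _ _ _ _ _ dc).
rewrite deriveE// (@diff_comp _ _ _ _ (fun s : R => x + s *: v) f)//.
by rewrite /= (@diff_val _ _ _ _ _ _ _ dl) scale1r diff_differential.
Qed.

Lemma MVT_line f x v :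
  (forall s : R, 0 <= s <= 1 -> differentiable f (x + s *: v)) ->
  exists2 s, 0 < s < 1 & f (x + v) - f x = (v *m differential f (x + s *: v)) 0 0.
Proof.
move=> df.
have dl (s : R) : 0 <= s <= 1 -> is_derive s 1 (fun s => f (x + s *: v))
    ((v *m differential f (x + s *: v)) 0 0).
  by move=> /df; exact: is_derive_line.
have [s s01||s s01] := @MVT R (fun s => f (x + s *: v))
    (fun s => (v *m differential f (x + s *: v)) 0 0) 0 1 ltr01.
- by apply: dl; move: s01; rewrite in_itv/= => /andP[/ltW -> /ltW ->].
- by apply: derivable_within_continuous => s; rewrite in_itv/= => /dl[].
by rewrite scale1r scale0r addr0 subr0 mulr1 => ->; exists s; move: s01; rewrite ?in_itv.
Qed.

Lemma ball_line x0 r x y (s : R) : ball x0 r x -> ball x0 r y -> 0 <= s <= 1 ->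
  ball x0 r (x + s *: (y - x)).
Proof.
rewrite -!ball_normE /= => xr yr /andP[s0 s1].
have -> : x0 - (x + s *: (y - x)) = (1 - s) *: (x0 - x) + s *: (x0 - y).
  by rewrite scalerBl scale1r !scalerBr opprD !opprB !addrA; apply/rowP => j; rewrite !mxE; ring.
apply: le_lt_trans (ler_normD _ _) _; rewrite !normrZ.
rewrite (ger0_norm s0) ger0_norm ?subr_ge0//.
have := normr_ge0 (x0 - x); have := normr_ge0 (x0 - y).
move: (`|x0 - x|) (`|x0 - y|) xr yr => a b ar br b0 a0.
have [sE|sN] := eqVneq s 0.
  by rewrite sE subr0 mul1r mul0r addr0.
have sp : 0 < s by rewrite lt_neqAle eq_sym sN.
have h1 : (1 - s) * a <= (1 - s) * r by rewrite ler_wpM2l ?subr_ge0// ltW.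
have h2 : s * b < s * r by rewrite ltr_pM2l.
by move: h1 h2; lra.
Qed.

Lemma sum_div_bound (a e : R) : 0 <= a -> 0 <= e ->
  \sum_(i < m) a * (2 * (e / (2 * m.+1%:R))) <= e * a.
Proof.
move=> a0 e0.
have -> : \sum_(i < m) a * (2 * (e / (2 * m.+1%:R))) = (e * a) * (m%:R / m.+1%:R).
  rewrite sumr_const card_ord -[LHS]mulr_natr.
  have : m.+1%:R != 0 :> R by rewrite pnatr_eq0.
  by move: (m.+1%:R) => M M0; field.
by rewrite ler_piMr ?mulr_ge0// ler_pdivrMr// mul1r ler_nat.
Qed.

Lemma strict_diff f x e : 0 < e ->
  (\forall y \near x, differentiable f y) ->
  (forall i, {for x, continuous (partial i f)}) ->
  exists2 r, 0 < r & forall u y z, ball x r u -> ball x r y -> ball x r z ->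
    `|f z - f y - ((z - y) *m differential f u) 0 0| <= e * `|z - y|.
Proof.
move=> e0 df cf.
pose d := e / (2 * m.+1%:R).
have d0 : 0 < d by rewrite divr_gt0// mulr_gt0.
have : \forall y \near x, differentiable f y /\
    forall i, `|partial i f x - partial i f y| < d.
  have cf' : \forall y \near x, forall i, `|partial i f x - partial i f y| < d.
    apply: (@filter_forall _ _ (fun i => [set y | `|partial i f x - partial i f y| < d]) (nbhs x)) => i.
    by have /cvgrPdist_lt/(_ d d0) := cf i.
  by move: df cf'; apply: filterS2 => y.
move=> /nbhs_ballP[r r0 rP]; exists r => // u y z xu xy xz.
have dyz (s : R) : 0 <= s <= 1 -> differentiable f (y + s *: (z - y)).
  by move=> s01; have [] := rP _ (ball_line xy xz s01).
have [s /andP[s0 s1]] := MVT_line dyz.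
rewrite [y + (z - y)]addrC subrK => ->.
have s01 : 0 <= s <= 1 by rewrite !ltW.
have [_ Hs] := rP _ (ball_line xy xz s01).
have [_ Hu] := rP _ xu.
rewrite !mxE -sumrB.
apply: le_trans (ler_norm_sum _ _ _) _.
apply: le_trans (sum_div_bound (normr_ge0 (z - y)) (ltW e0)); rewrite -/d; apply: ler_sum => i _.
rewrite !mxE -mulrBr normrM ler_pM//; first by have := coord_le_norm (z - y) 0 i; rewrite !mxE.
have := Hs i; have := Hu i.
move: (partial i f x) (partial i f u) (partial i f _) => a b c.
by rewrite !ltr_norml !ler_norml => /andP[? ?] /andP[? ?]; apply/andP; split; lra.
Qed.

End MeanValue.

(** * Symmetry of second derivatives *)

Section Schwarz.
Variables (R : realType) (m : nat).
Implicit Types (f : 'rV[R]_m -> R) (x : 'rV[R]_m).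

Let e_ (i : 'I_m) : 'rV[R]_m := delta_mx 0 i.

Lemma pairing_delta i (c : 'cV[R]_m) (h : R) : ((h *: e_ i) *m c) 0 0 = h * c i 0.
Proof. by rewrite -scalemxAl mxE -rowE mxE. Qed.

Let norm_e i : `|e_ i| <= 1.
Proof. by apply: norm_le_coord => // a b; rewrite mxE normr_nat; case: eqP; case: eqP. Qed.

Let second_diff f x i j h :=
  f (x + h *: e_ i + h *: e_ j) - f (x + h *: e_ i) - f (x + h *: e_ j) + f x.

Lemma second_diff_eps f x i j e : 0 < e ->
  (\forall y \near x, differentiable f y) ->
  differentiable (partial i f) x ->
  exists2 d, 0 < d & forall h : R, 0 < h < d ->
    `|second_diff f x i j h - h * h * partial j (partial i f) x| <= 3 * e * (h * h).
Proof.
move=> e0 /nbhs_ballP[r /= r0 rP] dg.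
have /nbhs_ballP[d /= d0 dP] := differential_eps dg e0.
exists (Num.min r d / 2) => [|h /andP[h0 hrd]].
  by rewrite divr_gt0// lt_min r0.
have hr : 2 * h < r by move: hrd; rewrite ltr_pdivlMr// lt_min mulrC => /andP[].
have hd : 2 * h < d by move: hrd; rewrite ltr_pdivlMr// lt_min mulrC => /andP[].
have nrm (s t : R) : 0 <= s <= h -> 0 <= t <= h -> `|s *: e_ i + t *: e_ j| <= s + t.
  move=> /andP[s0 _] /andP[t0 _]; apply: le_trans (ler_normD _ _) _.
  by rewrite !normrZ !ger0_norm// lerD// -[leRHS]mulr1 ler_wpM2l.
have inb (s t q : R) : 2 * h < q -> 0 <= s <= h -> 0 <= t <= h ->
    ball x q (x + s *: e_ i + t *: e_ j).
  move=> hq sh th; rewrite -ball_normE /= -addrA opprD addNKr normrN.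
  by apply: le_lt_trans (nrm _ _ sh th) _; move/andP: sh => [_ +]; move/andP: th => [_ +]; lra.
have h0h : 0 <= h <= h by rewrite ltW/=.
have z0h : 0 <= (0 : R) <= h by rewrite lexx ltW.
pose g := partial i f.
have dl (s : R) : 0 <= s <= 1 ->
    is_derive s 1 (fun s => f (x + h *: e_ j + s *: (h *: e_ i)) - f (x + s *: (h *: e_ i)))
     (h * g (x + h *: e_ j + s *: (h *: e_ i)) - h * g (x + s *: (h *: e_ i))).
  move=> /andP[s0 s1]; have sh : 0 <= s * h <= h.
    by rewrite mulr_ge0// ?(ltW h0)//= ler_piMl// ltW.
  have d1 : is_derive s 1 (fun s => f (x + h *: e_ j + s *: (h *: e_ i)))
      (h * g (x + h *: e_ j + s *: (h *: e_ i))).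
    have := @is_derive_line _ _ f (x + h *: e_ j) (h *: e_ i) s.
    rewrite pairing_delta mxE; apply; apply: rP.
    by rewrite scalerA addrAC; exact: inb.
  have d2 : is_derive s 1 (fun s => f (x + s *: (h *: e_ i)))
      (h * g (x + s *: (h *: e_ i))).
    have := @is_derive_line _ _ f x (h *: e_ i) s.
    rewrite pairing_delta mxE; apply; apply: rP.
    by rewrite scalerA -[_ + _]addr0 -(scale0r (e_ j)); exact: inb.
  exact: is_deriveB d1 d2.
have [s s01||s s01] := @MVT R
  (fun s => f (x + h *: e_ j + s *: (h *: e_ i)) - f (x + s *: (h *: e_ i)))
  (fun s => h * g (x + h *: e_ j + s *: (h *: e_ i)) - h * g (x + s *: (h *: e_ i)))
  0 1 ltr01.
- by apply: dl; move: s01; rewrite in_itv/= => /andP[/ltW -> /ltW ->].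
- by apply: derivable_within_continuous => s; rewrite in_itv/= => /dl[].
rewrite !scale1r !scale0r !addr0 subr0 mulr1 => E.
have {E} : second_diff f x i j h =
    h * g (x + h *: e_ j + s *: (h *: e_ i)) - h * g (x + s *: (h *: e_ i)).
  rewrite -E /second_diff [x + h *: e_ i + _]addrAC.
  by move: (f _) (f _) (f _) (f _) => a b c k; ring.
move=> ->.
have sh : 0 <= s * h <= h.
  move: s01; rewrite in_itv/= => /andP[s0 s1].
  by rewrite mulr_ge0// ?(ltW h0)// ?(ltW s0)//= ler_piMl// ltW.
have dP' u : ball x d (x + u) ->
    `|g (x + u) - g x - (u *m differential g x) 0 0| <= e * `|u|.
  by move=> /dP; rewrite [x + u]addrC addrK.
rewrite scalerA [x + h *: e_ j + _]addrAC -[x + _ + _]addrA.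
have b1 : ball x d (x + ((s * h) *: e_ i + h *: e_ j)) by rewrite addrA; exact: inb.
have := dP' _ b1.
have := dP' ((s * h) *: e_ i).
have := inb _ _ _ hd sh z0h; rewrite scale0r addr0 => b0 /(_ b0).
have n1 := nrm _ _ sh h0h; have n2 := nrm _ _ sh z0h.
rewrite scale0r addr0 in n2.
rewrite mulmxDl [(_ *m _ + _ *m _) 0 0]mxE !pairing_delta !mxE.
have m2 : e * `|(s * h) *: e_ i| <= e * h.
  by rewrite ler_wpM2l ?(ltW e0)//; move/andP: sh => [_]; move: n2; lra.
have m1 : e * `|(s * h) *: e_ i + h *: e_ j| <= e * (2 * h).
  by rewrite ler_wpM2l ?(ltW e0)//; move/andP: sh => [_]; move: n1; lra.
move=> /le_trans/(_ m2) A2 /le_trans/(_ m1) A1.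
move: A1 A2; move: (g _) (g _) (g x) (partial i g x) (partial j g x) => a b c p q.
move=> A1 A2.
have -> : h * b - h * a - h * h * q =
  h * ((b - c - (s * h * p + h * q)) - (a - c - s * h * p)) by ring.
rewrite normrM gtr0_norm// [leRHS]mulrCA ler_pM2l//.
apply: le_trans (ler_normB _ _) _.
by move: A1 A2; lra.
Qed.

Lemma partialC f x i j (U : set 'rV[R]_m) : open U -> smooth_on U f -> U x ->
  partial i (partial j f) x = partial j (partial i f) x.
Proof.
move=> Uo Uf Ux.
have df : \forall y \near x, differentiable f y.
  have := open_nbhs_nbhs (conj Uo Ux); apply: filterS => y Uy.
  exact: smooth_diff Uf Uy.
apply/eqP; rewrite -subr_eq0 -normr_le0; apply/ler_addgt0Pl => e e0.
rewrite addr0.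
have e6 : 0 < e / 6 by rewrite divr_gt0.
have [d1 d10 P1] := second_diff_eps j e6 df (smooth_diff (smooth_partial i Uf) Ux).
have [d2 d20 P2] := second_diff_eps i e6 df (smooth_diff (smooth_partial j Uf) Ux).
pose h := Num.min d1 d2 / 2.
have h0 : 0 < h by rewrite divr_gt0// lt_min d10.
have hd : h < Num.min d1 d2.
  by rewrite ltr_pdivrMr// ltr_pMr ?ltr1n// lt_min d10.
have := P1 h; have := P2 h.
move: hd; rewrite lt_min h0 => /andP[-> ->] /(_ isT) A2 /(_ isT) A1.
have E : second_diff f x j i h = second_diff f x i j h.
  rewrite /second_diff [x + h *: e_ i + _]addrAC.
  by move: (f _) (f _) (f _) (f _) => a b c k; ring.
rewrite E in A2; move: A1 A2; move: (second_diff _ _ _ _ _) => D.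
move: (partial j _ x) (partial i _ x) => a b A1 A2.
have hh : 0 < h * h by rewrite mulr_gt0.
rewrite -(ler_pM2l hh) -[in leLHS](gtr0_norm hh) -normrM.
have -> : h * h * (b - a) = (D - h * h * a) - (D - h * h * b) by ring.
apply: le_trans (ler_normB _ _) _.
by move: A1 A2; move: `|_| `|_| => u v; lra.
Qed.

End Schwarz.

(** * The Poincare lemma on a ball *)

Section Antiderivative.
Variable R : realType.

Lemma antiderivative (h : R -> R) : continuous h ->
  exists H : R -> R, forall s : R, 0 <= s <= 1 -> is_derive s 1 H (h s).
Proof.
move=> hc.
have hi : lebesgue_measure.-integrable `[-1, 2] (EFin \o h).
  apply: continuous_compact_integrable; first exact: segment_compact.
  by apply: continuous_subspaceT => x; exact: hc.
exists (fun x => (\int[lebesgue_measure]_(t in [set` `[(-1 : R), x]]) h t)%R).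
move=> s /andP[s0 s1].
have s2 : s < 2 by lra.
have s_1 : -1 < s by lra.
have [d dE] := continuous_FTC1_closed s2 hi s_1 (hc s).
split; [exact: d|exact: (etrans (esym (derive1E _ _)) dE)].
Qed.

Definition clamp (s : R) : R := if s < 0 then 0 else if 1 < s then 1 else s.

Lemma clamp01 s : 0 <= clamp s <= 1.
Proof. by rewrite /clamp; case: ltP => // s0; rewrite ?lexx ?ler01//; case: ltP => // s1; rewrite ?lexx ?ler01// s0. Qed.

Lemma clampE (s : R) : 0 <= s <= 1 -> clamp s = s.
Proof. by rewrite /clamp => /andP[s0 s1]; rewrite !ltNge s0 s1. Qed.

Lemma clamp_continuous : continuous clamp.
Proof.
move=> s; apply/cvgrPdist_le => e e0; near=> t.
have : `|s - t| <= e by near: t; exact: cvgr_dist_le.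
rewrite /clamp; case: (ltP s 0) => ?; case: (ltP t 0) => ?;
  case: (ltP 1 s) => ?; case: (ltP 1 t) => ?; rewrite !ler_norml => /andP[? ?];
  apply/andP; split; lra.
Unshelve. all: by end_near. Qed.

End Antiderivative.

Section Poincare.
Variables (R : realType) (m : nat).

Lemma smooth_of_differential (U : set 'rV[R]_m) (f : 'rV[R]_m -> R) w :
  open U -> (forall x, U x -> differentiable f x) ->
  (forall x, U x -> differential f x = w x) -> smooth_mx_on U w -> smooth_on U f.
Proof.
move=> Uo df fw Uw; apply/smooth_onP => -[|k]; split=> // i.
have /smooth_onP/(_ k) := Uw i 0.
by apply: (ck_eq Uo) => x /fw <-; rewrite mxE.
Qed.

Variables (x0 : 'rV[R]_m) (r : R) (w : 'rV[R]_m -> 'cV[R]_m).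
Let U := ball x0 r.
Hypotheses (ws : smooth_mx_on U w) (wc : closed_1form U w).

Let Uo : open U. Proof. exact: ball_open. Qed.

Let f (v z : 'rV[R]_m) : R := (v *m w z) 0 0.

Let fs v : smooth_on U (f v).
Proof. by apply: smooth_mxM => //; exact: smooth_mx_cst. Qed.

Let differential_f v z i : U z ->
  differential (f v) z i 0 = \sum_j v 0 j * partial i (fun y => w y j 0) z.
Proof.
move=> Uz; rewrite mxE.
have -> : f v = (fun z => \sum_j v 0 j * w z j 0) by apply/funext => y; rewrite /f mxE.
have d j : differentiable (fun y => w y j 0) z by exact: smooth_diff (ws j 0) Uz.
rewrite (@partial_sum _ _ _ _ i (fun j z => v 0 j * w z j 0) z _).2; last first.
  move=> j; apply: (@differentiableM _ _ (fun=> v 0 j) (fun z => w z j 0)).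
    exact: differentiable_cst.
  exact: d.
apply: eq_bigr => j _; rewrite (@partialM _ _ i (fun=> v 0 j) (fun z => w z j 0) z (differentiable_cst _ _) (d j)).
by rewrite partial_cst mul0r add0r.
Qed.

Let f_sym u v z : U z ->
  (u *m differential (f v) z) 0 0 = (v *m differential (f u) z) 0 0.
Proof.
move=> Uz; rewrite !mxE.
under eq_bigr => i _ do rewrite differential_f// mulr_sumr.
under [RHS]eq_bigr => i _ do rewrite differential_f// mulr_sumr.
rewrite exchange_big/=; apply: eq_bigr => i _; apply: eq_bigr => j _.
have /eqP := wc Uz i j; rewrite subr_eq0 => /eqP ->.
by rewrite mulrCA.
Qed.

Let path (x : 'rV[R]_m) (s : R) : 'rV[R]_m := x0 + s *: (x - x0).

Let U_path x (s : R) : U x -> 0 <= s <= 1 -> U (path x s).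
Proof.
move=> Ux s01; apply: ball_line => //; apply: ballxx.
by move: Ux; rewrite /U -ball_normE/=; exact: le_lt_trans.
Qed.

Let path_continuous x : continuous (path x).
Proof.
move=> s; rewrite /continuous_at /path; apply: cvgD; first exact: cvg_cst.
exact: scalel_continuous.
Qed.

Let antider x : U x -> exists H : R -> R, forall s : R, 0 <= s <= 1 ->
  is_derive s 1 H (f (x - x0) (path x s)).
Proof.
move=> Ux.
have [s|H HP] := @antiderivative R (fun s => f (x - x0) (path x (clamp s))).
  apply: (@continuous_comp _ _ _ (fun s => path x (clamp s)) (f (x - x0))).
    apply: (@continuous_comp _ _ _ (@clamp R) (path x)); first exact: clamp_continuous.
    exact: path_continuous.
  apply/differentiable_continuous/(smooth_diff (fs _)).
  by apply: U_path => //; exact: clamp01.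
by exists H => s s01; have := HP s s01; rewrite clampE.
Qed.

Let estimate (x : 'rV[R]_m) (e : R) (v : 'rV[R]_m) (s : R) :=
  [/\ U (path x s + s *: v),
    `|f (x - x0) (path x s + s *: v) - f (x - x0) (path x s)
      - s * (v *m differential (f (x - x0)) (path x s)) 0 0| <= e * `|v| &
    `|f v (path x s + s *: v) - f v (path x s)| <= e * `|v|].

Let uniform_estimate x e : U x -> 0 < e ->
  \forall v \near (0 : 'rV[R]_m), forall s : R, 0 <= s <= 1 -> estimate x e v s.
Proof.
move=> Ux e0.
have /compact_near_coveringP cov := @segment_compact R 0 1.
have : \forall v \near (0 : 'rV[R]_m),
    `[0%R : R, 1] `<=` (fun s : R => 0 <= s <= 1 -> estimate x e v s).
  apply: (cov 'rV[R]_m (nbhs (0 : 'rV[R]_m)) (fun v s => 0 <= s <= 1 -> estimate x e v s) (nbhs_filter _)) => s0.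
  rewrite /= in_itv/= => s01.
  set a := x - x0; set z0 := path x s0.
  have Uz0 : U z0 by exact: U_path.
  have [r1 r10 fr1] : exists2 r1, 0 < r1 & forall u y z,
      ball z0 r1 u -> ball z0 r1 y -> ball z0 r1 z ->
      `|f a z - f a y - ((z - y) *m differential (f a) u) 0 0| <= e * `|z - y|.
    apply: strict_diff => //.
      have := open_nbhs_nbhs (conj Uo Uz0); apply: filterS => y Uy.
      exact: smooth_diff (fs _) Uy.
    by move=> i; exact/differentiable_continuous/(smooth_diff (smooth_partial i (fs a))).
  pose e2 := e / (2 * m.+1%:R).
  have e20 : 0 < e2 by rewrite divr_gt0// mulr_gt0.
  have : \forall z \near z0, forall j, `|w z0 j 0 - w z j 0| < e2.
    apply: (@filter_forall _ _ (fun j => [set z | `|w z0 j 0 - w z j 0| < e2]) (nbhs z0)) => j.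
    have /differentiable_continuous := smooth_diff (ws j 0) Uz0.
    by move=> /cvgrPdist_lt/(_ _ e20).
  move=> /nbhs_ballP[r2 /= r20 wr2].
  have /nbhs_ballP[r3 /= r30 Ur3] : nbhs z0 U by exact: open_nbhs_nbhs.
  pose q := Num.min r1 (Num.min r2 r3).
  have q0 : 0 < q by rewrite !lt_min r10 r20 r30.
  have q20 : 0 < q / 2 by rewrite divr_gt0.
  have bq z : ball z0 q z -> [/\ ball z0 r1 z, ball z0 r2 z & ball z0 r3 z].
    by rewrite -!ball_normE /= !lt_min => /and3P[].
  exists ([set s | ball z0 (q / 2) (path x s)], ball 0 (q / 2)).
    split; last exact: nbhsx_ballx.
    exact: path_continuous (nbhsx_ballx _ _ q20).
  move=> [s v] [/= bs bv] s'01; rewrite /estimate.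
  have [s'0 s'1] := andP s'01.
  have vs : `|s *: v| <= `|v| by rewrite normrZ ger0_norm// ler_piMl.
  have bs1 : ball z0 q (path x s).
    by move: bs; rewrite -!ball_normE/= => /lt_le_trans; apply; rewrite ler_pdivrMr// ler_pMr// ler1n.
  have bs2 : ball z0 q (path x s + s *: v).
    move: bs bv; rewrite -!ball_normE/= sub0r normrN (opprD (path x s)) (addrA z0) => bs bv.
    apply: le_lt_trans (ler_normB _ _) _.
    by apply: le_lt_trans (lerD (lexx _) vs) _; rewrite [q]splitr; exact: ltrD bs bv.
  have [b11 b12 b13] := bq _ bs1; have [b21 b22 b23] := bq _ bs2.
  split; first exact: Ur3.
    have := fr1 (path x s) (path x s) (path x s + s *: v) b11 b11 b21.
    rewrite [path x s + s *: v]addrC addrK -scalemxAl [X in _ - X]mxE => /le_trans; apply.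
    by rewrite ler_wpM2l// ltW.
  rewrite /f !mxE -sumrB; apply: le_trans (ler_norm_sum _ _ _) _.
  apply: le_trans (sum_div_bound m (normr_ge0 v) (ltW e0)); rewrite -/e2; apply: ler_sum => j _.
  rewrite -mulrBr normrM ler_pM ?coord_le_norm//.
  have := wr2 _ b12 j; have := wr2 _ b22 j.
  move: (w z0 j 0) (w _ j 0) (w _ j 0) => A B C.
  by rewrite !ltr_norml !ler_norml => /andP[? ?] /andP[? ?]; apply/andP; split; lra.
by apply: filterS => v H s s01; apply: H => //; rewrite /= in_itv.
Qed.

Theorem poincare : exists2 P : 'rV[R]_m -> R, smooth_on U P &
  forall x, U x -> differential P x = w x.
Proof.
have /choice[K KP] : forall x, exists H : R -> R, U x -> forall s : R, 0 <= s <= 1 ->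
    is_derive s 1 H (f (x - x0) (path x s)).
  move=> x; have [Ux|nUx] := pselect (U x); last by exists (fun=> 0).
  by have [H HP] := antider Ux; exists H.
pose P x := K x 1 - K x 0.
have dP x : U x -> differentiable P x /\ differential P x = w x.
  move=> Ux; apply: eps_differential => e e0.
  have e20 : 0 < e / 2 by rewrite divr_gt0.
  have est : \forall y \near x, forall s : R, 0 <= s <= 1 -> estimate x (e / 2) (y - x) s.
    have := uniform_estimate Ux e20; rewrite (near_shift x).
    by apply: filterS => y /=; rewrite sub0r.
  have Un : \forall y \near x, U y by exact: open_nbhs_nbhs.
  near=> y.
  have Uy : U y by near: y.
  have esty : forall s : R, 0 <= s <= 1 -> estimate x (e / 2) (y - x) s by near: y.
  pose v := y - x; rewrite -/v in esty *.
  pose D s := K y s - K x s - s * f v (path x s).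
  pose D' s := f (y - x0) (path y s) - f (x - x0) (path x s)
     - (f v (path x s) + s * ((x - x0) *m differential (f v) (path x s)) 0 0).
  have DD (s : R) : 0 <= s <= 1 -> is_derive s 1 D (D' s).
    move=> s01; apply: is_deriveB; first exact: is_deriveB (KP y Uy s s01) (KP x Ux s s01).
    have dl : is_derive s 1 (fun s => f v (path x s))
        (((x - x0) *m differential (f v) (path x s)) 0 0).
      by apply: is_derive_line; apply: smooth_diff (fs _) _; exact: U_path.
    have := @is_deriveM R R^o id _ s 1 _ _ (is_derive_id s 1) dl.
    move=> dM; apply: (is_derive_eq dM) => /=.
    by rewrite addrC [_ *: 1]mulr1.
  have [s s01||s s01] := @MVT R D D' 0 1 ltr01.
  - by apply: DD; move: s01; rewrite in_itv/= => /andP[/ltW -> /ltW ->].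
  - by apply: derivable_within_continuous => s; rewrite in_itv/= => /DD[].
  rewrite subr0 mulr1 => E.
  have -> : P y - P x - (v *m w x) 0 0 = D' s.
    rewrite -E /D /P /f /path scale1r [x0 + _]addrC subrK.
    by move: (K _ _) (K _ _) (K _ _) (K _ _) ((v *m _) 0 0) ((v *m _) 0 0) => *; ring.
  have {}s01 : 0 <= s <= 1 by move: s01; rewrite in_itv/= => /andP[/ltW -> /ltW ->].
  have [U1 E1 E2] := esty s s01.
  have pyE : path y s = path x s + s *: v.
    by rewrite /path /v -addrA -scalerDr; congr (_ + _ *: _); rewrite [RHS]addrC addrA subrK.
  have fE z : f (y - x0) z = f (x - x0) z + f v z.
    have -> : y - x0 = (x - x0) + v by rewrite [RHS]addrC addrA subrK.
    by rewrite /f mulmxDl mxE.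
  rewrite /D' pyE fE f_sym; last exact: U_path.
  have -> : f (x - x0) (path x s + s *: v) + f v (path x s + s *: v)
      - f (x - x0) (path x s) - (f v (path x s)
        + s * (v *m differential (f (x - x0)) (path x s)) 0 0)
    = (f (x - x0) (path x s + s *: v) - f (x - x0) (path x s)
      - s * (v *m differential (f (x - x0)) (path x s)) 0 0)
      + (f v (path x s + s *: v) - f v (path x s)) by ring.
  apply: le_trans (ler_normD _ _) _; apply: le_trans (lerD E1 E2) _.
  by rewrite -mulrDl -splitr.
exists P => [|x Ux]; last by have [] := dP x Ux.
apply: (@smooth_of_differential U P w) => // x Ux; by have [] := dP x Ux.
Unshelve. all: by end_near. Qed.

End Poincare.

(** * The inverse function theorem *)

Lemma near_neq0 (R : realType) (V : topologicalType) (f : V -> R) x :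
  {for x, continuous f} -> f x != 0 -> \forall y \near x, f y != 0.
Proof.
move=> cf; rewrite -normr_gt0 => fx0.
have /cvgrPdist_lt/(_ _ fx0) := cf.
by apply: filterS => y; apply: contraTneq => ->; rewrite subr0 ltxx.
Qed.

HB.instance Definition _ (R : realType) (m n : nat) :=
  Uniform_isComplete.Build 'M[R]_(m, n) cauchy_cvg.

Lemma mulmx_bound (R : realType) m n p (B : 'M[R]_(n, p)) :
  exists2 a, 0 < a & forall v : 'M[R]_(m, n), `|v *m B| <= a * `|v|.
Proof.
exists (n%:R * `|B| + 1) => [|v]; first by rewrite ltr_wpDl// mulr_ge0.
by apply: le_trans (norm_mulmx _ _) _; rewrite mulrCA mulrC ler_wpM2r// lerDl.
Qed.

Lemma jacobian_is_diff (R : realType) m n (f : 'rV[R]_m -> 'rV[R]_n) x M :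
  is_diff x f (mulmxr M) -> 'J f x = M.
Proof. by case=> _ dE; apply/row_matrixP => i; rewrite !rowE mul_rV_lin1 dE. Qed.

Section InverseFunction.
Variables (R : realType) (n : nat).
Variables (U : set 'rV[R]_n) (G : 'rV[R]_n -> 'rV[R]_n) (x0 : 'rV[R]_n).
Hypotheses (Uo : open U) (Ux0 : U x0) (Gs : smooth_mx_on U G).
Hypothesis Gu : 'J G x0 \in unitmx.

Let A := invmx ('J G x0).
Let K (x : 'rV[R]_n) : 'rV[R]_n := x - G x *m A.

Let Ks : smooth_mx_on U K.
Proof.
apply: smooth_mxB => //; first exact: smooth_id.
by apply: smooth_mxM => //; exact: smooth_mx_cst.
Qed.

Let dG x : U x -> differentiable G x.
Proof. exact: smooth_mx_diff. Qed.

Let K0 j : differential (fun x => K x 0 j) x0 = 0.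
Proof.
apply/colP => i; rewrite !mxE.
have -> : (fun x => K x 0 j) = (fun x => x 0 j - \sum_k G x 0 k * A k j).
  by apply/funext => x; rewrite !mxE.
have dk k : differentiable (fun x => G x 0 k) x0 by exact: smooth_diff (Gs 0 k) Ux0.
have dA k : differentiable (fun x => G x 0 k * A k j) x0.
  exact: (@differentiableM _ _ (fun x => G x 0 k) (fun=> A k j) x0 (dk k) (differentiable_cst _ _)).
have [ds pE] := @partial_sum _ _ _ (index_enum 'I_n) i _ x0 dA.
rewrite partialB//; last exact: differentiable_coord.
rewrite pE partial_coord.
under eq_bigr => k _.
  rewrite (@partialM _ _ i (fun x => G x 0 k) (fun=> A k j) x0 (dk k) (differentiable_cst _ _)).
  rewrite partial_cst mulr0 addr0 -(jacobianE _ _ (dG Ux0)); over.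
have := mulmxV Gu; rewrite -/A => /matrixP/(_ i j); rewrite !mxE => ->.
by rewrite subrr.
Qed.

Let contracting : exists2 p, 0 < p & [/\ ball x0 p `<=` U,
  forall x, ball x0 p x -> 'J G x \in unitmx &
  forall y z, ball x0 p y -> ball x0 p z -> `|K z - K y| <= 2^-1 * `|z - y|].
Proof.
have /fin_all_exists2[q q0 qP] : forall j, exists2 r, 0 < r & forall u y z,
    ball x0 r u -> ball x0 r y -> ball x0 r z ->
    `|K z 0 j - K y 0 j - ((z - y) *m differential (fun x => K x 0 j) u) 0 0|
      <= 2^-1 * `|z - y|.
  move=> j; apply: strict_diff; first by rewrite invr_gt0.
    have := open_nbhs_nbhs (conj Uo Ux0); apply: filterS => y Uy.
    exact: smooth_diff (Ks 0 j) Uy.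
  by move=> i; apply/differentiable_continuous/(smooth_diff (smooth_partial i (Ks 0 j))).
have /nbhs_ballP[r1 /= r10 Ur1] : nbhs x0 U by exact: open_nbhs_nbhs.
have /nbhs_ballP[r2 /= r20 dr2] : \forall x \near x0, 'J G x \in unitmx.
  have ds : smooth_on U (fun x => \det ('J G x)).
    by apply: smooth_det => //; exact: smooth_jacobian.
  have D0 : \det ('J G x0) != 0 by rewrite -unitfE -unitmxE.
  have cd := differentiable_continuous (smooth_diff ds Ux0).
  have := near_neq0 cd D0.
  have det_unit (M : 'M[R]_n) : \det M != 0 -> M \in unitmx by rewrite unitmxE unitfE.
  by apply: filterS => x; exact: det_unit.
pose q' := \big[Num.min/Num.min r1 r2]_j q j.
have q'0 : 0 < q' by apply: lt_bigmin => //; rewrite lt_min r10.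
exists q'; first exact: q'0.
have le_q1 : q' <= Num.min r1 r2 by exact: bigmin_le_id.
have le_qj j : q' <= q j by exact: bigmin_le.
split=> [x bx|x bx|y z By Bz].
- by apply: Ur1; apply: le_ball bx; rewrite (le_trans le_q1)// ge_min lexx.
- by apply: dr2; apply: le_ball bx; rewrite (le_trans le_q1)// ge_min lexx orbT.
have B0 : ball x0 q' x0 by exact: ballxx.
apply: norm_le_coord => [|i j]; first by rewrite mulr_ge0// invr_ge0.
have := qP j x0 y z (le_ball (le_qj j) B0) (le_ball (le_qj j) By) (le_ball (le_qj j) Bz).
rewrite K0 mulmx0; have -> : (0 : 'M[R]_1) 0 0 = 0 by rewrite mxE.
rewrite subr0 (ord1 i).
by move: (K z) (K y) => u v; rewrite !mxE.
Qed.

Theorem inverse_function : exists (r : R) (f : 'rV[R]_n -> 'rV[R]_n),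
  [/\ 0 < r, smooth_mx_on (ball (G x0) r) f, f (G x0) = x0,
    forall y, ball (G x0) r y -> U (f y) /\ G (f y) = y &
    open (f @` ball (G x0) r)].
Proof.
have [p p0 [pU pJ pK]] := contracting.
have Au : A \in unitmx by rewrite unitmx_inv.
have inj x x' : ball x0 p x -> ball x0 p x' -> G x = G x' -> x = x'.
  move=> px px' GE; have := pK _ _ px' px.
  rewrite /K GE opprD opprK addrACA [- _ + _]addrC subrr addr0.
  move=> H; apply/eqP; rewrite -subr_eq0 -normr_le0.
  by have := normr_ge0 (x - x'); move: H; lra.
have [a a0 normA] := mulmx_bound 1 A.
pose r := p / (4 * a).
have r0 : 0 < r by rewrite divr_gt0// mulr_gt0.
pose C := [set x : 'rV[R]_n | `|x0 - x| <= p / 2].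
have CB : C `<=` ball x0 p.
  move=> x Cx; rewrite -ball_normE/=; apply: le_lt_trans Cx _.
  by rewrite ltr_pdivrMr// ltr_pMr// ltr1n.
have Cc : closed C.
  have -> : C = closed_ball_ Num.Def.normr x0 (p / 2) by [].
  exact: closed_closed_ball_.
have C0 : C x0 by rewrite /C/= subrr normr0 divr_ge0// ltW.
have TC y x : ball (G x0) r y -> C x -> `|x0 - (K x + y *m A)| < p / 2.
  move=> By Cx; have -> : x0 - (K x + y *m A) = (K x0 - K x) + (G x0 - y) *m A.
    rewrite /K mulmxBl; move: (G x0 *m A) (G x *m A) (y *m A) => u v w.
    by apply/rowP => j; rewrite !mxE; ring.
  apply: le_lt_trans (ler_normD _ _) _.
  have h1 := pK _ _ (CB _ Cx) (CB _ C0).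
  have h2 := normA (G x0 - y).
  have h3 : a * `|G x0 - y| < a * r by rewrite ltr_pM2l//; move: By; rewrite -ball_normE.
  have h4 : a * r = p / 4.
    rewrite /r; have : a != 0 by rewrite gt_eqF.
    by move: (a) => b b0; field.
  move: Cx; rewrite /C/= => Cx.
  move: h1 h2 h3 Cx; rewrite h4; move: `|_| `|_| `|_| `|_| => A1 A2 A3 A4.
  lra.
have ex y : ball (G x0) r y -> exists2 x, C x & G x = y.
  move=> By.
  have TCC : {homo (fun x => K x + y *m A) : x / C x}.
    by move=> x /(TC _ _ By)/ltW.
  pose T : {fun C >-> C} := mkfun_fun TCC.
  have [|x Cx xE] := @banach_fixed_point R 'rV[R]_n C T _ Cc (ex_intro _ x0 C0).
    exists (2^-1)%:nng; split => /=.
      by rewrite invf_lt1// ltr1n.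
    move=> [u v] [/= Cu Cv].
    by rewrite opprD addrACA subrr addr0; apply: pK; exact: CB.
  exists x => //; move: xE => /= /eqP.
  rewrite /K -subr_eq0 opprD opprD opprK !addrA subrr add0r -mulmxBl => /eqP H.
  have /(congr1 (mulmx^~ (invmx A))) := H; rewrite mulmxK// mul0mx => /eqP.
  by rewrite subr_eq0 => /eqP.
have /choice[f fP] : forall y, exists x, ball (G x0) r y -> C x /\ G x = y.
  move=> y; have [/ex[x Cx GE]|nB] := pselect (ball (G x0) r y); first by exists x.
  by exists x0.
exists r, f.
have fU y : ball (G x0) r y -> U (f y) by move=> /fP[/CB/pU].
have fB y : ball (G x0) r y -> ball x0 p (f y) by move=> /fP[/CB].
have Gf y : ball (G x0) r y -> G (f y) = y by move=> /fP[].
have Bo : open (ball (G x0) r) by exact: ball_open.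
have fK y y' : ball (G x0) r y -> ball (G x0) r y' ->
    `|f y - f y'| <= 2 * a * `|y - y'|.
  move=> By By'; have h1 := pK _ _ (fB _ By') (fB _ By).
  have h2 := normA (y - y').
  have : `|f y - f y'| <= `|K (f y) - K (f y')| + `|(y - y') *m A|.
    apply: le_trans (ler_normD _ _); rewrite /K !Gf// mulmxBl.
    rewrite le_eqVlt; apply/orP; left; apply/eqP; congr (`|_|).
    by move: (y *m A) (y' *m A) => u v; apply/rowP => j; rewrite !mxE; ring.
  move: h1 h2; move: `|K _ - _| `|f _ - _| `|_ *m _| `|y - _| => A1 A2 A3 A4; lra.
have dfE y : ball (G x0) r y -> is_diff y f (mulmxr (invmx ('J G (f y)))).
  move=> By; apply: is_diff_eps; first exact: mulmxr_continuous.
  move=> e e0.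
  set J := invmx _.
  have [b b0 normJ] := mulmx_bound 1 J.
  have e1 : 0 < e / (b * (2 * a)) by rewrite divr_gt0// mulr_gt0// mulr_gt0.
  have /nbhs_ballP[d /= d0 dP] := diff_eps (dG (fU _ By)) e1.
  have da : 0 < d / (2 * a) by rewrite divr_gt0// mulr_gt0.
  near=> y'.
  have By' : ball (G x0) r y' by near: y'; exact: open_nbhs_nbhs.
  have yy' : ball y (d / (2 * a)) y' by near: y'; exact: nbhsx_ballx.
  have ff := fK _ _ By' By.
  have fd : ball (f y) d (f y').
    rewrite -ball_normE/= distrC; apply: le_lt_trans ff _.
    rewrite mulrC -ltr_pdivlMr ?mulr_gt0//.
  have := dP _ fd; rewrite !Gf//.
  have -> : 'd G (f y) (f y' - f y) = (f y' - f y) *m 'J G (f y) by rewrite mul_rV_lin1.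
  move=> H.
  have -> : f y' - f y - mulmxr J (y' - y) =
      - ((y' - y - (f y' - f y) *m 'J G (f y)) *m J).
    have JJ : 'J G (f y) *m J = 1%:M by apply: mulmxV; apply: pJ; exact: fB.
    by rewrite [in RHS]mulmxBl -(mulmxA _ ('J G (f y))) JJ mulmx1 opprB.
  rewrite normrN; apply: le_trans (normJ _) _.
  have -> : e * `|y' - y| = b * (e / (b * (2 * a)) * (2 * a * `|y' - y|)).
    have : a != 0 by rewrite gt_eqF.
    have : b != 0 by rewrite gt_eqF.
    by move: (a) (b) (`|_|) => s t u t0 s0; field; rewrite s0 t0.
  rewrite (ler_pM2l b0); apply: le_trans H _; rewrite (ler_pM2l e1); exact: ff.
have fck k j : ck_on k (ball (G x0) r) (fun y => f y 0 j).
  elim: k j => [|k IH] j.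
    split=> // y By; have [df _] := dfE _ By; exact: differentiable_row.
  split=> [y By|i].
    by have [df _] := dfE _ By; exact: differentiable_row.
  have Js : smooth_mx_on (ball x0 p) (fun x => invmx ('J G x)).
    apply: smooth_invmx; [exact: ball_open|exact: pJ|].
    apply: smooth_jacobian; first exact: ball_open.
    by move=> s t; exact: smooth_sub pU (Gs s t).
  have := ck_comp Bo fB ((smooth_onP _ _).1 (Js i j) k) IH.
  apply: (ck_eq Bo) => y By.
  have [df _] := dfE _ By.
  by rewrite -(jacobianE _ _ df) (jacobian_is_diff (dfE _ By)).
split=> //.
- by move=> i j; apply/smooth_onP => k; rewrite (ord1 i).
- have B0 : ball (G x0) r (G x0) by exact: ballxx.
  by apply: inj; [exact: fB|exact: ballxx|exact: Gf].
- by move=> y By; split; [exact: fU|exact: Gf].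
have -> : f @` ball (G x0) r = ball x0 p `&` G @^-1` ball (G x0) r.
  apply/seteqP; split=> [_ [y By <-]|x [Bx BGx]]; first by split; [exact: fB|rewrite /= Gf].
  by exists (G x) => //; apply: inj => //; [exact: fB|exact: Gf].
rewrite openE => x [Bx BGx]; apply: filterI.
  by apply: open_nbhs_nbhs; split => //; exact: ball_open.
exact: (differentiable_continuous (dG (pU _ Bx))) (open_nbhs_nbhs (conj Bo BGx)).
Unshelve. all: by end_near. Qed.

End InverseFunction.

(** * The Levi-Civita connection *)

Section MatrixDerivative.
Variables (R : realType) (m : nat).
Implicit Types (x : 'rV[R]_m).

Definition mx_partial p q (i : 'I_m) (F : 'rV[R]_m -> 'M[R]_(p, q)) x : 'M[R]_(p, q) :=
  \matrix_(a, b) partial i (fun y => F y a b) x.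

Definition mx_diff p q (F : 'rV[R]_m -> 'M[R]_(p, q)) x : Prop :=
  forall a b, differentiable (fun y => F y a b) x.

Lemma smooth_mx_mx_diff U p q (F : 'rV[R]_m -> 'M[R]_(p, q)) x :
  smooth_mx_on U F -> U x -> mx_diff F x.
Proof. by move=> UF Ux a b; exact: smooth_diff (UF a b) Ux. Qed.

Lemma smooth_mx_partial U p q i (F : 'rV[R]_m -> 'M[R]_(p, q)) :
  open U -> smooth_mx_on U F -> smooth_mx_on U (mx_partial i F).
Proof.
move=> Uo UF a b; have := smooth_partial i (UF a b).
by apply: (smooth_eq Uo) => y _; rewrite mxE.
Qed.

Lemma mx_partial_open_eq U p q i (F G : 'rV[R]_m -> 'M[R]_(p, q)) x :
  open U -> (forall y, U y -> F y = G y) -> U x -> mx_partial i F x = mx_partial i G x.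
Proof.
move=> Uo FG Ux; apply/matrixP => a b; rewrite !mxE.
by apply: (open_eq_partial Uo) => // y /FG ->.
Qed.

Lemma mx_partial_cst p q i (A : 'M[R]_(p, q)) x : mx_partial i (fun=> A) x = 0.
Proof. by apply/matrixP => a b; rewrite !mxE partial_cst. Qed.

Lemma mx_partialD p q i (F G : 'rV[R]_m -> 'M[R]_(p, q)) x :
  mx_diff F x -> mx_diff G x ->
  mx_partial i (fun y => F y + G y) x = mx_partial i F x + mx_partial i G x.
Proof.
move=> dF dG; apply/matrixP => a b; rewrite !mxE -(partialD _ (dF a b) (dG a b)).
by congr (partial i _ x); apply/funext => y; rewrite mxE.
Qed.

Lemma mx_partialN p q i (F : 'rV[R]_m -> 'M[R]_(p, q)) x :
  mx_diff F x -> mx_partial i (fun y => - F y) x = - mx_partial i F x.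
Proof.
move=> dF; apply/matrixP => a b; rewrite !mxE -(partialN _ (dF a b)).
by congr (partial i _ x); apply/funext => y; rewrite mxE.
Qed.

Lemma mx_partialZ p q i (f : 'rV[R]_m -> R) (F : 'rV[R]_m -> 'M[R]_(p, q)) x :
  differentiable f x -> mx_diff F x ->
  mx_partial i (fun y => f y *: F y) x = partial i f x *: F x + f x *: mx_partial i F x.
Proof.
move=> df dF; apply/matrixP => a b; rewrite !mxE -(partialM _ df (dF a b)).
by congr (partial i _ x); apply/funext => y; rewrite mxE.
Qed.

Lemma mx_diffM p q r (F : 'rV[R]_m -> 'M[R]_(p, q)) (G : 'rV[R]_m -> 'M[R]_(q, r)) x :
  mx_diff F x -> mx_diff G x -> mx_diff (fun y => F y *m G y) x.
Proof.
move=> dF dG a b.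
have -> : (fun y => (F y *m G y) a b) =
    \sum_k (fun y => F y a k * G y k b).
  by apply/funext => y; rewrite fct_sumE mxE.
apply: differentiable_sum => k.
exact: (@differentiableM _ _ (fun y => F y a k) (fun y => G y k b) x (dF a k) (dG k b)).
Qed.

Lemma mx_partialM p q r i (F : 'rV[R]_m -> 'M[R]_(p, q)) (G : 'rV[R]_m -> 'M[R]_(q, r)) x :
  mx_diff F x -> mx_diff G x ->
  mx_partial i (fun y => F y *m G y) x = mx_partial i F x *m G x + F x *m mx_partial i G x.
Proof.
move=> dF dG; apply/matrixP => a b; rewrite !mxE.
have d k : differentiable (fun y => F y a k * G y k b) x.
  exact: (@differentiableM _ _ (fun y => F y a k) (fun y => G y k b) x (dF a k) (dG k b)).
have -> : (fun y => (F y *m G y) a b) = (fun y => \sum_k F y a k * G y k b).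
  by apply/funext => y; rewrite mxE.
rewrite (@partial_sum _ _ _ _ i _ x d).2 -big_split/=; apply: eq_bigr => k _.
by rewrite (partialM _ (dF a k) (dG k b)) !mxE.
Qed.

Lemma mx_partial_tr p q i (F : 'rV[R]_m -> 'M[R]_(p, q)) x :
  mx_partial i (fun y => (F y)^T) x = (mx_partial i F x)^T.
Proof.
apply/matrixP => a b; rewrite !mxE.
by congr (partial i _ x); apply/funext => y; rewrite mxE.
Qed.

Lemma mx_diff_tr p q (F : 'rV[R]_m -> 'M[R]_(p, q)) x :
  mx_diff F x -> mx_diff (fun y => (F y)^T) x.
Proof.
move=> dF a b; have := dF b a; congr (differentiable _ _).
by apply/funext => y; rewrite mxE.
Qed.

Lemma mx_diff_row n (F : 'rV[R]_m -> 'rV[R]_n) x : mx_diff F x -> differentiable F x.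
Proof. by move=> dF; apply: differentiable_rV. Qed.

Lemma row_jacobian n (F : 'rV[R]_m -> 'rV[R]_n) x i :
  mx_diff F x -> row i ('J F x) = mx_partial i F x.
Proof.
move=> /mx_diff_row dF; apply/rowP => j; rewrite !mxE -(jacobianE _ _ dF).
by rewrite mxE.
Qed.

Lemma mul_jacobian n (F : 'rV[R]_m -> 'rV[R]_n) x (v : 'rV[R]_m) :
  mx_diff F x -> v *m 'J F x = \sum_i v 0 i *: mx_partial i F x.
Proof.
move=> dF; rewrite mulmx_sum_row; apply: eq_bigr => i _.
by rewrite row_jacobian.
Qed.

End MatrixDerivative.

Lemma mx_partial_comp (R : realType) m k p q (F : 'rV[R]_m -> 'M[R]_(p, q))
    (f : 'rV[R]_k -> 'rV[R]_m) i w :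
  mx_diff F (f w) -> mx_diff f w ->
  mx_partial i (fun y => F (f y)) w = \sum_a mx_partial i f w 0 a *: mx_partial a F (f w).
Proof.
move=> dF /mx_diff_row df; apply/matrixP => a b; rewrite mxE summxE.
have [_ ->] := partial_comp i (dF a b) df.
by apply: eq_bigr => c _; rewrite !mxE.
Qed.

Section InnerProduct.
Variables (R : realType) (m : nat) (G : 'M[R]_m).

Definition ip (v w : 'rV[R]_m) : R := (v *m G *m w^T) 0 0.

Lemma ipDl u v w : ip (u + v) w = ip u w + ip v w.
Proof. by rewrite /ip !mulmxDl mxE. Qed.

Lemma ipDr u v w : ip w (u + v) = ip w u + ip w v.
Proof. by rewrite /ip linearD mulmxDr mxE. Qed.

Lemma ipNl v w : ip (- v) w = - ip v w.
Proof. by rewrite /ip !mulNmx mxE. Qed.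

Lemma ipNr v w : ip w (- v) = - ip w v.
Proof. by rewrite /ip linearN mulmxN mxE. Qed.

Lemma ipBl u v w : ip (u - v) w = ip u w - ip v w.
Proof. by rewrite ipDl ipNl. Qed.

Lemma ipBr u v w : ip w (u - v) = ip w u - ip w v.
Proof. by rewrite ipDr ipNr. Qed.

Lemma ipZl a v w : ip (a *: v) w = a * ip v w.
Proof. by rewrite /ip -!scalemxAl mxE. Qed.

Lemma ipZr a v w : ip w (a *: v) = a * ip w v.
Proof. by rewrite /ip linearZ/= -scalemxAr mxE. Qed.

Lemma ip0l w : ip 0 w = 0.
Proof. by rewrite /ip !mul0mx mxE. Qed.

Lemma ip0r w : ip w 0 = 0.
Proof. by rewrite /ip trmx0 mulmx0 mxE. Qed.

Lemma ip_suml (I : Type) (r : seq I) (F : I -> 'rV[R]_m) w :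
  ip (\sum_(i <- r) F i) w = \sum_(i <- r) ip (F i) w.
Proof. by elim/big_rec2: _ => [|i a b _ <-]; rewrite ?ip0l ?ipDl. Qed.

Lemma ip_sumr (I : Type) (r : seq I) (F : I -> 'rV[R]_m) w :
  ip w (\sum_(i <- r) F i) = \sum_(i <- r) ip w (F i).
Proof. by elim/big_rec2: _ => [|i a b _ <-]; rewrite ?ip0r ?ipDr. Qed.

Lemma ipC v w : G^T = G -> ip v w = ip w v.
Proof.
move=> Gs; have -> : ip v w = ((v *m G *m w^T)^T) 0 0 by rewrite [RHS]mxE.
by rewrite !trmx_mul Gs trmxK mulmxA.
Qed.

Lemma ip_delta i j : ip (delta_mx 0 i) (delta_mx 0 j) = G i j.
Proof. by rewrite /ip -rowE trmx_delta -colE !mxE. Qed.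

Lemma ip_basis v w : (forall i, ip v (delta_mx 0 i) = ip w (delta_mx 0 i)) ->
  forall z, ip v z = ip w z.
Proof.
move=> H z; rewrite (row_sum_delta z) !ip_sumr; apply: eq_bigr => i _.
by rewrite !ipZr H.
Qed.

Lemma ip_inj v w : G \in unitmx -> (forall z, ip v z = ip w z) -> v = w.
Proof.
move=> Gu H; apply: (can_inj (mulmxK Gu)); apply/rowP => j.
by have := H (delta_mx 0 j); rewrite /ip trmx_delta -!colE !mxE.
Qed.

End InnerProduct.

Lemma ipE (R : realType) m (G : 'M[R]_m) v w :
  ip G v w = \sum_j \sum_l v 0 j * w 0 l * G j l.
Proof.
rewrite {1}(row_sum_delta v) {1}(row_sum_delta w) ip_suml; apply: eq_bigr => j _.
rewrite ipZl ip_sumr mulr_sumr; apply: eq_bigr => l _.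
by rewrite ipZr ip_delta mulrA.
Qed.

Lemma partial_ip (R : realType) m n (g : 'rV[R]_m -> 'M[R]_n) Y Z i x :
  mx_diff g x -> mx_diff Y x -> mx_diff Z x ->
  partial i (fun y => ip (g y) (Y y) (Z y)) x =
    ip (mx_partial i g x) (Y x) (Z x) + ip (g x) (mx_partial i Y x) (Z x)
    + ip (g x) (Y x) (mx_partial i Z x).
Proof.
move=> dg dY dZ.
have E := @mx_partialM _ _ _ _ _ i _ _ x (mx_diffM dY dg) (mx_diff_tr dZ).
rewrite (mx_partialM i dY dg) mx_partial_tr in E.
have := congr1 (fun A : 'M[R]_1 => A 0 0) E.
by rewrite mxE => ->; rewrite mulmxDl !mxE /ip !mxE; congr (_ + _); rewrite addrC.
Qed.

Section LeviCivita.
Variables (R : realType) (m : nat) (g : 'rV[R]_m -> 'M[R]_m) (U : set 'rV[R]_m).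
Hypotheses (Uo : open U) (gs : smooth_mx_on U g).
Hypothesis gsym : forall x, U x -> (g x)^T = g x.
Hypothesis gunit : forall x, U x -> g x \in unitmx.

Let e_ (i : 'I_m) : 'rV[R]_m := delta_mx 0 i.

Definition lower_christoffel x (i j l : 'I_m) : R :=
  2^-1 * (partial i (fun y => g y j l) x + partial j (fun y => g y i l) x
     - partial l (fun y => g y i j) x).

Definition christoffel_row x i j : 'rV[R]_m := \row_k christoffel g x i j k.

Definition cov i (Y : 'rV[R]_m -> 'rV[R]_m) x : 'rV[R]_m :=
  mx_partial i Y x + \sum_j Y x 0 j *: christoffel_row x i j.

Lemma nablaE (X Y : 'rV[R]_m -> 'rV[R]_m) x : mx_diff Y x -> nabla g X Y x = \sum_i X x 0 i *: cov i Y x.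
Proof.
move=> dY; rewrite /nabla (mul_jacobian _ dY) /cov.
under [RHS]eq_bigr => i _ do rewrite scalerDr.
rewrite big_split/=; congr (_ + _); apply/rowP => k; rewrite summxE mxE.
apply: eq_bigr => i _; rewrite mxE summxE mulr_sumr; apply: eq_bigr => j _.
by rewrite !mxE -mulrA mulrC -mulrA.
Qed.

Lemma partial_sym i j l x : U x ->
  partial i (fun y => g y j l) x = partial i (fun y => g y l j) x.
Proof.
move=> Ux; apply: (open_eq_partial Uo) => // y Uy.
by rewrite -{1}(gsym Uy) mxE.
Qed.

Lemma christoffel_rowE x i j : U x ->
  christoffel_row x i j = (\row_l lower_christoffel x i j l) *m invmx (g x).
Proof.
move=> Ux; apply/rowP => k; rewrite !mxE /christoffel mulr_sumr.
apply: eq_bigr => l _; rewrite mxE /lower_christoffel.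
have -> : invmx (g x) k l = invmx (g x) l k.
  by rewrite -[in LHS](gsym Ux) -trmx_inv mxE.
by rewrite [RHS]mulrC mulrCA.
Qed.

Lemma ip_christoffel x i j l : U x ->
  ip (g x) (christoffel_row x i j) (e_ l) = lower_christoffel x i j l.
Proof.
move=> Ux; rewrite (christoffel_rowE i j Ux) /ip mulmxKV ?gunit//.
by rewrite trmx_delta -colE !mxE.
Qed.

Lemma christoffel_row_sym x i j : U x -> christoffel_row x i j = christoffel_row x j i.
Proof.
move=> Ux; apply: (ip_inj (gunit Ux)); apply: ip_basis => l.
rewrite !ip_christoffel// /lower_christoffel (partial_sym l i j Ux).
by congr (_ * (_ - _)); rewrite addrC.
Qed.

Lemma partial_metric x i j l : U x ->
  partial i (fun y => g y j l) x = lower_christoffel x i j l + lower_christoffel x i l j.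
Proof.
move=> Ux; rewrite /lower_christoffel (partial_sym i l j Ux).
by field.
Qed.

Lemma smooth_christoffel_row i j : smooth_mx_on U (fun x => christoffel_row x i j).
Proof.
have gis := smooth_invmx Uo gunit gs.
move=> a k; apply: (smooth_eq Uo (f := fun x => christoffel g x i j k)).
  by move=> y _; rewrite mxE.
apply: (smoothM Uo); first exact: smooth_cst.
apply: (smooth_sum Uo) => l; apply: (smoothM Uo); first exact: gis.
by apply: (smoothB Uo); [apply: (smoothD Uo)|]; exact/smooth_partial/gs.
Qed.

Lemma smooth_cov i Y : smooth_mx_on U Y -> smooth_mx_on U (cov i Y).
Proof.
move=> Ys; apply: (smooth_mxD Uo); first exact: smooth_mx_partial.
move=> a k; apply: (smooth_eq Uo (f := fun x => \sum_j Y x 0 j * christoffel_row x i j a k)).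
  move=> y _; rewrite summxE; apply: eq_bigr => j _.
  by move: (christoffel_row y i j) => u; rewrite mxE.
by apply: (smooth_sum Uo) => j; apply: (smoothM Uo); [exact: Ys|exact: smooth_christoffel_row].
Qed.

Lemma cov_open_eq i Y Z x : (forall y, U y -> Y y = Z y) -> U x ->
  cov i Y x = cov i Z x.
Proof. by move=> YZ Ux; rewrite /cov (mx_partial_open_eq i Uo YZ Ux) YZ. Qed.

Lemma cov_delta i j x : cov i (fun=> e_ j) x = christoffel_row x i j.
Proof.
rewrite /cov mx_partial_cst add0r (bigD1 j)//= mxE !eqxx scale1r big1 ?addr0// => l lj.
by rewrite mxE eqxx (negbTE lj) scale0r.
Qed.

Lemma covD i (Y Z : 'rV[R]_m -> 'rV[R]_m) x : mx_diff Y x -> mx_diff Z x ->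
  cov i (fun y => Y y + Z y) x = cov i Y x + cov i Z x.
Proof.
move=> dY dZ; rewrite /cov mx_partialD// addrACA -big_split/=; congr (_ + _).
by apply: eq_bigr => j _; rewrite mxE scalerDl.
Qed.

Lemma covZ i (f : 'rV[R]_m -> R) (Y : 'rV[R]_m -> 'rV[R]_m) x : differentiable f x -> mx_diff Y x ->
  cov i (fun y => f y *: Y y) x = partial i f x *: Y x + f x *: cov i Y x.
Proof.
move=> df dY; rewrite /cov mx_partialZ// scalerDr addrA scaler_sumr; congr (_ + _).
by apply: eq_bigr => j _; rewrite mxE scalerA.
Qed.

Lemma covN i (Y : 'rV[R]_m -> 'rV[R]_m) x : mx_diff Y x -> cov i (fun y => - Y y) x = - cov i Y x.
Proof.
move=> dY; rewrite /cov mx_partialN// opprD -sumrN; congr (_ + _).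
by apply: eq_bigr => j _; rewrite mxE scaleNr.
Qed.

Lemma ip_mx_partial_metric i x v w : U x ->
  ip (mx_partial i g x) v w =
  ip (g x) (\sum_j v 0 j *: christoffel_row x i j) w
  + ip (g x) v (\sum_j w 0 j *: christoffel_row x i j).
Proof.
move=> Ux; rewrite [LHS]ipE.
have -> : ip (g x) (\sum_j v 0 j *: christoffel_row x i j) w =
    \sum_j \sum_l v 0 j * w 0 l * lower_christoffel x i j l.
  rewrite ip_suml; apply: eq_bigr => j _; rewrite ipZl {1}(row_sum_delta w) ip_sumr mulr_sumr.
  by apply: eq_bigr => l _; rewrite ipZr ip_christoffel// mulrA.
have -> : ip (g x) v (\sum_j w 0 j *: christoffel_row x i j) =
    \sum_j \sum_l v 0 j * w 0 l * lower_christoffel x i l j.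
  rewrite {1}(row_sum_delta v) ip_suml; apply: eq_bigr => j _.
  rewrite ipZl ip_sumr mulr_sumr; apply: eq_bigr => l _.
  by rewrite ipZr (ipC _ _ (gsym Ux)) ip_christoffel// mulrA.
rewrite -big_split/=; apply: eq_bigr => j _; rewrite -big_split/=; apply: eq_bigr => l _.
by rewrite mxE partial_metric// mulrDr.
Qed.

Lemma partial_inner i (Y Z : 'rV[R]_m -> 'rV[R]_m) x : U x -> mx_diff Y x -> mx_diff Z x ->
  partial i (fun y => ip (g y) (Y y) (Z y)) x =
  ip (g x) (cov i Y x) (Z x) + ip (g x) (Y x) (cov i Z x).
Proof.
move=> Ux dY dZ; rewrite (partial_ip i (smooth_mx_mx_diff gs Ux) dY dZ).
by rewrite ip_mx_partial_metric// /cov ipDl ipDr; ring.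
Qed.

Lemma curl_inner i j (Y : 'rV[R]_m -> 'rV[R]_m) x : U x -> mx_diff Y x ->
  partial i (fun y => ip (g y) (Y y) (e_ j)) x
  - partial j (fun y => ip (g y) (Y y) (e_ i)) x =
  ip (g x) (cov i Y x) (e_ j) - ip (g x) (cov j Y x) (e_ i).
Proof.
move=> Ux dY.
have de l : mx_diff (fun=> e_ l) x by move=> a b; exact: differentiable_cst.
rewrite !partial_inner// !cov_delta (christoffel_row_sym i j Ux).
by ring.
Qed.

Lemma nabla_delta i (Y : 'rV[R]_m -> 'rV[R]_m) x : mx_diff Y x -> nabla g (fun=> e_ i) Y x = cov i Y x.
Proof.
move=> dY; rewrite nablaE// (bigD1 i)//= mxE !eqxx scale1r big1 ?addr0// => l li.
by rewrite mxE eqxx (negbTE li) scale0r.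
Qed.

Lemma mx_diff_open_eq p q (Y Z : 'rV[R]_m -> 'M[R]_(p, q)) x :
  (forall y, U y -> Y y = Z y) -> U x -> mx_diff Y x -> mx_diff Z x.
Proof.
move=> YZ Ux dY a b; apply: near_eq_differentiable (dY a b).
by apply: (near_eq_open Uo) => // y /YZ ->.
Qed.

Lemma curvature_delta i j Z x : smooth_mx_on U Z -> U x ->
  curvature g (fun=> e_ i) (fun=> e_ j) Z x = cov i (cov j Z) x - cov j (cov i Z) x.
Proof.
move=> Zs Ux.
have nE l y : U y -> nabla g (fun=> e_ l) Z y = cov l Z y.
  by move=> Uy; apply: nabla_delta; exact: smooth_mx_mx_diff Zs Uy.
have dn l : mx_diff (nabla g (fun=> e_ l) Z) x.
  apply: (@mx_diff_open_eq _ _ (cov l Z)) => //; first by move=> y /nE ->.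
  exact: smooth_mx_mx_diff (smooth_cov l Zs) Ux.
rewrite /curvature !nabla_delta// nablaE; last exact: smooth_mx_mx_diff Zs Ux.
rewrite [X in _ - X](_ : _ = 0) ?subr0; last first.
  apply: big1 => l _; rewrite /lie_bracket.
  have J0 k : 'J (fun=> e_ k) x = 0 :> 'M[R]_m.
    by apply/row_matrixP => a; rewrite row_jacobian ?mx_partial_cst ?row0.
  by rewrite (J0 i) (J0 j) !mulmx0 subrr mxE scale0r.
by congr (_ - _); apply: cov_open_eq => // y /nE ->.
Qed.

End LeviCivita.

Lemma mx_partialC (R : realType) m p q (U : set 'rV[R]_m)
    (f : 'rV[R]_m -> 'M[R]_(p, q)) i j x :
  open U -> smooth_mx_on U f -> U x ->
  mx_partial i (mx_partial j f) x = mx_partial j (mx_partial i f) x.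
Proof.
move=> Uo fs Ux.
have E i' j' a b : (mx_partial i' (mx_partial j' f) x) a b =
    partial i' (partial j' (fun y => f y a b)) x.
  by rewrite mxE; congr (partial i' _ x); apply/funext => y; rewrite mxE.
apply/matrixP => a b.
exact: (etrans (E i j a b) (etrans (partialC i j Uo (fs a b) Ux) (esym (E j i a b)))).
Qed.

Section Immersion.
Variables (R : realType) (m k : nat).
Variables (U : set 'rV[R]_m) (g : 'rV[R]_m -> 'M[R]_m).
Variables (W : set 'rV[R]_k) (f : 'rV[R]_k -> 'rV[R]_m).
Hypotheses (Uo : open U) (gs : smooth_mx_on U g).
Hypothesis gsym : forall x, U x -> (g x)^T = g x.
Hypothesis gunit : forall x, U x -> g x \in unitmx.
Hypotheses (Wo : open W) (fs : smooth_mx_on W f).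
Hypothesis fU : forall w, W w -> U (f w).

Let h w := 'J f w *m g (f w) *m ('J f w)^T.
Hypothesis hunit : forall w, W w -> h w \in unitmx.

Let F i w : 'rV[R]_m := mx_partial i f w.

Let df w : W w -> mx_diff f w.
Proof. exact: smooth_mx_mx_diff. Qed.

Let gf_s : smooth_mx_on W (fun w => g (f w)).
Proof. exact: smooth_mx_comp fU gs fs. Qed.

Lemma smooth_pullback_metric : smooth_mx_on W h.
Proof.
have Js := smooth_jacobian Wo fs.
by apply: smooth_mxM => //; [apply: smooth_mxM|apply: smooth_trmx].
Qed.

Lemma pullback_metric_sym w : W w -> (h w)^T = h w.
Proof. by move=> Ww; rewrite /h !trmx_mul trmxK gsym ?mulmxA//; exact: fU. Qed.

Lemma ip_pullback w v u : ip (h w) v u = ip (g (f w)) (v *m 'J f w) (u *m 'J f w).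
Proof. by rewrite /ip /h trmx_mul !mulmxA. Qed.

Let hE w i j : W w -> h w i j = ip (g (f w)) (F i w) (F j w).
Proof.
move=> Ww; rewrite -ip_delta ip_pullback -!rowE.
by rewrite !(row_jacobian _ (df Ww)).
Qed.

Let F_sym i j w : W w -> mx_partial i (F j) w = mx_partial j (F i) w.
Proof.
by move=> Ww; exact: mx_partialC Wo fs Ww.
Qed.

Let dF i w : W w -> mx_diff (F i) w.
Proof.
by move=> Ww; apply: (smooth_mx_mx_diff _ Ww); exact: smooth_mx_partial.
Qed.

Let G i j w : 'rV[R]_m :=
  \sum_a \sum_b (F i w 0 a * F j w 0 b) *: christoffel_row g (f w) a b.

Let G_sym i j w : W w -> G i j w = G j i w.
Proof.
move=> Ww; apply: (etrans (exchange_big _ _ _ _ _ _)) => /=.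
apply: eq_bigr => a _; apply: eq_bigr => b _.
congr (_ *: _); first exact: mulrC.
exact: (christoffel_row_sym Uo gsym gunit b a (fU Ww)).
Qed.

Let partial_h l i j w : W w ->
  partial l (fun y => h y i j) w =
  ip (g (f w)) (mx_partial l (F i) w + G l i w) (F j w)
  + ip (g (f w)) (F i w) (mx_partial l (F j) w + G l j w).
Proof.
move=> Ww.
rewrite (open_eq_partial Wo l (g := fun y => ip (g (f y)) (F i y) (F j y))) //; last first.
  by move=> y Wy; exact: hE.
have dgf : mx_diff (fun y => g (f y)) w by exact: smooth_mx_mx_diff gf_s Ww.
rewrite (partial_ip l dgf (dF i Ww) (dF j Ww)).
have -> : ip (mx_partial l (fun y => g (f y)) w) (F i w) (F j w) =
    ip (g (f w)) (G l i w) (F j w) + ip (g (f w)) (F i w) (G l j w).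
  have dg := smooth_mx_mx_diff gs (fU Ww).
  rewrite (mx_partial_comp l dg (df Ww)).
  have ip_sumG (r : seq 'I_m) c v u : ip (\sum_(a <- r) c a *: mx_partial a g (f w)) v u =
      \sum_(a <- r) c a * ip (mx_partial a g (f w)) v u.
    elim/big_rec2: _ => [|a y1 y2 _ <-]; first by rewrite /ip mulmx0 mul0mx mxE.
    by rewrite /ip mulmxDr mulmxDl mxE -scalemxAr -scalemxAl [in LHS]mxE.
  rewrite ip_sumG /G !(ip_suml, ip_sumr) -big_split/=; apply: eq_bigr => a _.
  rewrite (ip_mx_partial_metric Uo gsym gunit a _ _ (fU Ww)) mulrDr.
  congr (_ + _); rewrite !(ip_suml, ip_sumr) mulr_sumr; apply: eq_bigr => b _.
    by rewrite !ipZl mulrA.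
  by rewrite !ipZr mulrA.
by rewrite !(ipDl, ipDr); ring.
Qed.

Let christoffel_pullback i j l w : W w ->
  ip (h w) (christoffel_row h w i j) (delta_mx 0 l) =
  ip (g (f w)) (mx_partial i (F j) w + G i j w) (F l w).
Proof.
move=> Ww; rewrite (ip_christoffel pullback_metric_sym hunit i j l Ww).
have [A AE As] : exists2 A : 'I_k -> 'I_k -> 'rV[R]_m,
    (forall i j, A i j = mx_partial i (F j) w + G i j w) & forall i j, A i j = A j i.
  exists (fun i j => mx_partial i (F j) w + G i j w); first by [].
  by move=> i' j'; exact: (f_equal2 +%R (F_sym i' j' Ww) (G_sym i' j' Ww)).
have ph l' i' j' : partial l' (fun y => h y i' j') w =
    ip (g (f w)) (A l' i') (F j' w) + ip (g (f w)) (F i' w) (A l' j').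
  by rewrite !AE; exact: partial_h.
rewrite /lower_christoffel (ph i j l) (ph j i l) (ph l i j) -AE (As j i) (As l i) (As l j).
rewrite (ipC (F j w) _ (gsym (fU Ww))) (ipC (F i w) (A j l) (gsym (fU Ww))).
move: (ip _ (A i j) _) (ip _ (A i l) _) (ip _ (A j l) _) => a b c.
by field.
Qed.

Theorem cov_immersion i (Y : 'rV[R]_k -> 'rV[R]_k) (V : 'rV[R]_m -> 'rV[R]_m) w z :
  smooth_mx_on W Y -> smooth_mx_on U V ->
  (forall y, W y -> V (f y) = Y y *m 'J f y) -> W w ->
  ip (h w) (cov h i Y w) z =
  ip (g (f w)) (\sum_a ('J f w) i a *: cov g a V (f w)) (z *m 'J f w).
Proof.
move=> Ys Vs VY Ww.
have JE y j a : W y -> ('J f y) j a = F j y 0 a.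
  by move=> Wy; rewrite /F -(row_jacobian j (df Wy)) [RHS]mxE.
have mulJ u : u *m 'J f w = \sum_j u 0 j *: F j w by exact: mul_jacobian (df Ww).
have main l : ip (h w) (cov h i Y w) (delta_mx 0 l) =
    ip (g (f w)) (\sum_a ('J f w) i a *: cov g a V (f w)) (F l w).
  rewrite /cov ipDl ip_suml.
  under eq_bigr => j _ do rewrite ipZl (christoffel_pullback _ _ _ Ww) -ipZl.
  rewrite ip_pullback -rowE (row_jacobian _ (df Ww)) mulJ.
  rewrite -/(F l w) -ip_suml -ipDl; congr (ip _ _ _).
  under [RHS]eq_bigr => a _ do rewrite scalerDr.
  rewrite big_split/=.
  have -> : \sum_a ('J f w) i a *: mx_partial a V (f w) =
      \sum_j (mx_partial i Y w 0 j *: F j w + Y w 0 j *: mx_partial i (F j) w).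
    have dV := smooth_mx_mx_diff Vs (fU Ww).
    transitivity (mx_partial i (fun y => V (f y)) w).
      by rewrite (mx_partial_comp i dV (df Ww)); apply: eq_bigr => a _; rewrite JE.
    rewrite (mx_partial_open_eq i Wo VY Ww).
    have dJ : mx_diff (fun y => 'J f y) w.
      by apply: (smooth_mx_mx_diff _ Ww); exact: smooth_jacobian.
    have dY := smooth_mx_mx_diff Ys Ww.
    rewrite (mx_partialM i dY dJ) mulJ -[_ + _ *m _]/(_ + _) mulmx_sum_row -big_split/=.
    apply: eq_bigr => j _; congr (_ + _ *: _).
    apply/rowP => b; rewrite !mxE.
    by apply: (open_eq_partial Wo) => // y Wy; rewrite JE.
  rewrite big_split/= -addrA; congr (_ + _).
  under eq_bigr => j _ do rewrite scalerDr.
  rewrite big_split/=; congr (_ + _).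
  under [RHS]eq_bigr => a _.
    rewrite VY// mulJ scaler_sumr.
    under eq_bigr => b _.
      rewrite scalerA summxE mulr_sumr scaler_suml; over.
    rewrite exchange_big/=; over.
  rewrite [RHS]exchange_big/=; apply: eq_bigr => j _.
  rewrite /G scaler_sumr; apply: eq_bigr => a _.
  rewrite scaler_sumr; apply: eq_bigr => b _.
  have sE (c : R) (u : 'rV[R]_m) : (c *: u) 0 b = c * u 0 b by rewrite mxE.
  by rewrite scalerA JE// sE mulrCA.
rewrite (row_sum_delta z) mulmx_suml !ip_sumr; apply: eq_bigr => l _.
by rewrite -scalemxAl !ipZr main -rowE (row_jacobian _ (df Ww)).
Qed.

End Immersion.

(** * Para-contact structures and adopted frames *)

Section ParaContactAlgebra.
Variables (R : realType) (n : nat) (G F : 'M[R]_n) (xi : 'rV[R]_n).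
Hypothesis Gs : G^T = G.
Hypothesis FF : forall v : 'rV[R]_n, v *m F *m F = v - ip G xi v *: xi.
Hypothesis Fip : forall v w, ip G (v *m F) (w *m F) = - ip G v w + ip G xi v * ip G xi w.
Hypothesis xi1 : ip G xi xi = 1.

Let xi0 : xi != 0.
Proof. by apply: contra_eq_neq xi1 => ->; rewrite ip0l eq_sym oner_eq0. Qed.

Lemma xi_phi : xi *m F = 0.
Proof.
have u2 : xi *m F *m F = 0 by rewrite FF xi1 scale1r subrr.
have := FF (xi *m F); rewrite u2 mul0mx => /esym/eqP.
rewrite subr_eq0 => /eqP; move: (ip _ _ _) => c E.
move: u2; rewrite E -scalemxAl E scalerA => /eqP.
by rewrite scaler_eq0 (negbTE xi0) orbF mulf_eq0 orbb => /eqP ->; rewrite scale0r.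
Qed.

Lemma phi_perp_xi v : ip G xi (v *m F) = 0.
Proof.
have := FF (v *m F); rewrite (FF v) mulmxBl -scalemxAl xi_phi scaler0 subr0 => /eqP.
rewrite -subr_eq0 opprB addrC subrK scaler_eq0 (negbTE xi0) orbF => /eqP.
exact.
Qed.

Lemma phi_skew v w : ip G (v *m F) w = - ip G v (w *m F).
Proof.
have := Fip v (w *m F); rewrite FF phi_perp_xi mulr0 addr0 ipBr ipZr.
by rewrite (ipC (v *m F) xi Gs) phi_perp_xi mulr0 subr0.
Qed.

Lemma eigen_perp_xi s v : s * s = 1 -> v *m F = s *: v -> ip G xi v = 0.
Proof.
move=> s1 vF; have -> : v = s *: v *m F by rewrite -scalemxAl vF scalerA s1 scale1r.
exact: phi_perp_xi.
Qed.

Lemma eigen_isotropic s v w : s * s = 1 -> v *m F = s *: v -> w *m F = s *: w ->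
  ip G v w = 0.
Proof.
move=> s1 vF wF; have := phi_skew v w; rewrite vF wF ipZl ipZr => /eqP.
rewrite -subr_eq0 opprK -mulr2n mulrn_eq0 mulf_eq0 /= => /orP[/eqP s0|/eqP//].
by move: s1; rewrite s0 mul0r => /eqP; rewrite eq_sym oner_eq0.
Qed.

Definition eigen_proj (s : R) (v : 'rV[R]_n) : 'rV[R]_n :=
  2^-1 *: (v *m F *m F + s *: (v *m F)).

Lemma eigen_projE s v : s * s = 1 -> eigen_proj s v *m F = s *: eigen_proj s v.
Proof.
move=> s1; have F3 : v *m F *m F *m F = v *m F.
  by rewrite (FF v) mulmxBl -scalemxAl xi_phi scaler0 subr0.
rewrite /eigen_proj -!scalemxAl mulmxDl -scalemxAl F3.
rewrite [RHS]scalerA [s * _]mulrC -[RHS]scalerA; congr (_ *: _).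
by rewrite scalerDr scalerA s1 scale1r addrC.
Qed.

Lemma ip_eigen_proj s v w : s * s = 1 -> v *m F = - s *: v ->
  ip G v (eigen_proj s w) = ip G v w.
Proof.
move=> s1 vF; have wF u : ip G v (u *m F) = s * ip G v u.
  apply: oppr_inj; rewrite -phi_skew vF ipZl mulNr.
  by [].
rewrite /eigen_proj ipZr ipDr ipZr !wF !mulrA s1 mul1r.
by field.
Qed.

End ParaContactAlgebra.

Section AdoptedFrame.
Variables (R : realType) (G : 'M[R]_5) (V : 'I_5 -> 'rV[R]_5).
Hypothesis VG : forall i j, ip G (V i) (V j) = adopted_gram R i j.

Lemma I5_cases (P : 'I_5 -> Prop) : P 0 -> P 1 -> P 2 -> P 3 -> P 4 -> forall i, P i.
Proof.
move=> P0 P1 P2 P3 P4 [[|[|[|[|[|//]]]]] Hi].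
- by rewrite (_ : Ordinal Hi = 0)//; apply: val_inj.
- by rewrite (_ : Ordinal Hi = 1)//; apply: val_inj.
- by rewrite (_ : Ordinal Hi = 2)//; apply: val_inj.
- by rewrite (_ : Ordinal Hi = 3)//; apply: val_inj.
- by rewrite (_ : Ordinal Hi = 4)//; apply: val_inj.
Qed.

Lemma sum5 (W : nmodType) (h : 'I_5 -> W) : \sum_i h i = h 0 + h 1 + h 2 + h 3 + h 4.
Proof.
rewrite !big_ord_recl big_ord0 addr0 !addrA.
by congr (_ + _ + _ + _ + _); congr (h _); apply: val_inj.
Qed.

Lemma adopted_gram_invol : adopted_gram R *m adopted_gram R = 1%:M.
Proof.
apply/matrixP => i j; rewrite mxE sum5 !mxE.
by elim/I5_cases: i; elim/I5_cases: j; rewrite /= ?(mulr0, mulr1, mul0r, add0r, addr0).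
Qed.

Let VM : 'M[R]_5 := \matrix_i V i.

Let VM_gram : VM *m G *m VM^T = adopted_gram R.
Proof.
apply/matrixP => i j; rewrite -(VG i j) -ip_delta /ip !mulmxA -mulmxA.
by rewrite -trmx_mul -!rowE !rowK.
Qed.

Lemma frame_ext v w : (forall i, ip G v (V i) = ip G w (V i)) -> v = w.
Proof.
move=> H; have Gu : G *m VM^T \in unitmx.
  have := VM_gram; rewrite -mulmxA => E.
  have : VM *m (G *m VM^T) \in unitmx.
    by rewrite E; exact: (mulmx1_unit adopted_gram_invol).1.
  by rewrite unitmx_mul => /andP[].
have E u i : (u *m (G *m VM^T)) 0 i = ip G u (V i).
  rewrite mulmxA [LHS]mxE /ip [RHS]mxE; apply: eq_bigr => k _; congr (_ * _).
  by rewrite !mxE.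
by apply: (can_inj (mulmxK Gu)); apply/rowP => i; rewrite !E.
Qed.

Lemma frame_decomposition v :
  v = ip G v (V 0) *: V 0 + ip G v (V 3) *: V 1 + ip G v (V 4) *: V 2
    + ip G v (V 1) *: V 3 + ip G v (V 2) *: V 4.
Proof.
apply: frame_ext => i; rewrite !ipDl !ipZl !VG !mxE.
by elim/I5_cases: i; rewrite /= ?(mulr0, mulr1, addr0, add0r).
Qed.

End AdoptedFrame.

Section FlatTensor.
Variables (R : realType) (m : nat) (g : 'rV[R]_m -> 'M[R]_m) (U : set 'rV[R]_m).
Hypotheses (Uo : open U) (gs : smooth_mx_on U g).
Hypothesis gsym : forall x, U x -> (g x)^T = g x.
Hypothesis gunit : forall x, U x -> g x \in unitmx.

Let e_ (i : 'I_m) : 'rV[R]_m := delta_mx 0 i.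

Hypothesis flat_basis : forall x i j l, U x ->
  cov g i (cov g j (fun=> e_ l)) x = cov g j (cov g i (fun=> e_ l)) x.

Let smooth_e l : smooth_mx_on U (fun=> e_ l).
Proof. exact: smooth_mx_cst. Qed.

Let cov_sum i (I : Type) (r : seq I) (Y : I -> 'rV[R]_m -> 'rV[R]_m) x :
  (forall k, smooth_mx_on U (Y k)) -> U x ->
  smooth_mx_on U (fun y => \sum_(k <- r) Y k y) /\
  cov g i (fun y => \sum_(k <- r) Y k y) x = \sum_(k <- r) cov g i (Y k) x.
Proof.
move=> Ys Ux; elim: r => [|k r [IHs IHc]].
  have -> : (fun y => \sum_(k <- [::]) Y k y) = (fun=> 0).
    by apply/funext => y; rewrite big_nil.
  split; first exact: smooth_mx_cst.
  rewrite big_nil /cov mx_partial_cst add0r big1// => j _.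
  by move: (christoffel_row _ _ _ _) => v; rewrite mxE scale0r.
have -> : (fun y => \sum_(k <- k :: r) Y k y) = (fun y => Y k y + \sum_(k <- r) Y k y).
  by apply/funext => y; rewrite big_cons.
split; first exact: smooth_mxD.
rewrite big_cons -IHc; apply: covD; first exact: smooth_mx_mx_diff (Ys k) Ux.
exact: smooth_mx_mx_diff IHs Ux.
Qed.

Lemma cov_comm i j Z x : smooth_mx_on U Z -> U x ->
  cov g i (cov g j Z) x = cov g j (cov g i Z) x.
Proof.
move=> Zs Ux.
have Zl_s l : smooth_on U (fun y => Z y 0 l) by exact: Zs.
have ce_s i' l : smooth_mx_on U (cov g i' (fun=> e_ l)) by exact: smooth_cov.
have cZ i' y : U y -> cov g i' Z y =
    \sum_l (partial i' (fun y => Z y 0 l) y *: e_ l + Z y 0 l *: cov g i' (fun=> e_ l) y).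
  move=> Uy; have -> : Z = (fun y => \sum_l Z y 0 l *: e_ l).
    by apply/funext => z; exact: row_sum_delta.
  have Ys l : smooth_mx_on U (fun y => Z y 0 l *: e_ l) by exact: smooth_mxZ.
  rewrite (cov_sum i' (index_enum 'I_m) Ys Uy).2; apply: eq_bigr => l _.
  have dZl : differentiable (fun y => (\sum_l0 Z y 0 l0 *: e_ l0) 0 l) y.
    by apply: (smooth_diff _ Uy); apply: (smooth_eq Uo _ (Zl_s l)) => z _; rewrite -row_sum_delta.
  have dZl' := smooth_diff (Zl_s l) Uy.
  rewrite (covZ g i' dZl' (smooth_mx_mx_diff (smooth_e l) Uy)).
  have EZ : (fun y => (\sum_l0 Z y 0 l0 *: e_ l0) 0 l) = (fun y => Z y 0 l).
    by apply/funext => z; rewrite -row_sum_delta.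
  by rewrite EZ -row_sum_delta.
pose T j' l y := partial j' (fun y => Z y 0 l) y *: e_ l
  + Z y 0 l *: cov g j' (fun=> e_ l) y.
have Ts j' l : smooth_mx_on U (T j' l).
  by apply: smooth_mxD => //; apply: smooth_mxZ => //; exact: smooth_partial.
have cc i' j' : cov g i' (cov g j' Z) x = \sum_l
   (partial i' (partial j' (fun y => Z y 0 l)) x *: e_ l
    + partial j' (fun y => Z y 0 l) x *: cov g i' (fun=> e_ l) x
    + (partial i' (fun y => Z y 0 l) x *: cov g j' (fun=> e_ l) x
       + Z x 0 l *: cov g i' (cov g j' (fun=> e_ l)) x)).
  rewrite (cov_open_eq g Uo i' (cZ j') Ux).
  rewrite (cov_sum i' (index_enum 'I_m) (Ts j') Ux).2; apply: eq_bigr => l _.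
  have dZl := smooth_diff (Zl_s l) Ux.
  have dpZ := smooth_diff (smooth_partial j' (Zl_s l)) Ux.
  have de := smooth_mx_mx_diff (smooth_e l) Ux.
  have dce := smooth_mx_mx_diff (ce_s j' l) Ux.
  rewrite /T covD; last 2 first.
  - apply: (smooth_mx_mx_diff _ Ux); apply: smooth_mxZ => //; exact: smooth_partial.
  - by apply: (smooth_mx_mx_diff _ Ux); exact: smooth_mxZ.
  by rewrite (covZ g i' dpZ de) (covZ g i' dZl dce).
have comb (a b p q z : R) (e C D A B : 'rV[R]_m) : a = b -> A = B ->
    a *: e + q *: C + (p *: D + z *: A) = b *: e + p *: D + (q *: C + z *: B).
  by move=> -> ->; rewrite -!addrA; congr (_ + _); rewrite addrCA.
apply: (etrans (cc i j)); apply: (etrans _ (esym (cc j i))).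
apply: eq_bigr => l _.
exact: (comb _ _ _ _ _ _ _ _ _ _ (partialC i j Uo (Zl_s l) Ux) (flat_basis i j l Ux)).
Qed.

End FlatTensor.

Section LocalStructure.
Variable R : realType.

(* Flatness is only recorded for the coordinate fields, see [cov_comm]. *)
Record local_structure (U : set 'rV[R]_5) (g phi : 'rV[R]_5 -> 'M[R]_5)
    (xi : 'rV[R]_5 -> 'rV[R]_5) (eta : 'rV[R]_5 -> 'cV[R]_5) : Prop := LocalStructure {
  ls_open : open U;
  ls_g : smooth_mx_on U g;
  ls_phi : smooth_mx_on U phi;
  ls_xi : smooth_mx_on U xi;
  ls_eta : smooth_mx_on U eta;
  ls_sym : forall x, U x -> (g x)^T = g x;
  ls_unit : forall x, U x -> g x \in unitmx;
  ls_sqr : forall x, U x -> forall v,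
    v *m phi x *m phi x = v - ip (g x) (xi x) v *: xi x;
  ls_compat : forall x, U x -> forall v w,
    ip (g x) (v *m phi x) (w *m phi x)
      = - ip (g x) v w + ip (g x) (xi x) v * ip (g x) (xi x) w;
  ls_norm : forall x, U x -> ip (g x) (xi x) (xi x) = 1;
  ls_dual : forall x, U x -> forall v, (v *m eta x) 0 0 = ip (g x) (xi x) v;
  ls_closed : closed_1form U eta;
  ls_closed2 : closed_2form U (fun x => phi x *m g x);
  ls_flat : forall x i j l, U x ->
    cov g i (cov g j (fun=> delta_mx 0 l)) x = cov g j (cov g i (fun=> delta_mx 0 l)) x }.

Lemma smooth_mx_sub m p q (U U' : set 'rV[R]_m) (F : 'rV[R]_m -> 'M[R]_(p, q)) :
  U' `<=` U -> smooth_mx_on U F -> smooth_mx_on U' F.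
Proof. by move=> sU Fs i j; exact: smooth_sub sU (Fs i j). Qed.

Lemma local_structure_sub U U' g phi xi eta : open U' -> U' `<=` U ->
  local_structure U g phi xi eta -> local_structure U' g phi xi eta.
Proof.
move=> U'o sU [Uo gs phis xis etas gsym gu sq co no du c1 c2 fl].
have sm := smooth_mx_sub sU.
split; first exact: U'o.
- exact: sm.
- exact: sm.
- exact: sm.
- exact: sm.
- by move=> x /sU; exact: gsym.
- by move=> x /sU; exact: gu.
- by move=> x /sU; exact: sq.
- by move=> x /sU; exact: co.
- by move=> x /sU; exact: no.
- by move=> x /sU; exact: du.
- by move=> x /sU; exact: c1.
- by move=> x /sU; exact: c2.
- by move=> x i j l /sU; exact: fl.
Qed.

End LocalStructure.

(** * Para-Kaehler leaves and the fundamental form *)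

Section JacobianTools.
Variable R : realType.

Lemma jacobian_comp m n p (F : 'rV[R]_m -> 'rV[R]_n) (G : 'rV[R]_n -> 'rV[R]_p) y :
  mx_diff F y -> mx_diff G (F y) ->
  'J (fun z => G (F z)) y = 'J F y *m 'J G (F y).
Proof.
move=> dF dG.
have dGF : mx_diff (fun z => G (F z)) y.
  move=> a b; apply: (@differentiable_comp _ _ _ _ F (fun x => G x a b)) => //.
  exact: mx_diff_row.
apply/row_matrixP => i; rewrite row_mul !row_jacobian//.
by rewrite (mx_partial_comp i dG dF) mul_jacobian.
Qed.

Lemma jacobian_open_eq m n (U : set 'rV[R]_m) (F G : 'rV[R]_m -> 'rV[R]_n) y :
  open U -> (forall x, U x -> F x = G x) -> U y -> mx_diff F y -> 'J F y = 'J G y.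
Proof.
move=> Uo FG Uy dF; have dG := mx_diff_open_eq Uo FG Uy dF.
apply/row_matrixP => i.
exact: (etrans (row_jacobian i dF)
  (etrans (mx_partial_open_eq i Uo FG Uy) (esym (row_jacobian i dG)))).
Qed.

Lemma mx_partial_id m i (x : 'rV[R]_m) : mx_partial i id x = delta_mx 0 i.
Proof.
apply/matrixP => a b; rewrite !mxE (ord1 a) eqxx /=.
by rewrite (partial_coord i b x) eq_sym.
Qed.

Lemma mx_diff_id m (x : 'rV[R]_m) : mx_diff id x.
Proof. by move=> a b; rewrite (ord1 a); exact: differentiable_coord. Qed.

Lemma jacobian_id m (x : 'rV[R]_m) : 'J id x = 1%:M.
Proof.
apply/row_matrixP => i; rewrite row_jacobian; last exact: mx_diff_id.
by rewrite mx_partial_id row1.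
Qed.

Lemma jacobian_inverse m (U : set 'rV[R]_m) (F G : 'rV[R]_m -> 'rV[R]_m) y :
  open U -> (forall x, U x -> G (F x) = x) -> U y -> mx_diff F y -> mx_diff G (F y) ->
  'J F y *m 'J G (F y) = 1%:M.
Proof.
move=> Uo GF Uy dF dG.
have GF' x : U x -> x = G (F x) by move=> /GF.
exact: (etrans (esym (jacobian_comp dF dG))
  (etrans (esym (jacobian_open_eq Uo GF' Uy (mx_diff_id y))) (jacobian_id y))).
Qed.

Lemma differential_comp m n (F : 'rV[R]_m -> 'rV[R]_n) (h : 'rV[R]_n -> R) y :
  mx_diff F y -> differentiable h (F y) ->
  differential (fun z => h (F z)) y = 'J F y *m differential h (F y).
Proof.
move=> dF dh; apply/colP => i; rewrite !mxE.
have [_ ->] := partial_comp i dh (mx_diff_row dF).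
by apply: eq_bigr => j _; rewrite (jacobianE _ _ (mx_diff_row dF)) !mxE.
Qed.

Lemma unitmx_ker n (A : 'M[R]_n) :
  (forall v : 'rV[R]_n, v *m A = 0 -> v = 0) -> A \in unitmx.
Proof.
move=> H; rewrite -row_free_unit -kermx_eq0; apply/eqP/row_matrixP => i.
by rewrite row0; apply: H; rewrite -row_mul mulmx_ker row0.
Qed.

End JacobianTools.

Definition parallel_leaves (R : realType) (C : set 'rV[R]_5)
    (g phi : 'rV[R]_5 -> 'M[R]_5) (eta : 'rV[R]_5 -> 'cV[R]_5) : Prop :=
  forall (W : set 'rV[R]_4) (f : 'rV[R]_4 -> 'rV[R]_5)
    (P : 'rV[R]_4 -> 'M[R]_4),
  [/\ open W, smooth_mx_on W f, f @` W `<=` C,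
    forall w, W w -> row_free ('J f w) &
    forall w, W w -> 'J f w *m eta (f w) = 0] ->
  (forall w, W w -> P w *m 'J f w = 'J f w *m phi (f w)) ->
  forall X Y : 'rV[R]_4 -> 'rV[R]_4, smooth_mx_on W X -> smooth_mx_on W Y ->
  forall w, W w ->
    nabla (fun w => 'J f w *m g (f w) *m ('J f w)^T) X (fun y => Y y *m P y) w
    = nabla (fun w => 'J f w *m g (f w) *m ('J f w)^T) X Y w *m P w.

Section Leaf.
Variable R : realType.
Variables (C U : set 'rV[R]_5) (g phi : 'rV[R]_5 -> 'M[R]_5).
Variables (xi : 'rV[R]_5 -> 'rV[R]_5) (eta : 'rV[R]_5 -> 'cV[R]_5).
Hypotheses (ls : local_structure U g phi xi eta) (UC : U `<=` C).
Hypothesis leaves : parallel_leaves C g phi eta.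

Variables (t : 'rV[R]_5 -> R).
Hypotheses (ts : smooth_on U t) (dt : forall x, U x -> differential t x = eta x).

Let Uo := ls_open ls.

(* Replacing the coordinate i0 by t straightens the foliation wherever the
   component i0 of eta = dt does not vanish. *)
Let straighten (i0 : 'I_5) (y : 'rV[R]_5) : 'rV[R]_5 :=
  y + (t y - y 0 i0) *: delta_mx 0 i0.

Let insert (i0 : 'I_5) (t0 : R) (w : 'rV[R]_4) : 'rV[R]_5 :=
  \row_j oapp (fun b => w 0 b) t0 (unlift i0 j).

Let E (i0 : 'I_5) : 'M[R]_(5, 4) := \matrix_(a, b) (a == lift i0 b)%:R.

Let mulE i0 (v : 'rV[R]_5) b : (v *m E i0) 0 b = v 0 (lift i0 b).
Proof.
rewrite mxE (bigD1 (lift i0 b))//= mxE eqxx mulr1 big1 ?addr0// => a ab.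
by rewrite mxE (negbTE ab) mulr0.
Qed.

Let straighten_smooth i0 : smooth_mx_on U (straighten i0).
Proof.
apply: smooth_mxD => //; first exact: smooth_id.
apply: smooth_mxZ => //; last exact: smooth_mx_cst.
by apply: smoothB => //; exact: smooth_coord.
Qed.

Let straighten_jacobian i0 y (v : 'rV[R]_5) : U y ->
  v *m 'J (straighten i0) y = v + ((v *m eta y) 0 0 - v 0 i0) *: delta_mx 0 i0.
Proof.
move=> Uy; have dts := smooth_diff ts Uy.
have dti : differentiable (fun y : 'rV[R]_5 => t y - y 0 i0) y.
  by apply: (@differentiableB _ _ _ t) => //; exact: differentiable_coord.
have dd : mx_diff (fun=> delta_mx 0 i0 : 'rV[R]_5) y.
  by move=> a b; exact: differentiable_cst.
have dz : mx_diff (fun y : 'rV[R]_5 => (t y - y 0 i0) *: (delta_mx 0 i0 : 'rV[R]_5)) y.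
  apply: (smooth_mx_mx_diff _ Uy); apply: smooth_mxZ => //; last exact: smooth_mx_cst.
  by apply: smoothB => //; exact: smooth_coord.
rewrite mul_jacobian; last exact: smooth_mx_mx_diff (straighten_smooth i0) Uy.
have pE i : mx_partial i (straighten i0) y =
    delta_mx 0 i + (eta y i 0 - (i == i0)%:R) *: delta_mx 0 i0.
  rewrite (mx_partialD i (mx_diff_id y) dz) mx_partial_id (mx_partialZ i dti dd).
  rewrite mx_partial_cst scaler0 addr0 (partialB i dts (differentiable_coord _ _ _)).
  by rewrite partial_coord -(dt Uy) mxE.
under eq_bigr => i _ do rewrite pE scalerDr scalerA.
rewrite big_split/= -row_sum_delta; congr (_ + _).
rewrite -scaler_suml; congr (_ *: _).
under eq_bigr => i _ do rewrite mulrBr.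
rewrite sumrB; congr (_ - _); first by rewrite mxE.
rewrite (bigD1 i0)//= eqxx mulr1 big1 ?addr0// => i /negbTE ->.
by rewrite mulr0.
Qed.

Lemma leaf_chart x : U x -> exists (W : set 'rV[R]_4) (f : 'rV[R]_4 -> 'rV[R]_5)
    (D : 'M[R]_(5, 4)) (w0 : 'rV[R]_4),
  [/\ open W /\ W w0, smooth_mx_on W f /\ f w0 = x, forall w, W w -> U (f w),
     forall w, W w -> 'J f w *m D = 1%:M /\ 'J f w *m eta (f w) = 0 &
     forall w (v : 'rV[R]_5), W w -> (v *m eta (f w)) 0 0 = 0 -> v = v *m D *m 'J f w].
Proof.
move=> Ux.
have [i0 eta0] : exists i0, eta x i0 0 != 0.
  apply/not_existsP => H; have := ls_norm ls Ux.
  rewrite -(ls_dual ls Ux) mxE big1 => [/eqP|i _].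
    by rewrite eq_sym oner_eq0.
  by have := H i; move/negP; rewrite negbK => /eqP ->; rewrite mulr0.
have Ju : 'J (straighten i0) x \in unitmx.
  apply: unitmx_ker => v; rewrite straighten_jacobian// => /rowP H.
  have vj j : j != i0 -> v 0 j = 0.
    by move=> ji; have := H j; rewrite !mxE eqxx (negbTE ji) mulr0 addr0.
  have : (v *m eta x) 0 0 = 0.
    by have := H i0; rewrite !mxE !eqxx mulr1 addrC subrK.
  rewrite mxE (bigD1 i0)//= big1 ?addr0 => [/eqP|j ji]; last by rewrite vj// mul0r.
  rewrite mulf_eq0 (negbTE eta0) orbF => /eqP vi0.
  by apply/rowP => j; rewrite mxE; have [->//|/vj] := eqVneq j i0.
have [r [F [r0 Fs Fx FU _]]] := inverse_function Uo Ux (straighten_smooth i0) Ju.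
pose ins := insert i0 (t x).
pose w0 := x *m E i0.
have insw0 : ins w0 = straighten i0 x.
  apply/rowP => j; rewrite !mxE; case: unliftP => [b ->|->]/=.
    by rewrite mulE eq_sym (negbTE (neq_lift _ _)) mulr0 addr0.
  by rewrite !eqxx mulr1 addrC subrK.
have insB w : ball w0 r w -> ball (straighten i0 x) r (ins w).
  rewrite -insw0 -!ball_normE/= => wr; apply: norm_lt_coord => // a j.
  rewrite !mxE; case: unliftP => [b _|_]/=; last by rewrite subrr normr0.
  by apply: le_lt_trans wr; have := coord_le_norm (w0 - w) 0 b; rewrite !mxE.
pose W := ball w0 r.
have Wo : open W by exact: ball_open.
pose f w := F (ins w).
have inss : smooth_mx_on W ins.
  move=> a j; case: (unliftP i0 j) => [b jE|jE].
    by apply: (smooth_eq Wo _ (smooth_coord Wo b)) => w _; rewrite mxE jE liftK.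
  by apply: (smooth_eq Wo _ (smooth_cst Wo (t x))) => w _; rewrite mxE jE unlift_none.
have fs : smooth_mx_on W f by exact: smooth_mx_comp insB Fs inss.
have fU w : W w -> U (f w) by move=> /insB/FU[].
have sf w : W w -> straighten i0 (f w) = ins w by move=> /insB/FU[].
have tf w : W w -> t (f w) = t x.
  move=> /sf/rowP/(_ i0); rewrite !mxE !eqxx mulr1 addrC subrK => ->.
  by rewrite unlift_none.
have fE w : W w -> f w *m E i0 = w.
  move=> Ww; apply/rowP => b; rewrite mulE.
  have /rowP/(_ (lift i0 b)) := sf w Ww; rewrite !mxE eqxx liftK/= => <-.
  by rewrite eq_sym (negbTE (neq_lift _ _)) mulr0 addr0.
have JE w : W w -> 'J f w *m E i0 = 1%:M.
  move=> Ww; have df := smooth_mx_mx_diff fs Ww.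
  apply/row_matrixP => i; rewrite row_mul row_jacobian// row1.
  have <- : mx_partial i (fun w => f w *m E i0) w = mx_partial i f w *m E i0.
    by rewrite mx_partialM// ?mx_partial_cst ?mulmx0 ?addr0//.
  by rewrite (mx_partial_open_eq i Wo fE Ww) mx_partial_id.
have Jeta w : W w -> 'J f w *m eta (f w) = 0.
  move=> Ww; have df := smooth_mx_mx_diff fs Ww.
  rewrite -(dt (fU _ Ww)) -(differential_comp df (smooth_diff ts (fU _ Ww))).
  apply/colP => i; rewrite !mxE.
  by rewrite (open_eq_partial Wo (g := fun=> t x)) ?partial_cst//; exact: tf.
exists W, f, (E i0), w0; split=> //.
- by split=> //; exact: ballxx.
- by split=> //; rewrite /f insw0.
- by move=> w Ww; split; [exact: JE|exact: Jeta].
move=> w v Ww veta.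
have dJ (d : 'rV[R]_5) : d *m E i0 = 0 -> (d *m eta (f w)) 0 0 = 0 ->
    d *m 'J (straighten i0) (f w) = 0.
  move=> dE deta; rewrite (straighten_jacobian i0 d (fU _ Ww)) deta sub0r.
  apply/rowP => j; rewrite !mxE eqxx.
  case: (unliftP i0 j) => [b ->|->].
    by rewrite eq_sym (negbTE (neq_lift _ _)) mulr0 addr0 -mulE dE mxE.
  by rewrite eqxx mulr1 subrr.
have JJ : 'J F (ins w) *m 'J (straighten i0) (F (ins w)) = 1%:M.
  apply: (@jacobian_inverse _ _ (ball (straighten i0 x) r)).
  - exact: ball_open.
  - by move=> y /FU[].
  - exact: insB.
  - exact: smooth_mx_mx_diff Fs (insB _ Ww).
  - exact: smooth_mx_mx_diff (straighten_smooth i0) (fU _ Ww).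
have [_ Ju'] := mulmx1_unit JJ.
apply/eqP; rewrite -subr_eq0; apply/eqP; apply: (can_inj (mulmxK Ju')).
rewrite mul0mx; apply: dJ.
  by rewrite mulmxBl -(mulmxA (v *m _)) JE// mulmx1 subrr.
by rewrite mulmxBl -(mulmxA (v *m _)) Jeta// mulmx0 subr0.
Qed.

Lemma leaf_cov (s : R) (V : 'rV[R]_5 -> 'rV[R]_5) (x v V' : 'rV[R]_5) :
  s * s = 1 -> smooth_mx_on U V -> (forall y, U y -> V y *m phi y = s *: V y) ->
  U x -> V' *m phi x = s *: V' -> (v *m eta x) 0 0 = 0 ->
  ip (g x) (\sum_a v 0 a *: cov g a V x) V' = 0.
Proof.
move=> s1 Vs VF Ux V'F veta.
have [W [f [D [w0 [[Wo Ww0] [fs fw0] fU JD tang]]]]] := leaf_chart Ux.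
subst x.
have perp (y u : 'rV[R]_5) (Uy : U y) : u *m phi y = s *: u -> (u *m eta y) 0 0 = 0.
  move=> uF; rewrite (ls_dual ls Uy).
  exact: (eigen_perp_xi (ls_sqr ls Uy) (ls_norm ls Uy) s1 uF).
pose P w := 'J f w *m phi (f w) *m D.
have Js := smooth_jacobian Wo fs.
have leafP : [/\ open W, smooth_mx_on W f, f @` W `<=` C,
    forall w, W w -> row_free ('J f w) &
    forall w, W w -> 'J f w *m eta (f w) = 0].
  split=> //.
  - by move=> _ [w Ww <-]; apply: UC; exact: fU.
  - by move=> w Ww; apply/row_freeP; exists D; have [] := JD w Ww.
  - by move=> w Ww; have [] := JD w Ww.
have PJ w : W w -> P w *m 'J f w = 'J f w *m phi (f w).
  move=> Ww; apply/row_matrixP => i; rewrite /P 2!row_mul; apply/esym.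
  apply: tang => //; rewrite (ls_dual ls (fU _ Ww)) row_mul.
  exact: (phi_perp_xi (ls_sqr ls (fU _ Ww)) (ls_norm ls (fU _ Ww))).
pose Y w := V (f w) *m D.
have Vfs : smooth_mx_on W (fun w => V (f w)) by exact: smooth_mx_comp fU Vs fs.
have Ys : smooth_mx_on W Y by apply: smooth_mxM => //; exact: smooth_mx_cst.
have YJ w : W w -> V (f w) = Y w *m 'J f w.
  move=> Ww; apply: tang => //; apply: perp; first exact: fU.
  exact/VF/fU.
have YP w : W w -> Y w *m P w = s *: Y w.
  move=> Ww; rewrite /P !mulmxA -YJ// VF; last exact: fU.
  by rewrite -scalemxAl.
pose h w := 'J f w *m g (f w) *m ('J f w)^T.
have hunit w : W w -> h w \in unitmx.
  move=> Ww; apply: unitmx_ker => d dh.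
  have dJ0 : d *m 'J f w = 0.
    apply: (ip_inj (ls_unit ls (fU _ Ww))) => z; rewrite ip0l.
    have deta : (d *m 'J f w *m eta (f w)) 0 0 = 0.
      by have [_ Je] := JD w Ww; rewrite -mulmxA Je mulmx0 mxE.
    rewrite (ls_dual ls (fU _ Ww)) in deta.
    pose zt := z - ip (g (f w)) (xi (f w)) z *: xi (f w).
    have ztan : (zt *m eta (f w)) 0 0 = 0.
      rewrite (ls_dual ls (fU _ Ww)) /zt ipBr ipZr (ls_norm ls (fU _ Ww)) mulr1.
      exact: subrr.
    have -> : z = zt + ip (g (f w)) (xi (f w)) z *: xi (f w) by rewrite subrK.
    rewrite ipDr ipZr (ipC _ (xi (f w)) (ls_sym ls (fU _ Ww))) deta mulr0 addr0.
    rewrite (tang _ _ Ww ztan) -ip_pullback -/(h w) /ip dh mul0mx.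
    by rewrite mxE.
  have [JD1 _] := JD w Ww.
  by rewrite -[d]mulmx1 -JD1 mulmxA dJ0 mul0mx.
pose gsym := ls_sym ls; pose gunit := ls_unit ls; pose gs := ls_g ls.
have hsm := smooth_pullback_metric gs Wo fs fU.
have key i : ip (g (f w0)) (\sum_a ('J f w0) i a *: cov g a V (f w0)) V' = 0.
  pose Z := cov h i Y w0.
  have V'tan : (V' *m eta (f w0)) 0 0 = 0 by exact: perp.
  have cE := cov_immersion Uo gs gsym gunit Wo fs fU hunit i (V' *m D) Ys Vs YJ Ww0.
  rewrite -(tang _ _ Ww0 V'tan) in cE.
  apply: (etrans (esym cE)).
  have ZP : s *: Z = Z *m P w0.
    have := leaves leafP PJ (smooth_mx_cst Wo (delta_mx 0 i)) Ys Ww0.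
    have dY := smooth_mx_mx_diff Ys Ww0.
    rewrite (nabla_delta _ _ dY) => <-.
    have YPs : forall w, W w -> s *: Y w = Y w *m P w by move=> w /YP ->.
    have dsY : mx_diff (fun w => s *: Y w) w0.
      by apply: (smooth_mx_mx_diff _ Ww0); apply: smooth_mxZ => //; exact: smooth_cst.
    have dYP := mx_diff_open_eq Wo YPs Ww0 dsY.
    rewrite (nabla_delta _ _ dYP) -(cov_open_eq h Wo i YPs Ww0).
    by rewrite (covZ h i (differentiable_cst s w0) dY) partial_cst scale0r add0r.
  apply: (etrans (ip_pullback g f w0 Z (V' *m D))).
  rewrite -(tang _ _ Ww0 V'tan).
  have ZF : Z *m 'J f w0 *m phi (f w0) = s *: (Z *m 'J f w0).
    by rewrite -mulmxA -(PJ _ Ww0) mulmxA -ZP -scalemxAl.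
  have U0 := fU _ Ww0.
  exact: (eigen_isotropic (gsym _ U0) (ls_sqr ls U0) (ls_compat ls U0) (ls_norm ls U0) s1 ZF V'F).
have -> : v = (v *m D) *m 'J f w0 by exact: tang.
rewrite ip_suml.
under eq_bigr => a _ do rewrite mxE ipZl mulr_suml.
rewrite exchange_big/= big1// => i _.
under eq_bigr => a _ do rewrite -mulrA -ipZl.
by rewrite -mulr_sumr -ip_suml key mulr0.
Qed.

End Leaf.

Lemma ip_sym_family (R : realType) n (G : 'M[R]_n) (T : 'I_n -> 'rV[R]_n) (u v : 'rV[R]_n) :
  (forall i j, ip G (T i) (delta_mx 0 j) = ip G (T j) (delta_mx 0 i)) ->
  ip G (\sum_i u 0 i *: T i) v = ip G (\sum_i v 0 i *: T i) u.
Proof.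
move=> Tsym; rewrite !ip_suml {1}(row_sum_delta v) {2}(row_sum_delta u).
under eq_bigr => i _ do rewrite ipZl ip_sumr mulr_sumr.
rewrite exchange_big/=; apply: eq_bigr => j _.
rewrite ipZl ip_sumr mulr_sumr; apply: eq_bigr => i _.
by rewrite !ipZr Tsym mulrCA.
Qed.

Section FundamentalForm.
Variable R : realType.
Variables (U : set 'rV[R]_5) (g phi : 'rV[R]_5 -> 'M[R]_5).
Variables (xi : 'rV[R]_5 -> 'rV[R]_5) (eta : 'rV[R]_5 -> 'cV[R]_5).
Hypothesis ls : local_structure U g phi xi eta.

Let Uo := ls_open ls.
Let gs := ls_g ls.
Let gsym := ls_sym ls.
Let gunit := ls_unit ls.

Lemma eta_entry x j : U x -> eta x j 0 = ip (g x) (xi x) (delta_mx 0 j).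
Proof. by move=> Ux; rewrite -(ls_dual ls Ux) -rowE mxE. Qed.

Lemma cov_xi_sym x i j : U x ->
  ip (g x) (cov g i xi x) (delta_mx 0 j) = ip (g x) (cov g j xi x) (delta_mx 0 i).
Proof.
move=> Ux; apply/eqP; rewrite -subr_eq0; apply/eqP.
have dxi := smooth_mx_mx_diff (ls_xi ls) Ux.
rewrite -(curl_inner Uo gs gsym gunit i j Ux dxi) -(ls_closed ls Ux i j).
by congr (_ - _); apply: (open_eq_partial Uo) => // y Uy; rewrite eta_entry.
Qed.

Section AtPoint.
Variable x : 'rV[R]_5.
Hypothesis Ux : U x.

Let Phi y := phi y *m g y.
Let G := fun i j => christoffel_row g x i j.
Let GG (v w : 'rV[R]_5) : 'rV[R]_5 := \sum_i v 0 i *: (\sum_j w 0 j *: G i j).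

Let GG_sym v w : GG v w = GG w v.
Proof.
rewrite /GG; under eq_bigr => i _ do rewrite scaler_sumr.
rewrite exchange_big/=; apply: eq_bigr => j _; rewrite scaler_sumr.
apply: eq_bigr => i _; rewrite !scalerA mulrC; congr (_ *: _).
exact: (christoffel_row_sym Uo gsym gunit i j Ux).
Qed.

Let Phi_ip v w : ip (Phi x) v w = ip (g x) (v *m phi x) w.
Proof. by rewrite /ip /Phi !mulmxA. Qed.

Let Phi_skew v w : ip (Phi x) v w = - ip (Phi x) w v.
Proof.
rewrite !Phi_ip (phi_skew (gsym Ux) (ls_sqr ls Ux) (ls_compat ls Ux) (ls_norm ls Ux)).
by rewrite (ipC v _ (gsym Ux)).
Qed.

Let Phis : smooth_mx_on U Phi.
Proof. by apply: smooth_mxM; [exact: Uo|exact: ls_phi ls|exact: gs]. Qed.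

Let N i v w := ip (mx_partial i Phi x) v w
  - ip (Phi x) (\sum_j v 0 j *: G i j) w - ip (Phi x) v (\sum_j w 0 j *: G i j).

Let partial_Phi i Y Z : mx_diff Y x -> mx_diff Z x ->
  partial i (fun y => ip (Phi y) (Y y) (Z y)) x =
  N i (Y x) (Z x) + ip (Phi x) (cov g i Y x) (Z x) + ip (Phi x) (Y x) (cov g i Z x).
Proof.
move=> dY dZ; rewrite (partial_ip i (smooth_mx_mx_diff Phis Ux) dY dZ) /N /cov ipDl ipDr.
rewrite -/(G i).
move: (ip (mx_partial i Phi x) _ _) (ip _ (mx_partial i Y x) _) (ip _ _ (mx_partial i Z x)).
move: (ip (Phi x) (\sum_j _) _) (ip (Phi x) _ (\sum_j _)) => a b c d e.
by ring.
Qed.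

Let sumN (u v w : 'rV[R]_5) : \sum_i u 0 i * N i v w =
  \sum_i \sum_j \sum_k u 0 i * v 0 j * w 0 k * partial i (fun y => Phi y j k) x
  - ip (Phi x) (GG u v) w - ip (Phi x) v (GG u w).
Proof.
rewrite /N; under eq_bigr => i _ do rewrite !mulrBr.
rewrite !sumrB; congr (_ - _ - _); last 2 first.
- by rewrite ip_suml; apply: eq_bigr => i _; rewrite ipZl.
- by rewrite ip_sumr; apply: eq_bigr => i _; rewrite ipZr.
apply: eq_bigr => i _; rewrite ipE mulr_sumr; apply: eq_bigr => j _.
by rewrite mulr_sumr; apply: eq_bigr => k _; rewrite mxE !mulrA.
Qed.

Let cyclicN (u v w : 'rV[R]_5) :
  \sum_i u 0 i * N i v w + \sum_i v 0 i * N i w u + \sum_i w 0 i * N i u v = 0.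
Proof.
rewrite !sumN.
pose S := \sum_i \sum_j \sum_k u 0 i * v 0 j * w 0 k * (partial i (fun y => Phi y j k) x
   + partial j (fun y => Phi y k i) x + partial k (fun y => Phi y i j) x).
have S0 : S = 0.
  apply: big1 => i _; apply: big1 => j _; apply: big1 => k _.
  by rewrite (ls_closed2 ls Ux i j k) mulr0.
have : S = \sum_i \sum_j \sum_k u 0 i * v 0 j * w 0 k * partial i (fun y => Phi y j k) x
  + \sum_i \sum_j \sum_k v 0 i * w 0 j * u 0 k * partial i (fun y => Phi y j k) x
  + \sum_i \sum_j \sum_k w 0 i * u 0 j * v 0 k * partial i (fun y => Phi y j k) x.
  have rot (f : 'I_5 -> 'I_5 -> 'I_5 -> R) :
      \sum_a \sum_b \sum_c f a b c = \sum_c \sum_a \sum_b f a b c.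
    rewrite [RHS]exchange_big/=; apply: eq_bigr => a' _; exact: exchange_big.
  rewrite [X in _ = _ + X + _]rot [X in _ = _ + X]rot [X in _ = _ + X]rot.
  rewrite -!big_split/=; apply: eq_bigr => i _.
  rewrite -!big_split/=; apply: eq_bigr => j _.
  rewrite -!big_split/=; apply: eq_bigr => k _.
  move: (partial i _ x) (partial j _ x) (partial k _ x) => a b c.
  by ring.
rewrite S0; move: (\sum_i _) (\sum_i _) (\sum_i _) => a b c abc.
rewrite (GG_sym v u) (GG_sym w u) (GG_sym w v).
rewrite (Phi_skew w (GG u v)) (Phi_skew (GG u w) v) (Phi_skew u (GG v w)).
move: (ip _ _ w) (ip _ v _) (ip _ _ u) => d e f.
have -> : c = - b - a by apply/eqP; rewrite -subr_eq0 opprD !opprK addrA -abc.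
by ring.
Qed.

Lemma xi_cov (s : R) (V V' : 'rV[R]_5 -> 'rV[R]_5) :
  s * s = 1 -> smooth_mx_on U V -> smooth_mx_on U V' ->
  (forall y, U y -> V y *m phi y = s *: V y) ->
  (forall y, U y -> V' y *m phi y = s *: V' y) ->
  ip (g x) (\sum_a xi x 0 a *: cov g a V x) (V' x) = 0.
Proof.
move=> s1 Vs V's VF V'F.
have skew y u w (Uy : U y) : ip (Phi y) u w = - ip (g y) u (w *m phi y).
  have -> : ip (Phi y) u w = ip (g y) (u *m phi y) w by rewrite /ip /Phi !mulmxA.
  exact: (phi_skew (gsym Uy) (ls_sqr ls Uy) (ls_compat ls Uy) (ls_norm ls Uy)).
have iso y (Uy : U y) : ip (g y) (V y) (V' y) = 0.
  exact: (eigen_isotropic (gsym Uy) (ls_sqr ls Uy) (ls_compat ls Uy) (ls_norm ls Uy) s1 (VF y Uy) (V'F y Uy)).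
have xiF y (Uy : U y) : xi y *m phi y = 0.
  exact: (xi_phi (ls_sqr ls Uy) (ls_norm ls Uy)).
have dV := smooth_mx_mx_diff Vs Ux; have dV' := smooth_mx_mx_diff V's Ux.
have dxi := smooth_mx_mx_diff (ls_xi ls) Ux.
have zero_partial i Y Z : (forall y, U y -> ip (Phi y) (Y y) (Z y) = 0) ->
    partial i (fun y => ip (Phi y) (Y y) (Z y)) x = 0.
  by move=> H; rewrite (open_eq_partial Uo (g := fun=> 0))// partial_cst.
have PV u Z (Zx : Z *m phi x = s *: Z) : ip (Phi x) u Z = - (s * ip (g x) u Z).
  by rewrite (skew x u Z Ux) Zx ipZr.
have PV' u Z (Zx : Z *m phi x = s *: Z) : ip (Phi x) Z u = s * ip (g x) u Z.
  by rewrite Phi_skew PV// opprK.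
have Px u : ip (Phi x) u (xi x) = 0 by rewrite (skew x u _ Ux) xiF// ip0r oppr0.
have Px' u : ip (Phi x) (xi x) u = 0 by rewrite Phi_skew Px oppr0.
have N1 i : N i (V x) (V' x) = 2 * s * ip (g x) (cov g i V x) (V' x).
  have := partial_Phi i dV dV'; rewrite zero_partial; last first.
    by move=> y Uy; rewrite skew// V'F// ipZr iso// mulr0 oppr0.
  rewrite (PV _ _ (V'F x Ux)) (PV' _ _ (VF x Ux)).
  have : ip (g x) (cov g i V x) (V' x) + ip (g x) (V x) (cov g i V' x) = 0.
    rewrite -(partial_inner Uo gs gsym gunit i Ux dV dV').
    by rewrite (open_eq_partial Uo (g := fun=> 0))// partial_cst.
  rewrite (ipC (V x) _ (gsym Ux)).
  move: (ip _ _ (V' x)) (ip _ _ (V x)) (N _ _ _) => a b c ab0 /eqP.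
  rewrite eq_sym => /eqP cE.
  have -> : c = (c + - (s * a) + s * b) + 2 * s * a - s * (a + b) by ring.
  by rewrite cE ab0; ring.
have N2 i : N i (V' x) (xi x) = - (s * ip (g x) (cov g i xi x) (V' x)).
  have := partial_Phi i dV' dxi; rewrite zero_partial; last first.
    by move=> y Uy; rewrite skew// xiF// ip0r oppr0.
  rewrite Px (PV' _ _ (V'F x Ux)) addr0 => /eqP.
  by rewrite eq_sym addr_eq0 => /eqP.
have N3 i : N i (xi x) (V x) = s * ip (g x) (cov g i xi x) (V x).
  have := partial_Phi i dxi dV; rewrite zero_partial; last first.
    move=> y Uy; rewrite skew// VF// ipZr.
    by rewrite (eigen_perp_xi (ls_sqr ls Uy) (ls_norm ls Uy) s1 (VF y Uy)) mulr0 oppr0.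
  rewrite Px' (PV _ _ (VF x Ux)) addr0 => /eqP.
  by rewrite eq_sym addr_eq0 opprK => /eqP.
have pull c (u : 'rV[R]_5) (T : 'I_5 -> 'rV[R]_5) w : \sum_i u 0 i * (c * ip (g x) (T i) w) =
    c * ip (g x) (\sum_i u 0 i *: T i) w.
  by rewrite ip_suml mulr_sumr; apply: eq_bigr => i _; rewrite ipZl mulrCA.
have E1 : \sum_i xi x 0 i * N i (V x) (V' x) =
    2 * s * ip (g x) (\sum_i xi x 0 i *: cov g i V x) (V' x).
  by rewrite -pull; apply: eq_bigr => i _; rewrite N1.
have E2 : \sum_i V x 0 i * N i (V' x) (xi x) =
    - s * ip (g x) (\sum_i V x 0 i *: cov g i xi x) (V' x).
  by rewrite -pull; apply: eq_bigr => i _; rewrite N2 mulNr.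
have E3 : \sum_i V' x 0 i * N i (xi x) (V x) =
    s * ip (g x) (\sum_i V' x 0 i *: cov g i xi x) (V x).
  by rewrite -pull; apply: eq_bigr => i _; rewrite N3.
have := cyclicN (xi x) (V x) (V' x); rewrite E1 E2 E3.
have -> : ip (g x) (\sum_i V x 0 i *: cov g i xi x) (V' x) =
    ip (g x) (\sum_i V' x 0 i *: cov g i xi x) (V x).
  by apply: ip_sym_family => i j; exact: cov_xi_sym.
rewrite mulNr subrK => /eqP; rewrite mulf_eq0 mulf_eq0 pnatr_eq0 /= => /orP[/eqP s0|/eqP//].
by move: s1; rewrite s0 mul0r => /eqP; rewrite eq_sym oner_eq0.
Qed.

End AtPoint.
End FundamentalForm.

Lemma smooth_ip (R : realType) m n (U : set 'rV[R]_m) (G : 'rV[R]_m -> 'M[R]_n) Y Z :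
  open U -> smooth_mx_on U G -> smooth_mx_on U Y -> smooth_mx_on U Z ->
  smooth_on U (fun x => ip (G x) (Y x) (Z x)).
Proof.
move=> Uo Gs Ys Zs; apply: smooth_mxM => //; first exact: smooth_mxM.
exact: smooth_trmx.
Qed.

Lemma ip_contract (R : realType) n (G : 'M[R]_n) (w v : 'rV[R]_n) :
  \sum_j v 0 j * ip G w (delta_mx 0 j) = ip G w v.
Proof.
by rewrite [in RHS](row_sum_delta v) ip_sumr; apply: eq_bigr => j _; rewrite ipZr.
Qed.

Lemma ball_neq0 (R : realType) m (U : set 'rV[R]_m) (f : 'rV[R]_m -> R) x :
  open U -> U x -> smooth_on U f -> f x != 0 ->
  exists2 r, 0 < r & ball x r `<=` U /\ forall y, ball x r y -> f y != 0.
Proof.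
move=> Uo Ux fs fx.
have /nbhs_ballP[r /= r0 rP] : \forall y \near x, U y /\ f y != 0.
  apply: filterI; first exact: open_nbhs_nbhs.
  exact: near_neq0 (differentiable_continuous (smooth_diff fs Ux)) fx.
by exists r => //; split=> y /rP[].
Qed.

Section Frame.
Variable R : realType.

(* The remaining entries of the Gram matrix follow from the eigenvalue
   equations. *)
Record adapted_frame (U : set 'rV[R]_5) (g phi : 'rV[R]_5 -> 'M[R]_5)
    (V1 V2 V3 V4 : 'rV[R]_5 -> 'rV[R]_5) : Prop := AdaptedFrame {
  af_s1 : smooth_mx_on U V1;
  af_s2 : smooth_mx_on U V2;
  af_s3 : smooth_mx_on U V3;
  af_s4 : smooth_mx_on U V4;
  af_e1 : forall x, U x -> V1 x *m phi x = -1 *: V1 x;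
  af_e2 : forall x, U x -> V2 x *m phi x = 1 *: V2 x;
  af_e3 : forall x, U x -> V3 x *m phi x = 1 *: V3 x;
  af_e4 : forall x, U x -> V4 x *m phi x = -1 *: V4 x;
  af_12 : forall x, U x -> ip (g x) (V1 x) (V2 x) = 0;
  af_13 : forall x, U x -> ip (g x) (V1 x) (V3 x) = 1;
  af_24 : forall x, U x -> ip (g x) (V2 x) (V4 x) = 1;
  af_34 : forall x, U x -> ip (g x) (V3 x) (V4 x) = 0 }.

Definition frame5 (a b c d e : 'rV[R]_5) (i : 'I_5) : 'rV[R]_5 :=
  nth 0 [:: a; b; c; d; e] i.

Variables (U : set 'rV[R]_5) (g phi : 'rV[R]_5 -> 'M[R]_5).
Variables (xi : 'rV[R]_5 -> 'rV[R]_5) (eta : 'rV[R]_5 -> 'cV[R]_5).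
Hypothesis ls : local_structure U g phi xi eta.

Let Uo := ls_open ls.
Let gs := ls_g ls.
Let gsym := ls_sym ls.
Let gunit := ls_unit ls.

Let sm1 : (-1 : R) * -1 = 1. Proof. by rewrite mulrNN mulr1. Qed.
Let s11 : (1 : R) * 1 = 1. Proof. by rewrite mulr1. Qed.

Lemma adapted_gram V1 V2 V3 V4 x : adapted_frame U g phi V1 V2 V3 V4 -> U x ->
  forall i j, ip (g x) (frame5 (xi x) (V1 x) (V2 x) (V3 x) (V4 x) i)
                 (frame5 (xi x) (V1 x) (V2 x) (V3 x) (V4 x) j) = adopted_gram R i j.
Proof.
move=> af Ux i j; rewrite mxE.
have gs' := gsym Ux.
have iso := eigen_isotropic gs' (ls_sqr ls Ux) (ls_compat ls Ux) (ls_norm ls Ux).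
have perp := eigen_perp_xi (ls_sqr ls Ux) (ls_norm ls Ux).
have e1 := af_e1 af Ux; have e2 := af_e2 af Ux.
have e3 := af_e3 af Ux; have e4 := af_e4 af Ux.
have c v w : ip (g x) v w = ip (g x) w v by exact: ipC.
have x1 := perp _ _ sm1 e1; have x4 := perp _ _ sm1 e4.
have x2 := perp _ _ s11 e2; have x3 := perp _ _ s11 e3.
have v11 := iso _ _ _ sm1 e1 e1; have v14 := iso _ _ _ sm1 e1 e4.
have v44 := iso _ _ _ sm1 e4 e4; have v22 := iso _ _ _ s11 e2 e2.
have v23 := iso _ _ _ s11 e2 e3; have v33 := iso _ _ _ s11 e3 e3.
have v12 := af_12 af Ux; have v13 := af_13 af Ux.
have v24 := af_24 af Ux; have v34 := af_34 af Ux.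
have v00 := ls_norm ls Ux.
by elim/I5_cases: i; elim/I5_cases: j; rewrite /frame5 /=;
  first [done | rewrite c; done].
Qed.

Lemma adapted_frame_exists V1 V2 x0 : U x0 ->
  smooth_mx_on U V1 -> smooth_mx_on U V2 -> V1 x0 != 0 -> V2 x0 != 0 ->
  (forall x, U x -> V1 x *m phi x = -1 *: V1 x) ->
  (forall x, U x -> V2 x *m phi x = 1 *: V2 x) ->
  (forall x, U x -> ip (g x) (V1 x) (V2 x) = 0) ->
  exists2 r, 0 < r & ball x0 r `<=` U /\
    exists V3 V4, adapted_frame (ball x0 r) g phi V1 V2 V3 V4.
Proof.
move=> Ux0 s1 s2 n1 n2 e1 e2 v12.
have dual (v : 'rV[R]_5) : v != 0 -> exists a, ip (g x0) v a != 0.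
  move=> v0; apply/not_existsP => H; move/eqP: v0; apply.
  apply: (ip_inj (gunit Ux0)) => z; rewrite ip0l; have := H z.
  by move/negP; rewrite negbK => /eqP.
have [a a0] := dual _ n1; have [b b0] := dual _ n2.
have fa : smooth_on U (fun x => ip (g x) (V1 x) a).
  by apply: smooth_ip => //; exact: smooth_mx_cst.
have fb : smooth_on U (fun x => ip (g x) (V2 x) b).
  by apply: smooth_ip => //; exact: smooth_mx_cst.
have [r [r0 [rU fab]]] : exists r, 0 < r /\ (ball x0 r `<=` U /\ forall y, ball x0 r y ->
    ip (g y) (V1 y) a * ip (g y) (V2 y) b != 0).
  have [|r r0 H] := ball_neq0 Uo Ux0 (smoothM Uo fa fb); last by exists r.
  by rewrite mulf_neq0.
have Bo : open (ball x0 r) by exact: ball_open.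
have fa0 y : ball x0 r y -> ip (g y) (V1 y) a != 0.
  by move=> /fab; rewrite mulf_eq0 negb_or => /andP[].
have fb0 y : ball x0 r y -> ip (g y) (V2 y) b != 0.
  by move=> /fab; rewrite mulf_eq0 negb_or => /andP[].
have phis := ls_phi ls.
have proj_s (s : R) (v : 'rV[R]_5) : smooth_mx_on U (fun x => eigen_proj (phi x) s v).
  have cs (w : 'rV[R]_5) : smooth_mx_on U (fun=> w) by exact: smooth_mx_cst.
  apply: smooth_mxZ => //; first exact: smooth_cst.
  apply: smooth_mxD => //; first by apply: smooth_mxM => //; exact: smooth_mxM.
  by apply: smooth_mxZ => //; [exact: smooth_cst|exact: smooth_mxM].
pose V3 y := (ip (g y) (V1 y) a)^-1 *: eigen_proj (phi y) 1 a.
pose W4 y := (ip (g y) (V2 y) b)^-1 *: eigen_proj (phi y) (-1) b.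
pose V4 y := W4 y - ip (g y) (V3 y) (W4 y) *: V1 y.
have gB := smooth_mx_sub rU gs.
have s1B := smooth_mx_sub rU s1; have s2B := smooth_mx_sub rU s2.
have s3 : smooth_mx_on (ball x0 r) V3.
  apply: smooth_mxZ => //; last exact: smooth_mx_sub rU (proj_s _ _).
  by apply: smoothV => //; exact: smooth_sub rU fa.
have sW4 : smooth_mx_on (ball x0 r) W4.
  apply: smooth_mxZ => //; last exact: smooth_mx_sub rU (proj_s _ _).
  by apply: smoothV => //; exact: smooth_sub rU fb.
have e3 y : ball x0 r y -> V3 y *m phi y = 1 *: V3 y.
  move=> /rU Uy; rewrite /V3 -scalemxAl.
  by rewrite (eigen_projE (ls_sqr ls Uy) (ls_norm ls Uy) _ s11) !scale1r.
have eW4 y : ball x0 r y -> W4 y *m phi y = -1 *: W4 y.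
  move=> /rU Uy; rewrite /W4 -scalemxAl.
  by rewrite (eigen_projE (ls_sqr ls Uy) (ls_norm ls Uy) _ sm1) [LHS]scalerA [RHS]scalerA mulrC.
have v13 y : ball x0 r y -> ip (g y) (V1 y) (V3 y) = 1.
  move=> By; have Uy := rU _ By.
  rewrite /V3 ipZr (ip_eigen_proj (gsym Uy) (ls_sqr ls Uy) (ls_compat ls Uy) (ls_norm ls Uy) _ s11 (e1 y Uy)).
  by rewrite mulVf// fa0.
have v2W y : ball x0 r y -> ip (g y) (V2 y) (W4 y) = 1.
  move=> By; have Uy := rU _ By.
  have e2' : V2 y *m phi y = - -1 *: V2 y by rewrite opprK e2.
  rewrite /W4 ipZr (ip_eigen_proj (gsym Uy) (ls_sqr ls Uy) (ls_compat ls Uy) (ls_norm ls Uy) _ sm1 e2').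
  by rewrite mulVf// fb0.
exists r => //; split=> //; exists V3, V4; split=> //.
- apply: smooth_mxB => //; apply: smooth_mxZ => //; exact: smooth_ip.
- by move=> y /rU; exact: e1.
- by move=> y /rU; exact: e2.
- move=> y By; rewrite /V4 mulmxBl eW4// -scalemxAl e1; last exact: rU.
  rewrite [RHS]scalerBr; congr (_ - _).
  by rewrite [LHS]scalerA [RHS]scalerA mulrC.
- by move=> y /rU; exact: v12.
- move=> y By; have Uy := rU _ By; rewrite /V4 ipBr ipZr v2W//.
  by rewrite (ipC _ (V1 y) (gsym Uy)) v12// mulr0 subr0.
move=> y By; have Uy := rU _ By; rewrite /V4 ipBr ipZr.
by rewrite (ipC _ (V1 y) (gsym Uy)) v13// mulr1 subrr.
Qed.

End Frame.

(** * Structure equations of a flat manifold *)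

(* A, B, C, D are the products of V1, V2, V3, V4 with a test vector. *)
Lemma codazzi_coefficients (R : realFieldType) (p p' q q' t t' u u' a a' b b' c c' s : R)
    (A B C D : R) : s != 0 ->
  p * A + t * (a * A + c * D) + (s * q * B + s * u * (b * B - c * C)) =
  p' * A + t' * (a' * A + c' * D) + (s * q' * B + s * u' * (b' * B - c' * C)) ->
  [/\ [/\ A = 0, B = 0, C = 0 & D = 1] -> t * c = t' * c',
      [/\ A = 0, B = 0, C = 1 & D = 0] -> u * c = u' * c',
      [/\ A = 1, B = 0, C = 0 & D = 0] -> p + t * a = p' + t' * a' &
      [/\ A = 0, B = 1, C = 0 & D = 0] -> q + u * b = q' + u' * b'].
Proof.
move=> s0 H; split=> -[hA hB hC hD]; move: H; rewrite hA hB hC hD => H.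
- lra.
- by apply: (mulfI s0); lra.
- lra.
- by apply: (mulfI s0); lra.
Qed.

Lemma contract_eq (R : comPzRingType) n (v a b : 'I_n -> R) (c d : R) :
  (forall j, a j * c = d * b j) ->
  (\sum_j v j * a j) * c = d * \sum_j v j * b j.
Proof.
move=> H; rewrite mulr_suml mulr_sumr; apply: eq_bigr => j _.
by rewrite -mulrA H mulrCA.
Qed.

Lemma curl_codazzi (R : realFieldType) (p q a b s t : R) :
  p + t * a = q + s * b -> p - q = a * t - b * s -> a * t = b * s /\ p = q.
Proof. by move=> H1 H2; split; lra. Qed.

Lemma sym_cancel (R : realFieldType) (p q a b : R) : p + b * a = q + a * b -> p = q.
Proof. by move=> ?; lra. Qed.

Lemma omega_cancel (R : realFieldType) (p q a b a' b' o o' t t' u u' s : R) :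
  p - s * (b * a') + o' * u - t' * o = q - s * (a * b') + o * u' - t * o' ->
  p - q = - s * (a * b' - b * a') - ((t + u) * o' - (t' + u') * o).
Proof. by move=> ?; lra. Qed.

Section StructureEquations.
Variable R : realType.
Variables (U : set 'rV[R]_5) (g phi : 'rV[R]_5 -> 'M[R]_5).
Variables (xi : 'rV[R]_5 -> 'rV[R]_5) (eta : 'rV[R]_5 -> 'cV[R]_5).
Variables (V1 V2 V3 V4 : 'rV[R]_5 -> 'rV[R]_5) (sigma : R).
Hypothesis ls : local_structure U g phi xi eta.
Hypothesis af : adapted_frame U g phi V1 V2 V3 V4.

Let e_ (i : 'I_5) : 'rV[R]_5 := delta_mx 0 i.

Definition lowered (V : 'rV[R]_5 -> 'rV[R]_5) x i : R := ip (g x) (V x) (e_ i).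

Let th := lowered.

Hypothesis sigma0 : sigma != 0.
Hypothesis cov_xi : forall x i, U x ->
  cov g i xi x = - (th V1 x i *: V1 x + (sigma * th V2 x i) *: V2 x).
Hypothesis b1 : forall x i, U x -> ip (g x) (cov g i V1 x) (V4 x) = 0.
Hypothesis b2 : forall x i, U x -> ip (g x) (cov g i V2 x) (V3 x) = 0.

Definition tau1 x i : R := ip (g x) (cov g i V1 x) (V3 x).
Definition tau2 x i : R := ip (g x) (cov g i V2 x) (V4 x).
Definition omega x i : R := ip (g x) (cov g i V3 x) (V4 x).
Definition alpha1 x : R := \sum_j V3 x 0 j * tau1 x j.
Definition alpha2 x : R := \sum_j V4 x 0 j * tau2 x j.

Let Uo := ls_open ls.
Let gs := ls_g ls.
Let gsym := ls_sym ls.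
Let gunit := ls_unit ls.
Let xis := ls_xi ls.
Let s1 := af_s1 af. Let s2 := af_s2 af. Let s3 := af_s3 af. Let s4 := af_s4 af.

Let gram (x : 'rV[R]_5) (Ux : U x) := adapted_gram ls af Ux.

Let ips x : U x -> [/\ [/\ ip (g x) (xi x) (xi x) = 1, ip (g x) (xi x) (V1 x) = 0,
    ip (g x) (xi x) (V2 x) = 0, ip (g x) (xi x) (V3 x) = 0 & ip (g x) (xi x) (V4 x) = 0],
  [/\ ip (g x) (V1 x) (V1 x) = 0, ip (g x) (V1 x) (V2 x) = 0,
    ip (g x) (V1 x) (V3 x) = 1 & ip (g x) (V1 x) (V4 x) = 0],
  [/\ ip (g x) (V2 x) (V2 x) = 0, ip (g x) (V2 x) (V3 x) = 0 & ip (g x) (V2 x) (V4 x) = 1] &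
  [/\ ip (g x) (V3 x) (V3 x) = 0, ip (g x) (V3 x) (V4 x) = 0 & ip (g x) (V4 x) (V4 x) = 0]].
Proof.
move=> Ux; have G := gram Ux.
have E i j : ip (g x) _ _ = _ := G i j.
by split; split; rewrite ?(G 0 0, G 0 1, G 0 2, G 0 3, G 0 4, G 1 1, G 1 2, G 1 3, G 1 4,
  G 2 2, G 2 3, G 2 4, G 3 3, G 3 4, G 4 4) ?mxE.
Qed.

Let expand x v : U x -> v = ip (g x) v (xi x) *: xi x + ip (g x) v (V3 x) *: V1 x
  + ip (g x) v (V4 x) *: V2 x + ip (g x) v (V1 x) *: V3 x + ip (g x) v (V2 x) *: V4 x.
Proof. by move=> Ux; exact: (frame_decomposition (gram Ux) v). Qed.

Let d_ip (c : R) Y Z x i : smooth_mx_on U Y -> smooth_mx_on U Z ->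
  (forall y, U y -> ip (g y) (Y y) (Z y) = c) -> U x ->
  ip (g x) (cov g i Y x) (Z x) = - ip (g x) (cov g i Z x) (Y x).
Proof.
move=> Ys Zs YZ Ux; apply/eqP; rewrite -addr_eq0 (ipC _ (Y x) (gsym Ux)).
rewrite -(partial_inner Uo gs gsym gunit i Ux (smooth_mx_mx_diff Ys Ux) (smooth_mx_mx_diff Zs Ux)).
by rewrite (open_eq_partial Uo (g := fun=> c))// partial_cst.
Qed.

Let cov_self (c : R) Y x i : smooth_mx_on U Y ->
  (forall y, U y -> ip (g y) (Y y) (Y y) = c) -> U x -> ip (g x) (cov g i Y x) (Y x) = 0.
Proof.
move=> Ys YY Ux; have /eqP := d_ip i Ys Ys YY Ux.
by rewrite -subr_eq0 opprK -mulr2n mulrn_eq0 => /eqP.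
Qed.

Let th_contract V (v x : 'rV[R]_5) : \sum_j v 0 j * th V x j = ip (g x) (V x) v.
Proof. exact: ip_contract. Qed.

Let cov_xi_ip x i (v : 'rV[R]_5) : U x -> ip (g x) (cov g i xi x) v =
  - (th V1 x i * ip (g x) (V1 x) v + sigma * th V2 x i * ip (g x) (V2 x) v).
Proof. by move=> Ux; rewrite cov_xi// ipNl ipDl !ipZl. Qed.

Let xiC x (v : 'rV[R]_5) : U x -> ip (g x) v (xi x) = ip (g x) (xi x) v.
Proof. by move=> Ux; exact: ipC (gsym Ux). Qed.

Definition gamma x i : R := ip (g x) (cov g i V1 x) (V2 x).

Let cov_V1_pre x i : U x -> cov g i V1 x = tau1 x i *: V1 x + gamma x i *: V4 x.
Proof.
move=> Ux; have [[_ x1 x2 _ _] [v11 v12 v13 v14] _ _] := ips Ux.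
rewrite {1}[LHS](expand _ Ux) b1// (@cov_self 0 V1 x i s1 _ Ux); last first.
  by move=> y Uy; have [_ [] ] := ips Uy.
have -> : ip (g x) (cov g i V1 x) (xi x) = 0.
  rewrite (@d_ip 0 V1 xi x i s1 xis _ Ux); last first.
    by move=> y Uy; have [[]] := ips Uy; rewrite xiC.
  by rewrite cov_xi_ip// v11 (ipC (V2 x) _ (gsym Ux)) v12 !mulr0 addr0 !oppr0.
by rewrite !scale0r add0r !addr0.
Qed.

Let cov_V2_pre x i : U x -> cov g i V2 x = tau2 x i *: V2 x - gamma x i *: V3 x.
Proof.
move=> Ux; have [_ [v11 v12 v13 v14] [v22 v23 v24] _] := ips Ux.
rewrite {1}[LHS](expand _ Ux) b2// (@cov_self 0 V2 x i s2 _ Ux); last first.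
  by move=> y Uy; have [_ _ []] := ips Uy.
have -> : ip (g x) (cov g i V2 x) (xi x) = 0.
  rewrite (@d_ip 0 V2 xi x i s2 xis _ Ux); last first.
    by move=> y Uy; have [[]] := ips Uy; rewrite xiC.
  by rewrite cov_xi_ip// v12 v22 !mulr0 addr0 !oppr0.
rewrite (@d_ip 0 V2 V1 x i s2 s1 _ Ux); last first.
  by move=> y Uy; have [_ [_ w12 _ _] _ _] := ips Uy; rewrite (ipC _ _ (gsym Uy)).
by rewrite !scale0r add0r !addr0 add0r -scaleNr.
Qed.

Let th_s V i : smooth_mx_on U V -> smooth_on U (fun y => th V y i).
Proof. by move=> Vs; apply: smooth_ip => //; exact: smooth_mx_cst. Qed.

Let covZ' i (f : 'rV[R]_5 -> R) (Y : 'rV[R]_5 -> 'rV[R]_5) x : smooth_on U f -> smooth_mx_on U Y -> U x ->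
  cov g i (fun y => f y *: Y y) x = partial i f x *: Y x + f x *: cov g i Y x.
Proof.
move=> fs Ys Ux.
exact: (covZ g i (smooth_diff fs Ux) (smooth_mx_mx_diff Ys Ux)).
Qed.

Let covD' i (Y Z : 'rV[R]_5 -> 'rV[R]_5) x : smooth_mx_on U Y -> smooth_mx_on U Z -> U x ->
  cov g i (fun y => Y y + Z y) x = cov g i Y x + cov g i Z x.
Proof.
move=> Ys Zs Ux.
exact: (covD g i (smooth_mx_mx_diff Ys Ux) (smooth_mx_mx_diff Zs Ux)).
Qed.

Let comm i j Z x : smooth_mx_on U Z -> U x ->
  cov g i (cov g j Z) x = cov g j (cov g i Z) x.
Proof. by move=> Zs Ux; exact: (cov_comm Uo gs gunit (ls_flat ls) i j Zs Ux). Qed.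

Let cov_cov_xi x i j : U x -> cov g i (cov g j xi) x =
  - (partial i (fun y => th V1 y j) x *: V1 x
     + th V1 x j *: (tau1 x i *: V1 x + gamma x i *: V4 x)
     + (sigma * partial i (fun y => th V2 y j) x *: V2 x
     + (sigma * th V2 x j) *: (tau2 x i *: V2 x - gamma x i *: V3 x))).
Proof.
move=> Ux; have s1j := th_s j s1; have s2j := th_s j s2.
have ss2 : smooth_on U (fun y => sigma * th V2 y j).
  by apply: smoothM => //; exact: smooth_cst.
have z1 : smooth_mx_on U (fun y => th V1 y j *: V1 y) by exact: smooth_mxZ.
have z2 : smooth_mx_on U (fun y => (sigma * th V2 y j) *: V2 y) by exact: smooth_mxZ.
rewrite (cov_open_eq g Uo i (fun y Uy => cov_xi j Uy) Ux).
rewrite (covN g i (smooth_mx_mx_diff (smooth_mxD Uo z1 z2) Ux)) (covD' i z1 z2 Ux).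
rewrite (covZ' i s1j s1 Ux) (covZ' i ss2 s2 Ux) -(cov_V1_pre i Ux) -(cov_V2_pre i Ux).
have [_ ->] : True /\ partial i (fun y => sigma * th V2 y j) x =
    sigma * partial i (fun y => th V2 y j) x.
  split=> //; rewrite (partialM i (differentiable_cst sigma x) (smooth_diff s2j Ux)).
  by rewrite partial_cst mul0r add0r.
by [].
Qed.

Let codazzi x i j (w : 'rV[R]_5) : U x ->
  let A := ip (g x) (V1 x) w in let B := ip (g x) (V2 x) w in
  let C := ip (g x) (V3 x) w in let D := ip (g x) (V4 x) w in
  [/\ [/\ A = 0, B = 0, C = 0 & D = 1] -> th V1 x j * gamma x i = th V1 x i * gamma x j,
      [/\ A = 0, B = 0, C = 1 & D = 0] -> th V2 x j * gamma x i = th V2 x i * gamma x j,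
      [/\ A = 1, B = 0, C = 0 & D = 0] ->
        partial i (fun y => th V1 y j) x + th V1 x j * tau1 x i =
        partial j (fun y => th V1 y i) x + th V1 x i * tau1 x j &
      [/\ A = 0, B = 1, C = 0 & D = 0] ->
        partial i (fun y => th V2 y j) x + th V2 x j * tau2 x i =
        partial j (fun y => th V2 y i) x + th V2 x i * tau2 x j].
Proof.
move=> Ux A B C D; apply: (codazzi_coefficients sigma0).
have H := etrans (esym (cov_cov_xi i j Ux)) (etrans (comm i j xis Ux) (cov_cov_xi j i Ux)).
have E (a1 a2 a3 a4 : 'rV[R]_5) (p q t u a b c : R) :
    ip (g x) (- (p *: a1 + t *: (a *: a1 + c *: a4) + (q *: a2 + u *: (b *: a2 - c *: a3)))) w
    = - (p * ip (g x) a1 w + t * (a * ip (g x) a1 w + c * ip (g x) a4 w)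
       + (q * ip (g x) a2 w + u * (b * ip (g x) a2 w - c * ip (g x) a3 w))).
  by rewrite !(ipNl, ipDl, ipZl).
apply: oppr_inj; apply: (etrans (esym (E _ _ _ _ _ _ _ _ _ _ _))).
apply: (etrans _ (E _ _ _ _ _ _ _ _ _ _ _)).
exact: (congr1 (fun v => ip (g x) v w) H).
Qed.

Let gamma0 x i : U x -> gamma x i = 0.
Proof.
move=> Ux; have [_ [v11 v12 v13 v14] [v22 v23 v24] [v33 v34 v44]] := ips Ux.
have c v w : ip (g x) v w = ip (g x) w v by exact: ipC (gsym Ux).
have A i' j' : th V1 x j' * gamma x i' = th V1 x i' * gamma x j'.
  have [H _ _ _] := codazzi i' j' (V2 x) Ux; apply: H.
  by split=> //; rewrite c.
have B i' j' : th V2 x j' * gamma x i' = th V2 x i' * gamma x j'.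
  have [_ H _ _] := codazzi i' j' (V1 x) Ux; apply: H.
  by split=> //; rewrite c.
pose k := \sum_j V3 x 0 j * gamma x j.
have g1 i' : gamma x i' = th V1 x i' * k.
  have := contract_eq (fun j => V3 x 0 j) (A i').
  by rewrite th_contract v13 mul1r.
have g2 i' : th V2 x i' * k = 0.
  have := contract_eq (fun j => V3 x 0 j) (B i').
  by rewrite th_contract v23 mul0r.
have g3 j : th V2 x j * k = 0 * k by rewrite g2 mul0r.
have := contract_eq (fun j => V4 x 0 j) g3.
by rewrite th_contract v24 mul1r mul0r g1 => ->; rewrite mulr0.
Qed.

Lemma cov_V1 x i : U x -> cov g i V1 x = tau1 x i *: V1 x.
Proof. by move=> Ux; rewrite cov_V1_pre// gamma0// scale0r addr0. Qed.

Lemma cov_V2 x i : U x -> cov g i V2 x = tau2 x i *: V2 x.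
Proof. by move=> Ux; rewrite cov_V2_pre// gamma0// scale0r subr0. Qed.

Let curl V x i j : smooth_mx_on U V -> U x ->
  partial i (fun y => th V y j) x - partial j (fun y => th V y i) x =
  ip (g x) (cov g i V x) (e_ j) - ip (g x) (cov g j V x) (e_ i).
Proof.
move=> Vs Ux; exact: (curl_inner Uo gs gsym gunit i j Ux (smooth_mx_mx_diff Vs Ux)).
Qed.

Let tau1_sym x i j : U x -> tau1 x i * th V1 x j = tau1 x j * th V1 x i /\
  partial i (fun y => th V1 y j) x = partial j (fun y => th V1 y i) x.
Proof.
move=> Ux; have [_ [v11 v12 v13 v14] [v22 v23 v24] [v33 v34 v44]] := ips Ux.
have c v w : ip (g x) v w = ip (g x) w v by exact: ipC (gsym Ux).
have [_ _ H _] := codazzi i j (V3 x) Ux.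
have {}H : partial i (fun y => th V1 y j) x + th V1 x j * tau1 x i =
    partial j (fun y => th V1 y i) x + th V1 x i * tau1 x j.
  by apply: H; split=> //; rewrite c.
have C : partial i (fun y => th V1 y j) x - partial j (fun y => th V1 y i) x =
    tau1 x i * th V1 x j - tau1 x j * th V1 x i.
  have E a b : ip (g x) (cov g a V1 x) (e_ b) = tau1 x a * th V1 x b.
    exact: (etrans (congr1 (fun v => ip (g x) v (e_ b)) (cov_V1 a Ux)) (ipZl _ _ _ _)).
  exact: (etrans (curl i j s1 Ux) (f_equal2 (fun a b => a - b) (E i j) (E j i))).
exact: (curl_codazzi H C).
Qed.

Let tau2_sym x i j : U x -> tau2 x i * th V2 x j = tau2 x j * th V2 x i /\
  partial i (fun y => th V2 y j) x = partial j (fun y => th V2 y i) x.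
Proof.
move=> Ux; have [_ [v11 v12 v13 v14] [v22 v23 v24] [v33 v34 v44]] := ips Ux.
have c v w : ip (g x) v w = ip (g x) w v by exact: ipC (gsym Ux).
have [_ _ _ H] := codazzi i j (V4 x) Ux.
have {}H : partial i (fun y => th V2 y j) x + th V2 x j * tau2 x i =
    partial j (fun y => th V2 y i) x + th V2 x i * tau2 x j.
  by apply: H; split=> //; rewrite c.
have C : partial i (fun y => th V2 y j) x - partial j (fun y => th V2 y i) x =
    tau2 x i * th V2 x j - tau2 x j * th V2 x i.
  have E a b : ip (g x) (cov g a V2 x) (e_ b) = tau2 x a * th V2 x b.
    exact: (etrans (congr1 (fun v => ip (g x) v (e_ b)) (cov_V2 a Ux)) (ipZl _ _ _ _)).
  exact: (etrans (curl i j s2 Ux) (f_equal2 (fun a b => a - b) (E i j) (E j i))).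
exact: (curl_codazzi H C).
Qed.

Lemma closed_V1 x i j : U x ->
  partial i (fun y => lowered V1 y j) x = partial j (fun y => lowered V1 y i) x.
Proof. by move=> Ux; have [] := tau1_sym i j Ux. Qed.

Lemma closed_V2 x i j : U x ->
  partial i (fun y => lowered V2 y j) x = partial j (fun y => lowered V2 y i) x.
Proof. by move=> Ux; have [] := tau2_sym i j Ux. Qed.

Lemma tau1E x i : U x -> tau1 x i = alpha1 x * lowered V1 x i.
Proof.
move=> Ux; have [_ [_ _ v13 _] _ _] := ips Ux.
have H j : th V1 x j * tau1 x i = th V1 x i * tau1 x j.
  by have [E _] := tau1_sym i j Ux; rewrite mulrC E mulrC.
have := contract_eq (fun j => V3 x 0 j) H.
by rewrite th_contract v13 mul1r mulrC.
Qed.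

Lemma tau2E x i : U x -> tau2 x i = alpha2 x * lowered V2 x i.
Proof.
move=> Ux; have [_ _ [_ _ v24] _] := ips Ux.
have H j : th V2 x j * tau2 x i = th V2 x i * tau2 x j.
  by have [E _] := tau2_sym i j Ux; rewrite mulrC E mulrC.
have := contract_eq (fun j => V4 x 0 j) H.
by rewrite th_contract v24 mul1r mulrC.
Qed.

Let c_ip x v w : U x -> ip (g x) v w = ip (g x) w v.
Proof. by move=> Ux; exact: ipC (gsym Ux). Qed.

Let cov_V3_coef x i : U x ->
  [/\ ip (g x) (cov g i V3 x) (xi x) = th V1 x i, ip (g x) (cov g i V3 x) (V1 x) = - tau1 x i,
    ip (g x) (cov g i V3 x) (V2 x) = 0 & ip (g x) (cov g i V3 x) (V3 x) = 0].
Proof.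
move=> Ux; have [_ [v11 v12 v13 v14] [v22 v23 v24] [v33 v34 v44]] := ips Ux; split.
- rewrite (@d_ip 0 V3 xi x i s3 xis _ Ux); last first.
    by move=> y Uy; have [[_ _ _ x3 _] _ _ _] := ips Uy; rewrite xiC.
  by rewrite (cov_xi_ip i _ Ux) v13 v23 mulr0 addr0 mulr1 opprK.
- rewrite (@d_ip 1 V3 V1 x i s3 s1 _ Ux)// => y Uy.
  by have [_ [_ _ w _] _ _] := ips Uy; rewrite c_ip.
- rewrite (@d_ip 0 V3 V2 x i s3 s2 _ Ux); first by rewrite b2// oppr0.
  by move=> y Uy; have [_ _ [_ w _] _] := ips Uy; rewrite c_ip.
- by apply: (@cov_self 0 V3 x i s3 _ Ux) => y Uy; have [_ _ _ []] := ips Uy.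
Qed.

Let cov_V4_coef x i : U x ->
  [/\ ip (g x) (cov g i V4 x) (xi x) = sigma * th V2 x i, ip (g x) (cov g i V4 x) (V1 x) = 0,
    ip (g x) (cov g i V4 x) (V2 x) = - tau2 x i,
    ip (g x) (cov g i V4 x) (V3 x) = - omega x i & ip (g x) (cov g i V4 x) (V4 x) = 0].
Proof.
move=> Ux; have [_ [v11 v12 v13 v14] [v22 v23 v24] [v33 v34 v44]] := ips Ux; split.
- rewrite (@d_ip 0 V4 xi x i s4 xis _ Ux); last first.
    by move=> y Uy; have [[_ _ _ _ x4] _ _ _] := ips Uy; rewrite xiC.
  by rewrite (cov_xi_ip i _ Ux) v14 v24 mulr0 add0r mulr1 opprK.
- rewrite (@d_ip 0 V4 V1 x i s4 s1 _ Ux); first by rewrite b1// oppr0.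
  by move=> y Uy; have [_ [_ _ _ w] _ _] := ips Uy; rewrite c_ip.
- rewrite (@d_ip 1 V4 V2 x i s4 s2 _ Ux)// => y Uy.
  by have [_ _ [_ _ w] _] := ips Uy; rewrite c_ip.
- rewrite (@d_ip 0 V4 V3 x i s4 s3 _ Ux)// => y Uy.
  by have [_ _ _ [_ w _]] := ips Uy; rewrite c_ip.
- by apply: (@cov_self 0 V4 x i s4 _ Ux) => y Uy; have [_ _ _ []] := ips Uy.
Qed.

Let cov_V3 x i : U x ->
  cov g i V3 x = th V1 x i *: xi x + omega x i *: V2 x + - tau1 x i *: V3 x.
Proof.
move=> Ux; have [c0 c1 c2 c3] := cov_V3_coef i Ux.
by rewrite {1}[LHS](expand _ Ux) c0 c1 c2 c3 !scale0r !addr0.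
Qed.

Let cov_V4 x i : U x ->
  cov g i V4 x = (sigma * th V2 x i) *: xi x + - omega x i *: V1 x + - tau2 x i *: V4 x.
Proof.
move=> Ux; have [c0 c1 c2 c3 c4] := cov_V4_coef i Ux.
by rewrite {1}[LHS](expand _ Ux) c0 c1 c2 c3 c4 !scale0r !addr0.
Qed.

Let smooth_form (Y Z : 'rV[R]_5 -> 'rV[R]_5) i : smooth_mx_on U Y -> smooth_mx_on U Z ->
  smooth_on U (fun x => ip (g x) (cov g i Y x) (Z x)).
Proof. by move=> Ys Zs; apply: smooth_ip => //; exact: smooth_cov. Qed.

Lemma smooth_lowered V i : smooth_mx_on U V -> smooth_on U (fun x => lowered V x i).
Proof. exact: th_s. Qed.

Lemma smooth_tau1 i : smooth_on U (fun x => tau1 x i).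
Proof. exact: smooth_form. Qed.

Lemma smooth_tau2 i : smooth_on U (fun x => tau2 x i).
Proof. exact: smooth_form. Qed.

Lemma smooth_omega i : smooth_on U (fun x => omega x i).
Proof. exact: smooth_form. Qed.

Lemma smooth_alpha1 : smooth_on U alpha1.
Proof.
apply: (smooth_sum Uo) => j; apply: (smoothM Uo); first exact: (s3 0 j).
exact: smooth_tau1.
Qed.

Lemma smooth_alpha2 : smooth_on U alpha2.
Proof.
apply: (smooth_sum Uo) => j; apply: (smoothM Uo); first exact: (s4 0 j).
exact: smooth_tau2.
Qed.

Let cov_comb i x w (f1 f2 f3 : 'rV[R]_5 -> R) (Y1 Y2 Y3 : 'rV[R]_5 -> 'rV[R]_5) :
  smooth_on U f1 -> smooth_on U f2 -> smooth_on U f3 ->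
  smooth_mx_on U Y1 -> smooth_mx_on U Y2 -> smooth_mx_on U Y3 -> U x ->
  ip (g x) (cov g i (fun y => f1 y *: Y1 y + f2 y *: Y2 y + f3 y *: Y3 y) x) w =
    partial i f1 x * ip (g x) (Y1 x) w + f1 x * ip (g x) (cov g i Y1 x) w
  + (partial i f2 x * ip (g x) (Y2 x) w + f2 x * ip (g x) (cov g i Y2 x) w)
  + (partial i f3 x * ip (g x) (Y3 x) w + f3 x * ip (g x) (cov g i Y3 x) w).
Proof.
move=> f1s f2s f3s Y1s Y2s Y3s Ux.
have z1 := smooth_mxZ Uo f1s Y1s; have z2 := smooth_mxZ Uo f2s Y2s.
have z3 := smooth_mxZ Uo f3s Y3s.
have E := etrans (covD' i (smooth_mxD Uo z1 z2) z3 Ux)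
  (f_equal2 +%R (etrans (covD' i z1 z2 Ux)
    (f_equal2 +%R (covZ' i f1s Y1s Ux) (covZ' i f2s Y2s Ux))) (covZ' i f3s Y3s Ux)).
have D (A B C A' B' C' : 'rV[R]_5) (a b c a' b' c' : R) :
    ip (g x) (a *: A + a' *: A' + (b *: B + b' *: B') + (c *: C + c' *: C')) w =
    a * ip (g x) A w + a' * ip (g x) A' w + (b * ip (g x) B w + b' * ip (g x) B' w)
    + (c * ip (g x) C w + c' * ip (g x) C' w).
  by rewrite !(ipDl, ipZl).
exact: (etrans (congr1 (fun v => ip (g x) v w) E) (D _ _ _ _ _ _ _ _ _ _ _ _)).
Qed.

Lemma closed_tau1 x i j : U x ->
  partial i (fun y => tau1 y j) x = partial j (fun y => tau1 y i) x.
Proof.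
move=> Ux; have [_ [_ _ v13 _] _ _] := ips Ux.
have E i' j' : ip (g x) (cov g i' (cov g j' V1) x) (V3 x) =
    partial i' (fun y => tau1 y j') x + tau1 x j' * tau1 x i'.
  have tj := smooth_tau1 j'.
  have C := etrans (cov_open_eq g Uo i' (fun y Uy => cov_V1 j' Uy) Ux) (covZ' i' tj s1 Ux).
  have D (A B : 'rV[R]_5) (a b : R) :
    ip (g x) (a *: A + b *: B) (V3 x) = a * ip (g x) A (V3 x) + b * ip (g x) B (V3 x).
    by rewrite ipDl !ipZl.
  apply: (etrans (congr1 (fun v => ip (g x) v (V3 x)) C)).
  by apply: (etrans (D _ _ _ _)); rewrite v13 mulr1.
have H := etrans (esym (E i j)) (etrans
  (congr1 (fun v => ip (g x) v (V3 x)) (comm i j s1 Ux)) (E j i)).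
exact: sym_cancel H.
Qed.

Lemma closed_tau2 x i j : U x ->
  partial i (fun y => tau2 y j) x = partial j (fun y => tau2 y i) x.
Proof.
move=> Ux; have [_ _ [_ _ v24] _] := ips Ux.
have E i' j' : ip (g x) (cov g i' (cov g j' V2) x) (V4 x) =
    partial i' (fun y => tau2 y j') x + tau2 x j' * tau2 x i'.
  have tj := smooth_tau2 j'.
  have C := etrans (cov_open_eq g Uo i' (fun y Uy => cov_V2 j' Uy) Ux) (covZ' i' tj s2 Ux).
  have D (A B : 'rV[R]_5) (a b : R) :
    ip (g x) (a *: A + b *: B) (V4 x) = a * ip (g x) A (V4 x) + b * ip (g x) B (V4 x).
    by rewrite ipDl !ipZl.
  apply: (etrans (congr1 (fun v => ip (g x) v (V4 x)) C)).
  by apply: (etrans (D _ _ _ _)); rewrite v24 mulr1.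
have H := etrans (esym (E i j)) (etrans
  (congr1 (fun v => ip (g x) v (V4 x)) (comm i j s2 Ux)) (E j i)).
exact: sym_cancel H.
Qed.

Lemma curl_omega x i j : U x ->
  partial i (fun y => omega y j) x - partial j (fun y => omega y i) x =
  - sigma * (lowered V1 x i * lowered V2 x j - lowered V1 x j * lowered V2 x i)
  - ((tau1 x i + tau2 x i) * omega x j - (tau1 x j + tau2 x j) * omega x i).
Proof.
move=> Ux; have [[_ _ _ _ x4] [_ _ _ v14] [_ _ v24] [_ v34 _]] := ips Ux.
have E i' j' : ip (g x) (cov g i' (cov g j' V3) x) (V4 x) =
    partial i' (fun y => omega y j') x - sigma * (th V1 x j' * th V2 x i')
    + omega x j' * tau2 x i' - tau1 x j' * omega x i'.
  have f1 := th_s j' s1; have f2 := smooth_omega j'.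
  have f3 := smoothN Uo (smooth_tau1 j').
  apply: (etrans (congr1 (fun v => ip (g x) v (V4 x))
    (cov_open_eq g Uo i' (fun y Uy => cov_V3 j' Uy) Ux))).
  apply: (etrans (cov_comb i' (V4 x) f1 f2 f3 xis s2 s3 Ux)).
  have D (p q r t o m t2 a b : R) : p * 0 + t * a + (q * 1 + o * t2) + (r * 0 + - m * b) =
    q + t * a + o * t2 - m * b by ring.
  rewrite x4 v24 v34 -/(tau2 x i') -/(omega x i').
  apply: (etrans (D _ _ _ _ _ _ _ _ _)).
  have F : ip (g x) (cov g i' xi x) (V4 x) = - (sigma * th V2 x i').
    by rewrite (cov_xi_ip i' _ Ux) v14 v24 mulr0 add0r mulr1.
  have K (a b c d t u s : R) : u = - (s * t) -> a + b * u + c - d = a - s * (b * t) + c - d.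
    by move=> ->; ring.
  exact: K F.
have H := etrans (esym (E i j)) (etrans
  (congr1 (fun v => ip (g x) v (V4 x)) (comm i j s3 Ux)) (E j i)).
exact: omega_cancel H.
Qed.

Lemma curl_V3 x i j : U x ->
  partial i (fun y => lowered V3 y j) x - partial j (fun y => lowered V3 y i) x =
  (lowered V1 x i * lowered xi x j - lowered V1 x j * lowered xi x i)
  + (omega x i * lowered V2 x j - omega x j * lowered V2 x i)
  - (tau1 x i * lowered V3 x j - tau1 x j * lowered V3 x i).
Proof.
move=> Ux; have E a b : ip (g x) (cov g a V3 x) (e_ b) =
    th V1 x a * th xi x b + omega x a * th V2 x b + - tau1 x a * th V3 x b.
  apply: (etrans (congr1 (fun v => ip (g x) v (e_ b)) (cov_V3 a Ux))).
  by rewrite !ipDl !ipZl.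
have A (p q r s t u v w y z k l : R) :
  p * q + r * s + - t * u - (v * w + y * z + - k * l) =
  (p * q - v * w) + (r * s - y * z) - (t * u - k * l) by ring.
apply: (etrans (curl i j s3 Ux)).
exact: (etrans (f_equal2 (fun a b => a - b) (E i j) (E j i)) (A _ _ _ _ _ _ _ _ _ _ _ _)).
Qed.

Lemma curl_V4 x i j : U x ->
  partial i (fun y => lowered V4 y j) x - partial j (fun y => lowered V4 y i) x =
  sigma * (lowered V2 x i * lowered xi x j - lowered V2 x j * lowered xi x i)
  - (omega x i * lowered V1 x j - omega x j * lowered V1 x i)
  - (tau2 x i * lowered V4 x j - tau2 x j * lowered V4 x i).
Proof.
move=> Ux; have E a b : ip (g x) (cov g a V4 x) (e_ b) =
    sigma * th V2 x a * th xi x b + - omega x a * th V1 x b + - tau2 x a * th V4 x b.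
  apply: (etrans (congr1 (fun v => ip (g x) v (e_ b)) (cov_V4 a Ux))).
  by rewrite !ipDl !ipZl.
have A (m p q r s t u v w y z k l : R) :
  m * p * q + - r * s + - t * u - (m * v * w + - y * z + - k * l) =
  m * (p * q - v * w) - (r * s - y * z) - (t * u - k * l) by ring.
apply: (etrans (curl i j s4 Ux)).
exact: (etrans (f_equal2 (fun a b => a - b) (E i j) (E j i)) (A _ _ _ _ _ _ _ _ _ _ _ _ _)).
Qed.

End StructureEquations.

(** * Potentials and adopted coordinates *)

Section Potentials.
Variables (R : realType) (m : nat) (x0 : 'rV[R]_m) (r : R).
Let U := ball x0 r.
Let Uo : open U. Proof. exact: ball_open. Qed.

Implicit Types (f h : 'rV[R]_m -> R) (w : 'I_m -> 'rV[R]_m -> R).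

Definition has_gradient f w : Prop :=
  smooth_on U f /\ forall x i, U x -> partial i f x = w i x.

Definition closed_form w : Prop :=
  (forall j, smooth_on U (w j)) /\
  forall x i j, U x -> partial i (w j) x = partial j (w i) x.

Lemma potential w : closed_form w -> exists f, has_gradient f w.
Proof.
move=> [ws wc].
have [||P Ps Pw] := @poincare R m x0 r (fun x => \col_i w i x).
- move=> i j; apply: (smooth_eq Uo _ (ws i)) => x _; by rewrite mxE.
- move=> x Ux i j.
  have E k : (fun y => (\col_i w i y) k (0 : 'I_1)) = w k by apply/funext => y; rewrite mxE.
  by rewrite (E j) (E i) wc// subrr.
exists P; split=> // x i Ux; have /colP/(_ i) := Pw x Ux.
by rewrite !mxE.
Qed.

Lemma has_gradientM f h w v : has_gradient f w -> has_gradient h v ->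
  has_gradient (fun x => f x * h x) (fun i x => w i x * h x + f x * v i x).
Proof.
move=> [fs fw] [hs hv]; split; first exact: smoothM.
move=> x i Ux; rewrite -(fw x i Ux) -(hv x i Ux).
exact: partialM (smooth_diff fs Ux) (smooth_diff hs Ux).
Qed.

Lemma has_gradientD f h w v : has_gradient f w -> has_gradient h v ->
  has_gradient (fun x => f x + h x) (fun i x => w i x + v i x).
Proof.
move=> [fs fw] [hs hv]; split; first exact: smoothD.
move=> x i Ux; rewrite -(fw x i Ux) -(hv x i Ux).
exact: partialD (smooth_diff fs Ux) (smooth_diff hs Ux).
Qed.

Lemma has_gradientN f w : has_gradient f w ->
  has_gradient (fun x => - f x) (fun i x => - w i x).
Proof.
move=> [fs fw]; split; first exact: smoothN.
by move=> x i Ux; rewrite -(fw x i Ux); exact: partialN (smooth_diff fs Ux).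
Qed.

Lemma has_gradientZ (a : R) f w : has_gradient f w ->
  has_gradient (fun x => a * f x) (fun i x => a * w i x).
Proof.
move=> [fs fw]; split; first by apply: smoothM => //; exact: smooth_cst.
move=> x i Ux; rewrite -(fw x i Ux).
rewrite (partialM i (differentiable_cst a x) (smooth_diff fs Ux)).
by rewrite partial_cst mul0r add0r.
Qed.

Lemma has_gradient_exp f w : has_gradient f w ->
  has_gradient (fun x => expR (f x)) (fun i x => expR (f x) * w i x).
Proof.
move=> [fs fw]; split; first exact: smooth_exp.
move=> x i Ux; rewrite -(fw x i Ux).
have [_ ->] := @partial_comp1 _ _ expR f x i (smooth_diff fs Ux) (@derivable_expR R (f x)).
by rewrite derive1E; congr (_ * _); exact: (@derive_val _ _ _ _ _ _ _ (is_derive_expR (f x))).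
Qed.

Lemma has_gradient_id f : smooth_on U f -> has_gradient f (fun i => partial i f).
Proof. by []. Qed.

Lemma has_gradient_eq f w v : (forall x i, U x -> w i x = v i x) ->
  has_gradient f w -> has_gradient f v.
Proof. by move=> wv [fs fw]; split=> // x i Ux; rewrite fw// wv. Qed.

Lemma closed_formP w (dw : 'I_m -> 'I_m -> 'rV[R]_m -> R) :
  (forall j, has_gradient (w j) (fun i => dw i j)) ->
  (forall x i j, U x -> dw i j x = dw j i x) -> closed_form w.
Proof.
move=> wd dsym; split=> [j|x i j Ux]; first by case: (wd j).
by rewrite (wd j).2// (wd i).2// dsym.
Qed.

Variables (sigma : R) (th0 th1 th2 th3 th4 tau1 tau2 om : 'I_m -> 'rV[R]_m -> R).
Variables (alpha1 alpha2 : 'rV[R]_m -> R).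
Hypotheses (th0c : closed_form th0) (th1c : closed_form th1) (th2c : closed_form th2).
Hypotheses (tau1c : closed_form tau1) (tau2c : closed_form tau2).
Hypothesis (th3s : forall j, smooth_on U (th3 j)).
Hypothesis (th4s : forall j, smooth_on U (th4 j)).
Hypothesis (oms : forall j, smooth_on U (om j)).
Hypothesis tau1E : forall x i, U x -> tau1 i x = alpha1 x * th1 i x.
Hypothesis tau2E : forall x i, U x -> tau2 i x = alpha2 x * th2 i x.
Hypothesis curl_om : forall x i j, U x ->
  partial i (om j) x - partial j (om i) x =
  - sigma * (th1 i x * th2 j x - th1 j x * th2 i x)
  - ((tau1 i x + tau2 i x) * om j x - (tau1 j x + tau2 j x) * om i x).
Hypothesis curl_th3 : forall x i j, U x ->
  partial i (th3 j) x - partial j (th3 i) x =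
  (th1 i x * th0 j x - th1 j x * th0 i x) + (om i x * th2 j x - om j x * th2 i x)
  - (tau1 i x * th3 j x - tau1 j x * th3 i x).
Hypothesis curl_th4 : forall x i j, U x ->
  partial i (th4 j) x - partial j (th4 i) x =
  sigma * (th2 i x * th0 j x - th2 j x * th0 i x) - (om i x * th1 j x - om j x * th1 i x)
  - (tau2 i x * th4 j x - tau2 j x * th4 i x).

Theorem adapted_potentials : exists t X1 X2 Y1 Y2 h1 h2 f q Q : 'rV[R]_m -> R,
  [/\ has_gradient t th0, has_gradient X1 th1, has_gradient X2 th2,
    has_gradient h1 tau1 & has_gradient h2 tau2] /\
  [/\ smooth_on U f, has_gradient q (fun i x => - sigma * th1 i x - alpha1 x * q x * th1 i x),
    has_gradient Q (fun i x => q x * th1 i x),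
    has_gradient Y1 (fun i x => th3 i x - f x * th2 i x - (alpha1 x * Y1 x - t x) * th1 i x) &
    has_gradient Y2 (fun i x => th4 i x + f x * th1 i x
      - (alpha2 x * Y2 x - sigma * t x + Q x) * th2 i x)].
Proof.
have [t tg] := potential th0c; have [X1 X1g] := potential th1c.
have [X2 X2g] := potential th2c.
have [h1 h1g] := potential tau1c; have [h2 h2g] := potential tau2c.
pose E1 x := expR (h1 x); pose E2 x := expR (h2 x).
pose N1 x := expR (- h1 x); pose N2 x := expR (- h2 x).
have NE1 x : N1 x * E1 x = 1 by rewrite /N1 /E1 -expRD addNr expR0.
have NE2 x : N2 x * E2 x = 1 by rewrite /N2 /E2 -expRD addNr expR0.
have E1g : has_gradient E1 (fun i x => E1 x * tau1 i x) by exact: has_gradient_exp.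
have E2g : has_gradient E2 (fun i x => E2 x * tau2 i x) by exact: has_gradient_exp.
have N1g : has_gradient N1 (fun i x => N1 x * - tau1 i x).
  exact: has_gradient_exp (has_gradientN h1g).
have N2g : has_gradient N2 (fun i x => N2 x * - tau2 i x).
  exact: has_gradient_exp (has_gradientN h2g).
have g1 j := has_gradient_id (th1c.1 j); have g2 j := has_gradient_id (th2c.1 j).
have g3 j := has_gradient_id (th3s j); have g4 j := has_gradient_id (th4s j).
have go j := has_gradient_id (oms j).
clearbody E1 E2 N1 N2.
have [H1 H1g] : exists H, has_gradient H (fun i x => E1 x * th1 i x).
  apply: potential; apply: (closed_formP (fun j => has_gradientM E1g (g1 j))) => x i j Ux.
  rewrite (th1c.2 x i j Ux) !tau1E//; move: (partial j _ x) => p; ring.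
have [F Fg] : exists F, has_gradient F
    (fun i x => E1 x * E2 x * om i x + sigma * (H1 x * E2 x * th2 i x)).
  apply: potential; apply: (closed_formP (fun j => has_gradientD
    (has_gradientM (has_gradientM E1g E2g) (go j))
    (has_gradientZ sigma (has_gradientM (has_gradientM H1g E2g) (g2 j))))) => x i j Ux.
  have := curl_om i j Ux; rewrite (th2c.2 x i j Ux) (tau2E i Ux) (tau2E j Ux).
  move: (partial i (om j) x) (partial j (om i) x) (partial j (th2 i) x) => p p' p'' H.
  have {H} -> : p = p' + (- sigma * (th1 i x * th2 j x - th1 j x * th2 i x)
    - ((tau1 i x + alpha2 x * th2 i x) * om j x - (tau1 j x + alpha2 x * th2 j x) * om i x)).
    by rewrite -H [RHS]addrC subrK.
  ring.
pose f x := N1 x * N2 x * F x.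
have fg : has_gradient f (fun i x => om i x + sigma * (N1 x * H1 x) * th2 i x
    - (tau1 i x + tau2 i x) * f x).
  apply: has_gradient_eq (has_gradientM (has_gradientM N1g N2g) Fg) => x i Ux.
  rewrite /f.
  have K (n1 n2 e1 e2 a b o s h c F' : R) : n1 * e1 = 1 -> n2 * e2 = 1 ->
    (n1 * - a * n2 + n1 * (n2 * - b)) * F' + n1 * n2 * (e1 * e2 * o + s * (h * e2 * c)) =
    o + s * (n1 * h) * c - (a + b) * (n1 * n2 * F').
    move=> e1E e2E.
    have -> : n1 * n2 * (e1 * e2 * o + s * (h * e2 * c)) =
      (n1 * e1) * (n2 * e2) * o + s * (n1 * h) * (n2 * e2) * c by ring.
    by rewrite e1E e2E; ring.
  exact: K (NE1 x) (NE2 x).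
pose q x := - sigma * (N1 x * H1 x).
have qg : has_gradient q (fun i x => - sigma * th1 i x - alpha1 x * q x * th1 i x).
  apply: has_gradient_eq (has_gradientZ (- sigma) (has_gradientM N1g H1g)) => x i Ux.
  rewrite tau1E// /q.
  have K (n e a c h s : R) : n * e = 1 ->
    - s * (n * - (a * c) * h + n * (e * c)) = - s * c - a * (- s * (n * h)) * c.
    move=> neE; have -> : n * (e * c) = n * e * c by ring.
    by rewrite neE; ring.
  exact: K (NE1 x).
have fg' : has_gradient f (fun i x => om i x - q x * th2 i x - (tau1 i x + tau2 i x) * f x).
  apply: has_gradient_eq fg => x i Ux; rewrite /q; ring.
clearbody f q.
have [Q Qg] : exists Q, has_gradient Q (fun i x => q x * th1 i x).
  apply: potential; apply: (closed_formP (fun j => has_gradientM qg (g1 j))) => x i j Ux.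
  rewrite (th1c.2 x i j Ux); move: (partial j _ x) => p; ring.
have [W1 W1g] : exists W, has_gradient W
    (fun i x => E1 x * (th3 i x + - (f x * th2 i x) + t x * th1 i x)).
  apply: potential; apply: (closed_formP (fun j => has_gradientM E1g
    (has_gradientD (has_gradientD (g3 j) (has_gradientN (has_gradientM fg' (g2 j))))
      (has_gradientM tg (g1 j))))) => x i j Ux.
  have := curl_th3 i j Ux; rewrite (th2c.2 x i j Ux) (th1c.2 x i j Ux).
  rewrite (tau2E i Ux) (tau2E j Ux) (tau1E i Ux) (tau1E j Ux).
  move: (partial i (th3 j) x) (partial j (th3 i) x) (partial j (th2 i) x) (partial j (th1 i) x).
  move=> p p' p2 p1 H.
  have {H} -> : p = p' + ((th1 i x * th0 j x - th1 j x * th0 i x)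
     + (om i x * th2 j x - om j x * th2 i x)
     - (alpha1 x * th1 i x * th3 j x - alpha1 x * th1 j x * th3 i x)).
    by rewrite -H [RHS]addrC subrK.
  ring.
have [W2 W2g] : exists W, has_gradient W
    (fun i x => E2 x * (th4 i x + f x * th1 i x + (sigma * (t x * th2 i x) + - (Q x * th2 i x)))).
  apply: potential; apply: (closed_formP (fun j => has_gradientM E2g
    (has_gradientD (has_gradientD (g4 j) (has_gradientM fg' (g1 j)))
      (has_gradientD (has_gradientZ sigma (has_gradientM tg (g2 j)))
         (has_gradientN (has_gradientM Qg (g2 j))))))) => x i j Ux.
  have := curl_th4 i j Ux; rewrite (th2c.2 x i j Ux) (th1c.2 x i j Ux).
  rewrite (tau2E i Ux) (tau2E j Ux) (tau1E i Ux) (tau1E j Ux).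
  move: (partial i (th4 j) x) (partial j (th4 i) x) (partial j (th2 i) x) (partial j (th1 i) x).
  move=> p p' p2 p1 H.
  have {H} -> : p = p' + (sigma * (th2 i x * th0 j x - th2 j x * th0 i x)
     - (om i x * th1 j x - om j x * th1 i x)
     - (alpha2 x * th2 i x * th4 j x - alpha2 x * th2 j x * th4 i x)).
    by rewrite -H [RHS]addrC subrK.
  ring.
have K (n e a w v : R) : n * e = 1 -> n * - a * w + n * (e * v) = v - a * (n * w).
  move=> neE; have -> : n * (e * v) = n * e * v by ring.
  by rewrite neE; ring.
exists t, X1, X2, (fun x => N1 x * W1 x), (fun x => N2 x * W2 x), h1, h2, f, q, Q; split=> //.
split=> //; first by case: fg'.
  apply: has_gradient_eq (has_gradientM N1g W1g) => x i Ux.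
  rewrite (K _ _ _ _ _ (NE1 x)) tau1E//; ring.
apply: has_gradient_eq (has_gradientM N2g W2g) => x i Ux.
rewrite (K _ _ _ _ _ (NE2 x)) tau2E//; ring.
Qed.

End Potentials.

Section Charts.
Variables (R : realType) (m : nat) (M : topologicalType).
Implicit Types (c d : chart R m M).

Lemma chart_cinvK c x : is_chart c -> cimg c x ->
  cdom c (cinv c x) /\ cmap c (cinv c x) = x.
Proof. by move=> [_ _ K _ _] [q cq <-]; rewrite K ?inE. Qed.

Lemma overlap_open c d : is_chart c -> open (cdom d) -> open (overlap c d).
Proof.
move=> [co io K _ ic] dopen; rewrite openE => x [q [cq dq] qx].
have cx : cimg c x by exists q.
have dx : cdom d (cinv c x) by rewrite -qx K ?inE.
have ncx : nbhs x (cimg c) by exact: open_nbhs_nbhs.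
have ndx : nbhs x (cinv c @^-1` cdom d).
  by apply: (ic x (mem_set cx)); exact: open_nbhs_nbhs.
apply: filterS2 ncx ndx => y [q' cq' <-]; rewrite /= K ?inE// => dq'.
by exists q'.
Qed.

Section NewChart.
Variables (S : set (chart R m M)) (c0 : chart R m M) (B D : set 'rV[R]_m).
Variables (Psi F : 'rV[R]_m -> 'rV[R]_m).
Hypotheses (SM : smooth_manifold S) (Sc0 : S c0).
Hypotheses (Bo : open B) (Bc0 : B `<=` cimg c0) (Do : open D).
Hypotheses (Psis : smooth_mx_on B Psi) (Fs : smooth_mx_on D F).
Hypotheses (FB : forall y, D y -> B (F y)) (PsiF : forall y, D y -> Psi (F y) = y).
Hypothesis FDo : open (F @` D).

Definition new_chart : chart R m M :=
  Chart [set q | cdom c0 q /\ (F @` D) (cmap c0 q)] (Psi \o cmap c0) (cinv c0 \o F).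

Let c0c := atlas_chart SM Sc0.

Let F_cinv y : D y -> cdom c0 (cinv c0 (F y)) /\ cmap c0 (cinv c0 (F y)) = F y.
Proof. by move=> Dy; apply: chart_cinvK => //; exact/Bc0/FB. Qed.

Lemma new_chart_img : cimg new_chart = D.
Proof.
apply/seteqP; split=> [_ [q [cq [y Dy Fy]] <-]|y Dy] /=; first by rewrite -Fy PsiF.
have [dq mq] := F_cinv Dy.
by exists (cinv c0 (F y)); [split; rewrite ?mq//; exists y|rewrite /= mq PsiF].
Qed.

Lemma new_chart_transition y : D y -> transition new_chart c0 y = F y.
Proof. by move=> /F_cinv[]. Qed.

Lemma new_chart_overlap : overlap new_chart c0 = D.
Proof.
rewrite -new_chart_img /overlap /cimg; congr (_ @` _).
by apply/seteqP; split=> [q []|q [cq Fq]].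
Qed.

Let new_is_chart : is_chart new_chart.
Proof.
have [co io K mc ic] := c0c.
split.
- rewrite openE => q [cq Fq]; apply: filterI; first exact: open_nbhs_nbhs.
  by apply: (mc q (mem_set cq)); exact: open_nbhs_nbhs.
- by rewrite new_chart_img.
- move=> q /set_mem[cq [y Dy Fy]]; rewrite /= -Fy PsiF// Fy.
  by rewrite K ?inE.
- move=> q /set_mem[cq [y Dy Fy]].
  apply: continuous_comp; first exact: mc (mem_set cq).
  by rewrite -Fy; apply: differentiable_continuous; apply: (smooth_mx_diff Psis); exact: FB.
move=> y /set_mem; rewrite new_chart_img => Dy.
apply: continuous_comp.
  by apply: differentiable_continuous; exact: (smooth_mx_diff Fs).
by apply: ic; rewrite inE; exact/Bc0/FB.
Qed.

Lemma new_chart_atlas : S new_chart.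
Proof.
apply: (atlas_maximal SM) => // d Sd.
have dc := atlas_chart SM Sd.
have [dopen _ dK _ _] := dc; have [c0open _ c0K _ _] := c0c.
have [newo _ _ _ _] := new_is_chart.
have [c0d dc0] := atlas_compatible SM Sc0 Sd.
split.
  have sub : overlap new_chart d `<=` D.
    by rewrite -new_chart_img => _ [q [cq _] <-]; exists q.
  apply: (@smooth_mx_comp _ _ _ (overlap_open new_is_chart dopen) _ _ _
    (overlap c0 d) (transition c0 d) F) => //; last first.
    by move=> i j; exact: smooth_sub sub (Fs i j).
  move=> _ [q [[cq [y Dy Fy]] dq] <-]; rewrite /= -Fy PsiF// Fy.
  by exists q.
have sub : overlap d new_chart `<=` overlap d c0.
  by move=> _ [q [dq [cq _]] <-]; exists q.
apply: (@smooth_mx_comp _ _ _ (overlap_open dc newo) _ _ _ B Psi (transition d c0)) => //.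
  move=> _ [q [dq [cq [y Dy Fy]]] <-]; rewrite /transition /= dK ?inE// -Fy.
  exact: FB.
by move=> i j; exact: smooth_sub sub (dc0 i j).
Qed.

End NewChart.
End Charts.

Section Transfer.
Variables (R : realType) (m : nat) (U D : set 'rV[R]_m).
Variables (g h : 'rV[R]_m -> 'M[R]_m) (F : 'rV[R]_m -> 'rV[R]_m).
Hypotheses (Uo : open U) (Do : open D).
Hypotheses (gs : smooth_mx_on U g) (hs : smooth_mx_on D h) (Fs : smooth_mx_on D F).
Hypothesis gsym : forall x, U x -> (g x)^T = g x.
Hypothesis gunit : forall x, U x -> g x \in unitmx.
Hypothesis hunit : forall y, D y -> h y \in unitmx.
Hypothesis FU : forall y, D y -> U (F y).
Hypothesis hE : forall y, D y -> h y = 'J F y *m g (F y) *m ('J F y)^T.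

Lemma cov_metric_eq (g' : 'rV[R]_m -> 'M[R]_m) i Y y :
  (forall z, D z -> h z = g' z) -> D y -> cov h i Y y = cov g' i Y y.
Proof.
move=> hg Dy; rewrite /cov; congr (_ + _); apply: eq_bigr => j _; congr (_ *: _).
apply/rowP => k; rewrite !mxE /christoffel (hg y Dy); congr (_ * _).
apply: eq_bigr => l _; congr (_ * (_ + _ - _)).
- by apply: (open_eq_partial Do) => // z /hg ->.
- by apply: (open_eq_partial Do) => // z /hg ->.
- by apply: (open_eq_partial Do) => // z /hg ->.
Qed.

Lemma nabla_transfer (X Z V : 'rV[R]_m -> 'rV[R]_m) y :
  smooth_mx_on D Z -> smooth_mx_on U V ->
  (forall z, D z -> V (F z) = Z z *m 'J F z) -> D y ->
  nabla h X Z y *m 'J F y = \sum_a (X y *m 'J F y) 0 a *: cov g a V (F y).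
Proof.
move=> Zs Vs VZ Dy.
pose h' z := 'J F z *m g (F z) *m ('J F z)^T.
have h'u z : D z -> h' z \in unitmx by move=> Dz; rewrite /h' -hE//; exact: hunit.
have Ju : 'J F y \in unitmx.
  by have := h'u y Dy; rewrite /h' !unitmx_mul => /andP[/andP[]].
have E i : cov h i Z y *m 'J F y = \sum_a ('J F y) i a *: cov g a V (F y).
  apply: (ip_inj (gunit (FU Dy))) => w.
  have -> : w = (w *m invmx ('J F y)) *m 'J F y by rewrite mulmxKV.
  rewrite -(cov_immersion Uo gs gsym gunit Do Fs FU h'u i _ Zs Vs VZ Dy).
  rewrite (@cov_metric_eq h' i Z y hE Dy).
  exact: (esym (ip_pullback g F y _ _)).
rewrite (nablaE h X (smooth_mx_mx_diff Zs Dy)) mulmx_suml.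
under eq_bigr => i _ do rewrite -scalemxAl E scaler_sumr.
rewrite exchange_big/=; apply: eq_bigr => a _.
rewrite mxE scaler_suml; apply: eq_bigr => i _.
by rewrite scalerA.
Qed.

End Transfer.

Section LocalCoordinates.
Variable R : realType.
Variables (C : set 'rV[R]_5) (g phi : 'rV[R]_5 -> 'M[R]_5).
Variables (xi : 'rV[R]_5 -> 'rV[R]_5) (eta : 'rV[R]_5 -> 'cV[R]_5) (sigma : R).
Variables (V1 V2 : 'rV[R]_5 -> 'rV[R]_5) (x0 : 'rV[R]_5).
Hypothesis ls : local_structure C g phi xi eta.
Hypothesis leaves : parallel_leaves C g phi eta.
Hypotheses (Cx0 : C x0) (s1 : smooth_mx_on C V1) (s2 : smooth_mx_on C V2).
Hypotheses (n1 : V1 x0 != 0) (n2 : V2 x0 != 0).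
Hypothesis e1 : forall x, C x -> V1 x *m phi x = -1 *: V1 x.
Hypothesis e2 : forall x, C x -> V2 x *m phi x = 1 *: V2 x.
Hypothesis v12 : forall x, C x -> ip (g x) (V1 x) (V2 x) = 0.
Hypothesis sigma0 : sigma != 0.
Hypothesis cov_xi : forall x i, C x -> cov g i xi x =
  - (lowered g V1 x i *: V1 x + (sigma * lowered g V2 x i) *: V2 x).

Let sm1 : (-1 : R) * -1 = 1. Proof. by rewrite mulrNN mulr1. Qed.
Let s11 : (1 : R) * 1 = 1. Proof. by rewrite mulr1. Qed.

Lemma para_kahler_cov (r : R) (s : R) (V V' : 'rV[R]_5 -> 'rV[R]_5) x i :
  ball x0 r `<=` C -> s * s = 1 ->
  smooth_mx_on (ball x0 r) V -> smooth_mx_on (ball x0 r) V' ->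
  (forall y, ball x0 r y -> V y *m phi y = s *: V y) ->
  (forall y, ball x0 r y -> V' y *m phi y = s *: V' y) -> ball x0 r x ->
  ip (g x) (cov g i V x) (V' x) = 0.
Proof.
move=> BC ss Vs V's VF V'F Bx.
have Bo : open (ball x0 r) by exact: ball_open.
have lsB := local_structure_sub Bo BC ls.
have [t ts dt] := poincare (ls_eta lsB) (ls_closed lsB).
pose e : 'rV[R]_5 := delta_mx 0 i.
pose k := (e *m eta x) 0 0.
pose u := e - k *: xi x.
have ueta : (u *m eta x) 0 0 = 0.
  rewrite mulmxBl -scalemxAl.
  have mxB (a b : 'M[R]_1) (c : R) : (a - c *: b) 0 0 = a 0 0 - c * b 0 0 by rewrite !mxE.
  by rewrite mxB (ls_dual lsB Bx (xi x)) (ls_norm lsB Bx) mulr1 subrr.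
have T := leaf_cov lsB BC leaves ts dt ss Vs VF Bx (V'F x Bx) ueta.
have X := xi_cov lsB Bx ss Vs V's VF V'F.
have E : ip (g x) (cov g i V x) (V' x) =
    ip (g x) (\sum_a u 0 a *: cov g a V x) (V' x)
    + k * ip (g x) (\sum_a xi x 0 a *: cov g a V x) (V' x).
  rewrite -ipZl -ipDl; congr (ip _ _ _).
  rewrite scaler_sumr -big_split/= (bigD1 i)//= big1 ?addr0 => [|a ai].
    by rewrite !mxE !eqxx /= scalerA -scalerDl subrK scale1r.
  by rewrite !mxE eqxx (negbTE ai) /= scalerA -scalerDl subrK scale0r.
by rewrite E T X mulr0 addr0.
Qed.

(* q and Q are the functions B' and B of the theorem, for which A = 0. *)
Theorem local_adapted_coordinates : exists r : R, [/\ 0 < r, ball x0 r `<=` C &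
  exists (V3 V4 : 'rV[R]_5 -> 'rV[R]_5) (t X1 X2 Y1 Y2 h1 h2 q Q a1 a2 : 'rV[R]_5 -> R),
  [/\ adapted_frame (ball x0 r) g phi V1 V2 V3 V4,
     smooth_on (ball x0 r) a1 /\ smooth_on (ball x0 r) a2,
     (forall x i, ball x0 r x -> cov g i V1 x = partial i h1 x *: V1 x /\
       cov g i V2 x = partial i h2 x *: V2 x),
     [/\ has_gradient x0 r t (fun i x => lowered g xi x i),
       has_gradient x0 r X1 (fun i x => lowered g V1 x i),
       has_gradient x0 r X2 (fun i x => lowered g V2 x i),
       has_gradient x0 r h1 (fun i x => a1 x * lowered g V1 x i) &
       has_gradient x0 r h2 (fun i x => a2 x * lowered g V2 x i)] &
     [/\ has_gradient x0 r q
          (fun i x => - sigma * lowered g V1 x i - a1 x * q x * lowered g V1 x i),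
       has_gradient x0 r Q (fun i x => q x * lowered g V1 x i),
       has_gradient x0 r Y1 (fun i x => lowered g V3 x i
          - (a1 x * Y1 x - t x) * lowered g V1 x i) &
       has_gradient x0 r Y2 (fun i x => lowered g V4 x i
          - (a2 x * Y2 x - sigma * t x + Q x) * lowered g V2 x i)]]].
Proof.
have [r r0 [BC [W3 [W4 af]]]] := adapted_frame_exists ls Cx0 s1 s2 n1 n2 e1 e2 v12.
have Bo : open (ball x0 r) by exact: ball_open.
have lsB := local_structure_sub Bo BC ls.
have cov_xiB x i (Bx : ball x0 r x) := cov_xi i (BC x Bx).
have b1 x i : ball x0 r x -> ip (g x) (cov g i V1 x) (W4 x) = 0.
  exact: (para_kahler_cov i BC sm1 (af_s1 af) (af_s4 af) (af_e1 af) (af_e4 af)).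
have b2 x i : ball x0 r x -> ip (g x) (cov g i V2 x) (W3 x) = 0.
  exact: (para_kahler_cov i BC s11 (af_s2 af) (af_s3 af) (af_e2 af) (af_e3 af)).
have sl V j : smooth_mx_on (ball x0 r) V -> smooth_on (ball x0 r) (fun x => lowered g V x j).
  exact: (smooth_lowered lsB).
pose t1 := tau1 g V1 W3; pose t2 := tau2 g V2 W4; pose om := omega g W3 W4.
pose al1 := alpha1 g V1 W3; pose al2 := alpha2 g V2 W4.
have cl V : smooth_mx_on (ball x0 r) V -> (forall x i j, ball x0 r x ->
    partial i (fun y => lowered g V y j) x = partial j (fun y => lowered g V y i) x) ->
    closed_form x0 r (fun i x => lowered g V x i).
  by move=> Vs Vc; split=> [j|]; [exact: sl|exact: Vc].
have th0c : closed_form x0 r (fun i x => lowered g xi x i).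
  apply: (cl _ (ls_xi lsB)) => x i j Bx.
  have E a b : partial a (fun y => eta y b 0) x = partial a (fun y => lowered g xi y b) x.
    by apply: (open_eq_partial Bo _ _ Bx) => y By; exact: (eta_entry lsB).
  apply: (etrans (esym (E i j))); apply: (etrans _ (E j i)).
  by apply/eqP; rewrite -subr_eq0; apply/eqP; exact: (ls_closed lsB).
have th1c := cl V1 (af_s1 af) (fun x i j Bx => closed_V1 lsB af sigma0 cov_xiB b1 b2 i j Bx).
have th2c := cl V2 (af_s2 af) (fun x i j Bx => closed_V2 lsB af sigma0 cov_xiB b1 b2 i j Bx).
have tau1c : closed_form x0 r (fun i x => t1 x i).
  split=> [j|x i j Bx]; first exact: (smooth_tau1 lsB af).
  exact: (closed_tau1 lsB af sigma0 cov_xiB b1 b2).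
have tau2c : closed_form x0 r (fun i x => t2 x i).
  split=> [j|x i j Bx]; first exact: (smooth_tau2 lsB af).
  exact: (closed_tau2 lsB af sigma0 cov_xiB b1 b2).
have [t [X1 [X2 [Y1 [Y2 [h1 [h2 [f [q [Q [[tg X1g X2g h1g h2g] [fs qg Qg Y1g Y2g]]]]]]]]]]]] :=
  adapted_potentials th0c th1c th2c tau1c tau2c (fun j => sl W3 j (af_s3 af))
   (fun j => sl W4 j (af_s4 af)) (smooth_omega lsB af)
   (fun x i Bx => tau1E lsB af sigma0 cov_xiB b1 b2 i Bx)
   (fun x i Bx => tau2E lsB af sigma0 cov_xiB b1 b2 i Bx)
   (fun x i j Bx => curl_omega lsB af cov_xiB b2 i j Bx)
   (fun x i j Bx => curl_V3 lsB af cov_xiB b2 i j Bx)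
   (fun x i j Bx => curl_V4 lsB af cov_xiB b1 i j Bx).
exists r; split=> //.
exists (fun x => W3 x - f x *: V2 x), (fun x => W4 x + f x *: V1 x).
exists t, X1, X2, Y1, Y2, h1, h2, q, Q, al1, al2.
have lin (V V' : 'rV[R]_5 -> 'rV[R]_5) (k : R) x i :
    ip (g x) (V x + k *: V' x) (delta_mx 0 i) = lowered g V x i + k * lowered g V' x i.
  by rewrite ipDl ipZl.
have linN (V V' : 'rV[R]_5 -> 'rV[R]_5) (k : R) x i :
    ip (g x) (V x - k *: V' x) (delta_mx 0 i) = lowered g V x i - k * lowered g V' x i.
  by rewrite ipBl ipZl.
split.
- have V3s : smooth_mx_on (ball x0 r) (fun x => W3 x - f x *: V2 x).
    apply: (smooth_mxD Bo); first exact: (af_s3 af).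
    by apply: (smooth_mxN Bo); apply: (smooth_mxZ Bo fs); exact: (af_s2 af).
  have V4s : smooth_mx_on (ball x0 r) (fun x => W4 x + f x *: V1 x).
    apply: (smooth_mxD Bo); first exact: (af_s4 af).
    by apply: (smooth_mxZ Bo fs); exact: (af_s1 af).
  split=> //; try (by case: af).
  - move=> x Bx; rewrite mulmxBl -scalemxAl (af_e3 af Bx) (af_e2 af Bx).
    by rewrite !scale1r.
  - move=> x Bx; rewrite mulmxDl -scalemxAl (af_e4 af Bx) (af_e1 af Bx).
    by rewrite scalerDr !scalerA mulrC.
  - move=> x Bx; rewrite ipBr ipZr (af_12 af Bx) (af_13 af Bx).
    by rewrite mulr0 subr0.
  - move=> x Bx; rewrite ipDr ipZr (ipC _ (V1 x) (ls_sym lsB Bx)) (af_12 af Bx) (af_24 af Bx).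
    by rewrite mulr0 addr0.
  move=> x Bx; rewrite ipBl !ipDr !ipZl !ipZr (af_34 af Bx) (af_24 af Bx).
  rewrite (ipC _ (V1 x) (ls_sym lsB Bx)) (af_13 af Bx).
  by rewrite (ipC _ (V1 x) (ls_sym lsB Bx)) (af_12 af Bx) !mulr0 addr0 add0r subrr.
- by split; [exact: (smooth_alpha1 lsB af)|exact: (smooth_alpha2 lsB af)].
- move=> x i Bx; rewrite h1g.2// h2g.2//; split.
    exact: (cov_V1 lsB af sigma0 cov_xiB b1 b2).
  exact: (cov_V2 lsB af sigma0 cov_xiB b1 b2).
- split=> //.
    apply: has_gradient_eq h1g => x i Bx; exact: (tau1E lsB af sigma0 cov_xiB b1 b2).
  apply: has_gradient_eq h2g => x i Bx; exact: (tau2E lsB af sigma0 cov_xiB b1 b2).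
split=> //.
  by apply: has_gradient_eq Y1g => x i Bx; rewrite -linN.
by apply: has_gradient_eq Y2g => x i Bx; rewrite -lin.
Qed.

End LocalCoordinates.

Lemma dependence_line (R : realType) m (y0 : 'rV[R]_m) rho (f : 'rV[R]_m -> R) k z z' :
  smooth_on (ball y0 rho) f ->
  (forall y i, ball y0 rho y -> i != k -> partial i f y = 0) ->
  ball y0 rho z -> ball y0 rho z' -> z 0 k = z' 0 k -> f z = f z'.
Proof.
move=> fs fk Bz Bz' zk; apply/esym/eqP; rewrite -subr_eq0; apply/eqP.
have [|s /andP[s0 s1]] := @MVT_line R m f z (z' - z).
  by move=> s s01; apply: (smooth_diff fs); exact: ball_line.
rewrite subrKC => ->; rewrite mxE big1// => i _.
have Bs : ball y0 rho (z + s *: (z' - z)) by apply: ball_line => //; rewrite !ltW.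
have [->|ik] := eqVneq i k; last by rewrite [X in _ * X]mxE fk// mulr0.
by rewrite mxE [in X in _ + X]mxE zk subrr mul0r.
Qed.

Section PlaneReduction.
Variables (R : realType) (y0 : 'rV[R]_5) (rho : R).
Let D := ball y0 rho.
Let Do : open D. Proof. exact: ball_open. Qed.

Let x12 (z : 'rV[R]_5) : 'rV[R]_2 := row2 (z 0 1) (z 0 2).

Definition slice (w : 'rV[R]_2) : 'rV[R]_5 := y0 + (w 0 0 - y0 0 1) *: delta_mx 0 1.

Lemma slice_smooth (W : set 'rV[R]_2) : open W -> smooth_mx_on W slice.
Proof.
move=> Wo i j; rewrite (ord1 i).
have H : smooth_on W (fun w => y0 0 j + (w 0 0 - y0 0 1) * (delta_mx 0 1 : 'rV[R]_5) 0 j).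
  apply: (smoothD Wo); first exact: smooth_cst.
  apply: (smoothM Wo); last exact: smooth_cst.
  apply: (smoothB Wo); [exact: smooth_coord|exact: smooth_cst].
by apply: (smooth_eq Wo _ H) => w _; rewrite [in RHS]mxE [X in _ = _ + X]mxE.
Qed.

Lemma slice_open : open (slice @^-1` D).
Proof.
apply: open_comp => // w _; apply: differentiable_continuous.
exact: (smooth_mx_diff (slice_smooth openT)).
Qed.

Lemma slice_ball z : D z -> D (slice (x12 z)).
Proof.
rewrite /D -!ball_normE /= => Dz.
rewrite /slice opprD addrA subrr add0r normrN; apply: le_lt_trans Dz.
rewrite normrZ.
have -> : x12 z 0 0 = z 0 1 by rewrite [LHS]mxE.
apply: le_trans (_ : `|z 0 1 - y0 0 1| * 1 <= _).
  rewrite ler_wpM2l//; apply: norm_le_coord => [//|i j]; rewrite mxE.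
  by case: (_ && _); rewrite ?normr1// normr0 ler01.
rewrite mulr1 distrC.
have := coord_le_norm (y0 - z) 0 1.
by rewrite !mxE.
Qed.

Lemma x12_slice z : (slice (x12 z)) 0 1 = z 0 1.
Proof. by rewrite !mxE !eqxx /= mulr1 subrKC. Qed.

Lemma partial1_x12 (h : 'rV[R]_2 -> R) z : differentiable h (x12 z) ->
  partial 1 (fun z => h (x12 z)) z = partial 0 h (x12 z).
Proof.
move=> dh.
have x12s : smooth_mx_on [set: 'rV[R]_5] x12.
  move=> i j; rewrite (ord1 i).
  apply: (smooth_eq openT (f := fun z => if j == 0 then z 0 1 else z 0 2)).
    by move=> w _; rewrite mxE.
  by case: (j == 0); exact: smooth_coord openT _.
have [_ ->] := partial_comp 1 dh (smooth_mx_diff x12s (I : [set: 'rV[R]_5] z)).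
have E j : (fun z => x12 z 0 j) = (fun z => if j == 0 then z 0 1 else z 0 2).
  by apply/funext => w; rewrite mxE.
rewrite (bigD1 0)//= [X in _ + X]big1 ?addr0 => [|j j0].
  by rewrite E /= (partial_coord 1 1 z) eqxx mul1r.
by rewrite E (negbTE j0) (partial_coord 1 2 z) mul0r.
Qed.

Lemma partials_slice (f f1 : 'rV[R]_5 -> R) : smooth_on D f ->
  (forall y, D y -> partial 1 f y = f1 y) ->
  (forall y (i : 'I_5), D y -> i != 1 -> partial i f y = 0) ->
  [/\ smooth_on (x12 @` D) (fun w => f (slice w)),
    forall z, D z -> f (slice (x12 z)) = f z,
    forall z, D z -> partial 0 (fun w => f (slice w)) (x12 z) = f1 z &
    forall z, D z -> partial 0 (partial 0 (fun w => f (slice w))) (x12 z) = partial 1 f1 z].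
Proof.
move=> fs df1 df0; set W := slice @^-1` D.
have Wo : open W by exact: slice_open.
have xW z : D z -> W (x12 z) by exact: slice_ball.
have Fs : smooth_on W (fun w => f (slice w)).
  by apply: (smooth_comp Wo _ fs) => //; exact: slice_smooth.
have E z : D z -> f (slice (x12 z)) = f z.
  move=> Dz; apply: (dependence_line fs df0) => //; last exact: x12_slice.
  exact: slice_ball.
have E0 z : D z -> partial 0 (fun w => f (slice w)) (x12 z) = f1 z.
  move=> Dz; rewrite -df1// -(partial1_x12 (smooth_diff Fs (xW z Dz))).
  exact: (open_eq_partial Do).
split=> //; first by apply: smooth_sub Fs => _ [z Dz <-]; exact: xW.
move=> z Dz.
rewrite -(partial1_x12 (smooth_diff (smooth_partial 0 Fs) (xW z Dz))).
exact: (open_eq_partial Do).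
Qed.

End PlaneReduction.

Lemma mulmx_linv_inj (R : pzRingType) n (A A' : 'M[R]_n) (v w : 'rV[R]_n) :
  A *m A' = 1%:M -> v *m A = w *m A -> v = w.
Proof. by move=> AA vw; rewrite -[v]mulmx1 -[w]mulmx1 -AA !mulmxA vw. Qed.

Lemma eigen_transfer (R : comPzRingType) n (J F F' : 'M[R]_n) (v w : 'rV[R]_n) (s : R) :
  F' *m J = J *m F -> w = v *m J -> w *m F = s *: w -> v *m F' *m J = (s *: v) *m J.
Proof. by move=> FJ -> wF; rewrite -mulmxA FJ mulmxA wF scalemxAl. Qed.

Lemma metric_dual_transfer (R : comPzRingType) n (J G H : 'M[R]_n) (v w : 'rV[R]_n) :
  H = J *m G *m J^T -> w = v *m J -> H *m v^T = J *m (G *m w^T).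
Proof. by move=> -> ->; rewrite trmx_mul !mulmxA. Qed.

Lemma lower_col (R : realType) n (G : 'M[R]_n) (w : 'rV[R]_n) : G^T = G ->
  G *m w^T = \col_j ip G w (delta_mx 0 j).
Proof.
move=> Gs; apply/colP => j; rewrite [RHS]mxE (ipC _ _ Gs) /ip -rowE.
by rewrite [LHS]mxE [RHS]mxE; apply: eq_bigr => k _; rewrite [in RHS]mxE.
Qed.

Lemma mulmx_colB (R : comPzRingType) n (J : 'M[R]_n) (a b c : 'I_n -> R) (k : R) :
  (forall i, c i = a i - k * b i) ->
  J *m \col_i c i = J *m \col_i a i - k *: (J *m \col_i b i).
Proof.
move=> cE; rewrite scalemxAr -mulmxBr; congr (_ *m _).
by apply/colP => i; rewrite !mxE.
Qed.

Lemma mulmx_colZ (R : comPzRingType) n (J : 'M[R]_n) (b c : 'I_n -> R) (k : R) :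
  (forall i, c i = k * b i) -> J *m \col_i c i = k *: (J *m \col_i b i).
Proof.
move=> cE; rewrite scalemxAr; congr (_ *m _).
by apply/colP => i; rewrite !mxE.
Qed.

Lemma sum_scale2 (R : comPzRingType) n (V : lmodType R) (c p q : 'I_n -> R) (s : R) (v w : V) :
  \sum_a c a *: - (p a *: v + (s * q a) *: w) =
  - ((\sum_a c a * p a) *: v + s *: ((\sum_a c a * q a) *: w)).
Proof.
rewrite !scaler_suml scaler_sumr -big_split -sumrN; apply: eq_bigr => a _ /=.
by rewrite scalerN scalerDr !scalerA mulrCA.
Qed.

Lemma sum_scale1 (R : comPzRingType) n (V : lmodType R) (c p : 'I_n -> R) (v : V) :
  \sum_a c a *: (p a *: v) = (\sum_a c a * p a) *: v.
Proof. by rewrite scaler_suml; apply: eq_bigr => a _; rewrite scalerA. Qed.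

Lemma scale2_mul (R : comPzRingType) n (J : 'M[R]_n) (a b s : R) (v w v' w' : 'rV[R]_n) :
  v' = v *m J -> w' = w *m J ->
  - (a *: v' + s *: (b *: w')) = - (a *: v + s *: (b *: w)) *m J.
Proof. by move=> -> ->; rewrite mulNmx mulmxDl -!scalemxAl. Qed.

Lemma closed_differential (R : realType) m (U : set 'rV[R]_m) (f : 'rV[R]_m -> R) :
  open U -> smooth_on U f -> closed_1form U (differential f).
Proof.
move=> Uo fs z Uz i j.
have E k : (fun y => differential f y k (0 : 'I_1)) = partial k f.
  by apply/funext => y; rewrite mxE.
by rewrite !E (partialC i j Uo fs Uz) subrr.
Qed.

Section AdaptedChart.
Variables (R : realType) (x0 : 'rV[R]_5) (r : R).
Let B := ball x0 r.
Let Bo : open B. Proof. exact: ball_open. Qed.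
Variables (g phi : 'rV[R]_5 -> 'M[R]_5).
Variables (xi : 'rV[R]_5 -> 'rV[R]_5) (eta : 'rV[R]_5 -> 'cV[R]_5) (sigma : R).
Variables (V1 V2 V3 V4 : 'rV[R]_5 -> 'rV[R]_5).
Variables (t X1 X2 Y1 Y2 h1 h2 q Q a1 a2 : 'rV[R]_5 -> R).
Hypothesis ls : local_structure B g phi xi eta.
Hypothesis af : adapted_frame B g phi V1 V2 V3 V4.
Hypothesis tg : has_gradient x0 r t (fun i x => lowered g xi x i).
Hypothesis X1g : has_gradient x0 r X1 (fun i x => lowered g V1 x i).
Hypothesis X2g : has_gradient x0 r X2 (fun i x => lowered g V2 x i).
Hypothesis Y1g : has_gradient x0 r Y1 (fun i x => lowered g V3 x i
          - (a1 x * Y1 x - t x) * lowered g V1 x i).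
Hypothesis Y2g : has_gradient x0 r Y2 (fun i x => lowered g V4 x i
          - (a2 x * Y2 x - sigma * t x + Q x) * lowered g V2 x i).

Definition coordinates (x : 'rV[R]_5) : 'rV[R]_5 :=
  \row_k nth 0 [:: t x; X1 x; X2 x; Y1 x; Y2 x] k.

Definition frame_field (i : 'I_5) x : 'rV[R]_5 :=
  frame5 (xi x) (V1 x) (V2 x) (V3 x) (V4 x) i.

Lemma frame_field_gram x i j : B x ->
  ip (g x) (frame_field i x) (frame_field j x) = adopted_gram R i j.
Proof. by move=> Bx; exact: (adapted_gram ls af Bx i j). Qed.

Lemma smooth_frame_field i : smooth_mx_on B (frame_field i).
Proof.
elim/I5_cases: i.
- exact: (ls_xi ls).
- exact: (af_s1 af).
- exact: (af_s2 af).
- exact: (af_s3 af).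
- exact: (af_s4 af).
Qed.

Lemma coordinatesE k x : coordinates x 0 k = nth 0 [:: t x; X1 x; X2 x; Y1 x; Y2 x] k.
Proof. by rewrite mxE. Qed.

Lemma smooth_coordinates : smooth_mx_on B coordinates.
Proof.
move=> i k; rewrite (ord1 i).
have H f : (forall x, f x = coordinates x 0 k) -> smooth_on B f ->
    smooth_on B (fun x => coordinates x 0 k).
  by move=> fk; apply: (smooth_eq Bo) => x _.
elim/I5_cases: k H => H.
- by apply: (H t _ tg.1) => x; rewrite coordinatesE.
- by apply: (H X1 _ X1g.1) => x; rewrite coordinatesE.
- by apply: (H X2 _ X2g.1) => x; rewrite coordinatesE.
- by apply: (H Y1 _ Y1g.1) => x; rewrite coordinatesE.
- by apply: (H Y2 _ Y2g.1) => x; rewrite coordinatesE.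
Qed.

Let contract V (v x : 'rV[R]_5) : \sum_j v 0 j * lowered g V x j = ip (g x) (V x) v.
Proof. exact: ip_contract. Qed.

Lemma coordinates_unit x : B x -> 'J coordinates x \in unitmx.
Proof.
move=> Bx; apply: unitmx_ker => v v0.
have dP := smooth_mx_diff smooth_coordinates Bx.
have E k f w : has_gradient x0 r f w -> (fun x => coordinates x 0 k) = f ->
    \sum_j v 0 j * w j x = 0.
  move=> [fs fw] kf.
  have v0k : (v *m 'J coordinates x) 0 k = 0 by rewrite v0 mxE.
  rewrite -[RHS]v0k mxE; apply: eq_bigr => j _; congr (_ * _).
  rewrite (jacobianE _ _ dP) kf; exact/esym/fw.
have F k f : (forall x, coordinates x 0 k = f x) -> (fun x => coordinates x 0 k) = f.
  by move=> H; apply/funext.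
have e0 : ip (g x) (xi x) v = 0.
  by rewrite -contract; apply: (E 0 _ _ tg); apply: F => y; rewrite coordinatesE.
have e1 : ip (g x) (V1 x) v = 0.
  by rewrite -contract; apply: (E 1 _ _ X1g); apply: F => y; rewrite coordinatesE.
have e2 : ip (g x) (V2 x) v = 0.
  by rewrite -contract; apply: (E 2 _ _ X2g); apply: F => y; rewrite coordinatesE.
have K (V V' : 'rV[R]_5 -> 'rV[R]_5) (k : R) : ip (g x) (V' x) v = 0 ->
    \sum_j v 0 j * (lowered g V x j - k * lowered g V' x j) = 0 -> ip (g x) (V x) v = 0.
  move=> V'0.
  have -> : \sum_j v 0 j * (lowered g V x j - k * lowered g V' x j) =
      \sum_j v 0 j * lowered g V x j - k * \sum_j v 0 j * lowered g V' x j.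
    rewrite mulr_sumr -sumrB; apply: eq_bigr => j _.
    by rewrite mulrBr; congr (_ - _); rewrite mulrCA.
  by rewrite !contract V'0 mulr0 subr0.
have e3 : ip (g x) (V3 x) v = 0.
  apply: (K V3 V1 (a1 x * Y1 x - t x) e1).
  by apply: (E 3 _ _ Y1g); apply: F => y; rewrite coordinatesE.
have e4 : ip (g x) (V4 x) v = 0.
  apply: (K V4 V2 (a2 x * Y2 x - sigma * t x + Q x) e2).
  by apply: (E 4 _ _ Y2g); apply: F => y; rewrite coordinatesE.
apply: (frame_ext (fun i j => frame_field_gram i j Bx)) => i.
rewrite ip0l (ipC _ _ (ls_sym ls Bx)).
by elim/I5_cases: i.
Qed.

Section Pulled.
Variables (rho : R) (F : 'rV[R]_5 -> 'rV[R]_5).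
Let y0 := coordinates x0.
Let D := ball y0 rho.
Let Do : open D. Proof. exact: ball_open. Qed.
Hypothesis Fs : smooth_mx_on D F.
Hypothesis FB : forall y, D y -> B (F y).
Hypothesis FK : forall y, D y -> coordinates (F y) = y.
Variables (h hphi : 'rV[R]_5 -> 'M[R]_5).
Variables (hxi : 'rV[R]_5 -> 'rV[R]_5).
Hypothesis hunit : forall y, D y -> h y \in unitmx.
Hypothesis hxis : smooth_mx_on D hxi.
Hypothesis hE : forall y, D y -> h y = 'J F y *m g (F y) *m ('J F y)^T.
Hypothesis hphiE : forall y, D y -> hphi y *m 'J F y = 'J F y *m phi (F y).
Hypothesis hxiE : forall y, D y -> xi (F y) = hxi y *m 'J F y.

Lemma jacobian_coordinates y : D y -> 'J F y *m 'J coordinates (F y) = 1%:M.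
Proof.
move=> Dy; apply: (jacobian_inverse Do FK Dy); first exact: smooth_mx_mx_diff Fs Dy.
exact: smooth_mx_mx_diff smooth_coordinates (FB Dy).
Qed.

Let JK y : D y -> 'J coordinates (F y) *m 'J F y = 1%:M.
Proof. by move=> /jacobian_coordinates/mulmx1C. Qed.

Let Jinj y (v w : 'rV[R]_5) : D y -> v *m 'J F y = w *m 'J F y -> v = w.
Proof.
move=> Dy; exact: mulmx_linv_inj (jacobian_coordinates Dy).
Qed.

Definition chart_frame (i : 'I_5) y : 'rV[R]_5 :=
  frame_field i (F y) *m 'J coordinates (F y).

Lemma chart_frameE i y : D y -> frame_field i (F y) = chart_frame i y *m 'J F y.
Proof. by move=> Dy; rewrite -mulmxA JK// mulmx1. Qed.

Lemma smooth_chart_frame i : smooth_mx_on D (chart_frame i).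
Proof.
apply: (smooth_mxM Do).
  exact: (smooth_mx_comp Do FB (smooth_frame_field i) Fs).
exact: (smooth_mx_comp Do FB (smooth_jacobian Bo smooth_coordinates) Fs).
Qed.

Lemma chart_frame0 y : D y -> chart_frame 0 y = hxi y.
Proof. by move=> Dy; apply: (Jinj Dy); rewrite -chart_frameE// -hxiE. Qed.

Let ip_h y v w : D y -> ip (h y) v w = ip (g (F y)) (v *m 'J F y) (w *m 'J F y).
Proof. by move=> Dy; rewrite hE//; exact: ip_pullback. Qed.

Lemma ip_chart_frame y i v : D y ->
  ip (h y) v (chart_frame i y) = ip (g (F y)) (v *m 'J F y) (frame_field i (F y)).
Proof. by move=> Dy; rewrite ip_h// -chart_frameE. Qed.

Lemma chart_frame_gram y i j : D y ->
  ip (h y) (chart_frame i y) (chart_frame j y) = adopted_gram R i j.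
Proof.
by move=> Dy; rewrite ip_chart_frame// -chart_frameE// frame_field_gram//; exact: FB.
Qed.

Lemma chart_frame_eigen y i (s : R) : D y ->
  frame_field i (F y) *m phi (F y) = s *: frame_field i (F y) ->
  chart_frame i y *m hphi y = s *: chart_frame i y.
Proof.
move=> Dy E; apply: (Jinj Dy).
exact: (eigen_transfer (hphiE Dy) (chart_frameE i Dy) E).
Qed.

Lemma chart_frame_neq0 y i : D y -> frame_field i (F y) != 0 -> chart_frame i y != 0.
Proof.
move=> Dy; apply: contra_neq => E.
exact: (etrans (chart_frameE i Dy) (etrans (congr1 (mulmx^~ _) E) (mul0mx _ _))).
Qed.

Lemma chart_nabla X i y : D y -> nabla h X (chart_frame i) y *m 'J F y =
  \sum_a (X y *m 'J F y) 0 a *: cov g a (frame_field i) (F y).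
Proof.
move=> Dy.
apply: (nabla_transfer Bo Do (ls_g ls) Fs (ls_sym ls) (ls_unit ls) hunit FB hE
  X (smooth_chart_frame i) (smooth_frame_field i) (fun z => chart_frameE i (y:=z)) Dy).
Qed.

Let theta i := metric_dual h (chart_frame i).

Lemma chart_coframe i y : D y ->
  theta i y = 'J F y *m \col_j lowered g (frame_field i) (F y) j.
Proof.
move=> Dy; apply: (etrans (metric_dual_transfer (hE Dy) (chart_frameE i Dy))).
by congr (_ *m _); exact: lower_col (ls_sym ls (FB Dy)).
Qed.

Lemma chart_differential f w y : has_gradient x0 r f w -> D y ->
  differential (fun z => f (F z)) y = 'J F y *m \col_i w i (F y).
Proof.
move=> [fs fw] Dy; have By := FB Dy.
apply: (etrans (differential_comp (smooth_mx_mx_diff Fs Dy) (smooth_diff fs By))).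
by congr (_ *m _); apply/colP => i; rewrite !mxE; exact: fw.
Qed.

Lemma chart_coord f k z : (forall x, coordinates x 0 k = f x) -> D z -> f (F z) = z 0 k.
Proof. by move=> fk Dz; rewrite -fk FK. Qed.

Lemma differential_coord f w k y : has_gradient x0 r f w ->
  (forall x, coordinates x 0 k = f x) -> D y ->
  differential (fun z : 'rV[R]_5 => z 0 k) y = 'J F y *m \col_i w i (F y).
Proof.
move=> fg fk Dy; apply: (etrans _ (chart_differential fg Dy)).
apply/colP => i; rewrite !mxE; apply: (open_eq_partial Do) => // z Dz.
exact/esym/chart_coord.
Qed.

Let u z := a1 (F z) * z 0 3 - z 0 0.
Let v z := a2 (F z) * z 0 4 - sigma * z 0 0 + Q (F z).

Lemma chart_coframe_coords z : D z ->
  [/\ theta 0 z = differential (fun z : 'rV[R]_5 => z 0 0) z,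
      theta 1 z = differential (fun z : 'rV[R]_5 => z 0 1) z,
      theta 2 z = differential (fun z : 'rV[R]_5 => z 0 2) z,
      theta 3 z = u z *: theta 1 z + differential (fun z : 'rV[R]_5 => z 0 3) z &
      theta 4 z = v z *: theta 2 z + differential (fun z : 'rV[R]_5 => z 0 4) z].
Proof.
move=> Dz.
have c0 x : coordinates x 0 0 = t x by rewrite coordinatesE.
have c1 x : coordinates x 0 1 = X1 x by rewrite coordinatesE.
have c2 x : coordinates x 0 2 = X2 x by rewrite coordinatesE.
have c3 x : coordinates x 0 3 = Y1 x by rewrite coordinatesE.
have c4 x : coordinates x 0 4 = Y2 x by rewrite coordinatesE.
split.
- exact: (etrans (chart_coframe 0 Dz) (esym (differential_coord tg c0 Dz))).
- exact: (etrans (chart_coframe 1 Dz) (esym (differential_coord X1g c1 Dz))).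
- exact: (etrans (chart_coframe 2 Dz) (esym (differential_coord X2g c2 Dz))).
- rewrite (differential_coord Y1g c3 Dz).
  have -> : u z = a1 (F z) * Y1 (F z) - t (F z).
    by rewrite (chart_coord c3 Dz) (chart_coord c0 Dz).
  by rewrite !chart_coframe// (mulmx_colB _ (fun i => erefl)) addrC subrK.
rewrite (differential_coord Y2g c4 Dz).
have -> : v z = a2 (F z) * Y2 (F z) - sigma * t (F z) + Q (F z).
  by rewrite (chart_coord c4 Dz) (chart_coord c0 Dz).
by rewrite !chart_coframe// (mulmx_colB _ (fun i => erefl)) addrC subrK.
Qed.

Let lowered_h X i y : D y ->
  \sum_a (X y *m 'J F y) 0 a * lowered g (frame_field i) (F y) a =
  ip (h y) (X y) (chart_frame i y).
Proof.
move=> Dy; apply: (etrans (contract _ _ _)).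
by rewrite ip_chart_frame//; exact: ipC (ls_sym ls (FB Dy)).
Qed.

Hypothesis cov_xi : forall x i, B x -> cov g i xi x =
  - (lowered g V1 x i *: V1 x + (sigma * lowered g V2 x i) *: V2 x).

Lemma chart_shape X y : D y -> - nabla h X hxi y =
  ip (h y) (X y) (chart_frame 1 y) *: chart_frame 1 y
  + sigma *: (ip (h y) (X y) (chart_frame 2 y) *: chart_frame 2 y).
Proof.
move=> Dy; apply: oppr_inj; rewrite opprK; apply: (Jinj Dy).
apply: (etrans (nabla_transfer Bo Do (ls_g ls) Fs (ls_sym ls) (ls_unit ls) hunit FB hE
  X hxis (ls_xi ls) hxiE Dy)).
apply: (etrans (eq_bigr _ (fun a _ => congr1 (fun v => _ *: v) (cov_xi a (FB Dy))))).
apply: (etrans (sum_scale2 _ _ _ _ _ _)).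
rewrite (lowered_h X 1 Dy) (lowered_h X 2 Dy).
exact: scale2_mul (chart_frameE 1 Dy) (chart_frameE 2 Dy).
Qed.

Hypothesis covV : forall x i, B x -> cov g i V1 x = partial i h1 x *: V1 x /\
  cov g i V2 x = partial i h2 x *: V2 x.
Hypothesis h1g : has_gradient x0 r h1 (fun i x => a1 x * lowered g V1 x i).
Hypothesis h2g : has_gradient x0 r h2 (fun i x => a2 x * lowered g V2 x i).

Let tau1 := differential (fun z => h1 (F z)).
Let tau2 := differential (fun z => h2 (F z)).

Let chart_parallel i f X y : smooth_on B f -> D y ->
  (forall a, cov g a (frame_field i) (F y) = partial a f (F y) *: frame_field i (F y)) ->
  nabla h X (chart_frame i) y =
  (X y *m differential (fun z => f (F z)) y) 0 0 *: chart_frame i y.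
Proof.
move=> fs Dy cE; apply: (Jinj Dy).
have dE := differential_comp (smooth_mx_mx_diff Fs Dy) (smooth_diff fs (FB Dy)).
apply: (etrans (chart_nabla X i Dy)).
apply: (etrans (eq_bigr _ (fun a _ => congr1 (fun v => _ *: v) (cE a)))).
apply: (etrans (sum_scale1 _ _ _)).
apply: (etrans (congr1 (fun v => _ *: v) (chart_frameE i Dy))).
apply: (etrans (scalemxAl _ _ _)); congr (_ *: _ *m _).
rewrite dE mulmxA [RHS]mxE; apply: eq_bigr => a _.
by congr (_ * _); rewrite mxE.
Qed.

Lemma chart_nabla_null X z : D z ->
  nabla h X (chart_frame 1) z = (X z *m tau1 z) 0 0 *: chart_frame 1 z /\
  nabla h X (chart_frame 2) z = (X z *m tau2 z) 0 0 *: chart_frame 2 z.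
Proof.
move=> Dz; split.
  by apply: (chart_parallel X h1g.1 Dz) => a; have [] := covV a (FB Dz).
by apply: (chart_parallel X h2g.1 Dz) => a; have [] := covV a (FB Dz).
Qed.

Lemma chart_tauE z : D z ->
  tau1 z = a1 (F z) *: theta 1 z /\ tau2 z = a2 (F z) *: theta 2 z.
Proof.
move=> Dz; rewrite !chart_coframe//; split.
  by apply: (etrans (chart_differential h1g Dz)); exact: mulmx_colZ.
by apply: (etrans (chart_differential h2g Dz)); exact: mulmx_colZ.
Qed.

Lemma smooth_pull f : smooth_on B f -> smooth_on D (fun z => f (F z)).
Proof. by move=> fs; apply: (smooth_comp Do FB fs Fs). Qed.

Hypothesis a1s : smooth_on B a1.
Hypothesis a2s : smooth_on B a2.
Hypothesis qg : has_gradient x0 r q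
  (fun i x => - sigma * lowered g V1 x i - a1 x * q x * lowered g V1 x i).
Hypothesis Qg : has_gradient x0 r Q (fun i x => q x * lowered g V1 x i).

Let x12 (z : 'rV[R]_5) : 'rV[R]_2 := row2 (z 0 1) (z 0 2).

Lemma chart_differential_x1 f k w z : has_gradient x0 r f w ->
  (forall i, w i (F z) = k * lowered g V1 (F z) i) -> D z ->
  forall i, partial i (fun z => f (F z)) z = k * (i == 1)%:R.
Proof.
move=> fg wE Dz i.
have := etrans (chart_differential fg Dz) (mulmx_colZ _ wE).
rewrite -(chart_coframe 1 Dz); have [_ -> _ _ _] := chart_coframe_coords Dz.
by move=> /colP/(_ i); rewrite !mxE (partial_coord i 1 z).
Qed.

Lemma chart_pde : exists Bf : 'rV[R]_2 -> R,
  [/\ smooth_on (x12 @` D) Bf,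
    forall z, D z -> Q (F z) = Bf (x12 z) &
    forall z, D z -> partial 0 (partial 0 Bf) (x12 z)
      + a1 (F z) * partial 0 Bf (x12 z) = - sigma].
Proof.
have Qp z : D z -> forall i, partial i (fun z => Q (F z)) z = q (F z) * (i == 1)%:R.
  by move=> Dz; exact: (chart_differential_x1 Qg).
have qp z : D z -> forall i, partial i (fun z => q (F z)) z =
    (- sigma - a1 (F z) * q (F z)) * (i == 1)%:R.
  by move=> Dz; apply: (chart_differential_x1 qg _ Dz) => i; rewrite mulrBl.
have [||Bs BE B1 B2] := @partials_slice R y0 rho _ (fun z => q (F z)) (smooth_pull Qg.1).
- by move=> y Dy; rewrite Qp// eqxx mulr1.
- by move=> y i Dy i1; rewrite Qp// (negbTE i1) mulr0.
exists (fun w => Q (F (slice y0 w))); split=> // z Dz; first by rewrite BE.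
by rewrite B1// B2// qp// eqxx mulr1 subrK.
Qed.

End Pulled.
End AdaptedChart.

Lemma chart_local_structure (R : realType) (M : topologicalType) (S : set (chart R 5 M))
  (phi : field_components R 5 M 5 5) (xi : field_components R 5 M 1 5)
  (eta : field_components R 5 M 5 1) (g : field_components R 5 M 5 5) c :
  smooth_manifold S -> almost_para_cosymplectic S phi xi eta g -> locally_flat S g -> S c ->
  local_structure (cimg c) (g c) (phi c) (xi c) (eta c).
Proof.
move=> SM [[_ [phis _] [xis _] [etas _] [[gs _] gm] sqr eta_xi compat dual] cl cl2] flat Sc.
have [_ Uo _ _ _] := atlas_chart SM Sc.
have du x Ux v : (v *m eta c x) 0 0 = ip (g c x) (xi c x) v := dual c x Sc Ux v.
apply: LocalStructure.
- exact: Uo.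
- exact: gs.
- exact: phis.
- exact: xis.
- exact: etas.
- by move=> x Ux; have [] := gm c x Sc Ux.
- by move=> x Ux; have [] := gm c x Sc Ux.
- by move=> x Ux v; rewrite (sqr c x Sc Ux) du//.
- by move=> x Ux v w; rewrite -!du//; exact: compat.
- by move=> x Ux; rewrite -du//; exact: eta_xi.
- exact: du.
- exact: cl.
- exact: cl2.
move=> x i j l Ux.
have gun y Uy := (gm c y Sc Uy).2.
have es k : smooth_mx_on (cimg c) (fun=> delta_mx 0 k : 'rV[R]_5) by exact: smooth_mx_cst.
have := flat c _ _ _ Sc (es i) (es j) (es l) x Ux.
by rewrite (curvature_delta Uo (gs c Sc) gun i j (es l) Ux) => /eqP; rewrite subr_eq0 => /eqP.
Qed.

Theorem theorem8 (R : realType) (M : topologicalType) (S : set (chart R 5 M))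
  (phi : field_components R 5 M 5 5) (xi : field_components R 5 M 1 5)
  (eta : field_components R 5 M 5 1) (g : field_components R 5 M 5 5)
  (sigma : R)
  (manifoldM : smooth_manifold S)
  (sigmaE : sigma = 1 \/ sigma = -1)
  (weakM : weakly_para_cosymplectic S phi xi eta g)
  (leavesM : para_kahler_leaves S phi eta g)
  (typeM : elliptic_hyperbolic S phi xi g sigma)
  (flatM : locally_flat S g)
  (p : M) :
  exists c : chart R 5 M, [/\ S c, cdom c p &
  exists V : 'I_5 -> 'rV[R]_5 -> 'rV[R]_5, adopted_frame phi xi g sigma c V /\
  let U := cimg c in
  let theta (i : 'I_5) := metric_dual (g c) (V i) in
  let t (z : 'rV[R]_5) := z 0 0 in
  let x1 (z : 'rV[R]_5) := z 0 1 in
  let x2 (z : 'rV[R]_5) := z 0 2 in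
  let y1 (z : 'rV[R]_5) := z 0 3 in
  let y2 (z : 'rV[R]_5) := z 0 4 in
  let x12 (z : 'rV[R]_5) := row2 (x1 z) (x2 z) in
  exists (u v alpha1 alpha2 : 'rV[R]_5 -> R) (tau1 tau2 : 'rV[R]_5 -> 'cV[R]_5)
         (A B : 'rV[R]_2 -> R),
  [/\ [/\ smooth_on U u, smooth_on U v, smooth_on U alpha1 & smooth_on U alpha2],
      [/\ smooth_mx_on U tau1, smooth_mx_on U tau2,
          smooth_on (x12 @` U) A & smooth_on (x12 @` U) B],
      (forall z, U z ->
        [/\ theta 0 z = eta c z /\ theta 0 z = differential t z,
            theta 1 z = differential x1 z,
            theta 2 z = differential x2 z,
            theta 3 z = u z *: theta 1 z + differential y1 z &
            theta 4 z = v z *: theta 2 z + differential y2 z]),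
      (forall z, U z ->
        u z = alpha1 z * y1 z - t z + A (x12 z) /\
        v z = alpha2 z * y2 z - sigma * t z + B (x12 z)) &
      [/\ (forall X : 'rV[R]_5 -> 'rV[R]_5, smooth_mx_on U X ->
             forall z, U z ->
             nabla (g c) X (V 1) z = (X z *m tau1 z) 0 0 *: V 1 z /\
             nabla (g c) X (V 2) z = (X z *m tau2 z) 0 0 *: V 2 z),
          (forall z, U z ->
             tau1 z = alpha1 z *: theta 1 z /\ tau2 z = alpha2 z *: theta 2 z),
          closed_1form U tau1, closed_1form U tau2 &
          forall z, U z ->
            partial 1 (partial 1 A) (x12 z) + partial 0 (partial 0 B) (x12 z)
            + alpha2 z * partial 1 A (x12 z) + alpha1 z * partial 0 B (x12 z)
            = - sigma]]].
Proof.
have [c0 [Sc0 c0p [V1 [V2 dp]]]] := typeM p.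
have [apc _] := weakM.
have ls := chart_local_structure manifoldM apc flatM Sc0.
have [[phis phiT] [xis xiT] [etas etaT] [[gs gT] gm]] : [/\ endomorphism_field S phi,
    vector_field S xi, one_form S eta & pseudo_riemannian_metric S g].
  by have [[]] := apc.
have [[V1s V2s] V12nz V12phi V12g shape] := dp.
have Cx0 : cimg c0 (cmap c0 p) by exists p.
have sigma0 : sigma != 0 by case: sigmaE => ->; rewrite ?oppr_eq0 oner_eq0.
have cov_xi x i : cimg c0 x -> cov (g c0) i (xi c0) x =
    - (lowered (g c0) V1 x i *: V1 x + (sigma * lowered (g c0) V2 x i) *: V2 x).
  move=> Ux; have es : smooth_mx_on (cimg c0) (fun=> delta_mx 0 i : 'rV[R]_5).
    have Uo := ls_open ls; exact: smooth_mx_cst.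
  have := shape _ es x Ux.
  rewrite (nabla_delta (g c0) i (smooth_mx_mx_diff (ls_xi ls) Ux)) => E.
  apply: oppr_inj; rewrite opprK; apply: (etrans E).
  rewrite /lowered !(ipC _ (delta_mx 0 i) (ls_sym ls Ux)).
  by rewrite scalerA.
have [|||r [r0 BC [V3 [V4 [t [X1 [X2 [Y1 [Y2 [h1 [h2 [q [Q [a1 [a2 H]]]]]]]]]]]]]]] :=
  @local_adapted_coordinates R (cimg c0) (g c0) (phi c0) (xi c0) (eta c0) sigma V1 V2
    (cmap c0 p) ls _ Cx0 V1s V2s (V12nz _ Cx0).1 (V12nz _ Cx0).2 _ _ V12g sigma0 cov_xi.
- move=> W f P lp HP X Y Xs Ys w Ww.
  exact: (leavesM c0 W f P Sc0 lp HP X Y Xs Ys w Ww).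
- by move=> x Ux; rewrite (V12phi x Ux).1 scaleN1r.
- by move=> x Ux; rewrite (V12phi x Ux).2 scale1r.
have [af [a1s a2s] covV [tg X1g X2g h1g h2g] [qg Qg Y1g Y2g]] := H.
have Bo : open (ball (cmap c0 p) r) by exact: ball_open.
have lsB := local_structure_sub Bo BC ls.
have Bx0 : ball (cmap c0 p) r (cmap c0 p) by exact: ballxx.
set B := ball (cmap c0 p) r in af a1s a2s covV Bo lsB Bx0 BC *.
pose Psi := coordinates t X1 X2 Y1 Y2.
have Psis : smooth_mx_on B Psi by exact: (smooth_coordinates tg X1g X2g Y1g Y2g).
have Psiu : 'J Psi (cmap c0 p) \in unitmx.
  exact: (coordinates_unit lsB af tg X1g X2g Y1g Y2g Bx0).
have [rho [F [rho0 Fs Fx0 FBK Fo]]] := inverse_function Bo Bx0 Psis Psiu.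
have Do : open (ball (Psi (cmap c0 p)) rho) by exact: ball_open.
set D := ball (Psi (cmap c0 p)) rho in Fs FBK Fo Do *.
have FB y : D y -> B (F y) by move=> /FBK[].
have FK y : D y -> Psi (F y) = y by move=> /FBK[].
have BC0 y : B y -> cimg c0 y := BC y.
pose c := new_chart c0 D Psi F.
have Sc : S c by exact: (new_chart_atlas manifoldM Sc0 BC Do Psis Fs FB FK Fo).
have cD : cimg c = D by exact: (new_chart_img manifoldM Sc0 BC FB FK).
have cp : cdom c p.
  by split=> //; exists (Psi (cmap c0 p)); [exact: ballxx|exact: Fx0].
have ov z : D z -> overlap c c0 z.
  by rewrite /c (new_chart_overlap manifoldM Sc0 BC FB FK).
have tF z : D z -> transition c c0 z = F z.
  exact: (new_chart_transition Psi manifoldM Sc0 BC FB).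
have tJ z : D z -> 'J (transition c c0) z = 'J F z.
  move=> Dz; apply: esym; apply: (jacobian_open_eq Do (fun x Dx => esym (tF x Dx)) Dz).
  exact: smooth_mx_mx_diff Fs Dz.
have hE z : D z -> g c z = 'J F z *m g c0 (F z) *m ('J F z)^T.
  by move=> Dz; have := gT c c0 z Sc Sc0 (ov z Dz); rewrite (tJ z Dz) (tF z Dz).
have hphiE z : D z -> phi c z *m 'J F z = 'J F z *m phi c0 (F z).
  by move=> Dz; have := phiT c c0 z Sc Sc0 (ov z Dz); rewrite (tJ z Dz) (tF z Dz).
have hxiE z : D z -> xi c0 (F z) = xi c z *m 'J F z.
  by move=> Dz; have := xiT c c0 z Sc Sc0 (ov z Dz); rewrite (tJ z Dz) (tF z Dz).
have lsc := chart_local_structure manifoldM apc flatM Sc.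
rewrite cD in lsc.
have cov_xiB x i (Bx : B x) := cov_xi x i (BC x Bx).
pose V := chart_frame (xi c0) V1 V2 V3 V4 t X1 X2 Y1 Y2 F.
have Vs i : smooth_mx_on D (V i).
  exact: (smooth_chart_frame lsB af tg X1g X2g Y1g Y2g Fs FB i).
have V0 z : D z -> V 0 z = xi c z.
  exact: (chart_frame0 tg X1g X2g Y1g Y2g Fs FB FK hxiE).
have Vgram z : D z -> forall i j, ip (g c z) (V i z) (V j z) = adopted_gram R i j.
  by move=> Dz i j; exact: (chart_frame_gram lsB af tg X1g X2g Y1g Y2g Fs FB FK hE i j Dz).
have eigen i (s : R) z : D z -> (forall x, B x ->
    frame_field (xi c0) V1 V2 V3 V4 i x *m phi c0 x
    = s *: frame_field (xi c0) V1 V2 V3 V4 i x) -> V i z *m phi c z = s *: V i z.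
  move=> Dz E; apply: (chart_frame_eigen tg X1g X2g Y1g Y2g Fs FB FK hphiE Dz).
  exact: (E _ (FB z Dz)).
have Vnz i z : D z -> (forall x, B x -> frame_field (xi c0) V1 V2 V3 V4 i x != 0) -> V i z != 0.
  move=> Dz E; apply: (chart_frame_neq0 tg X1g X2g Y1g Y2g Fs FB FK Dz).
  exact: (E _ (FB z Dz)).
have gunit : forall z, D z -> g c z \in unitmx := ls_unit lsc.
have pair : distinguished_pair phi xi g sigma c (V 1) (V 2).
  rewrite /distinguished_pair cD; split.
  - by split; exact: Vs.
  - move=> z Dz; split; apply: (Vnz _ _ Dz) => x Bx; by have [] := V12nz x (BC0 x Bx).
  - move=> z Dz; split.
      by rewrite -scaleN1r; apply: (eigen 1 (-1) z Dz); exact: af_e1 af.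
    by rewrite -[RHS]scale1r; apply: (eigen 2 1 z Dz); exact: af_e2 af.
  - move=> z Dz; apply: (etrans (Vgram z Dz 1 2)); by rewrite mxE.
  move=> X _ z Dz.
  exact: (chart_shape lsB tg X1g X2g Y1g Y2g Fs FB FK gunit (ls_xi lsc) hE hxiE cov_xiB X Dz).
have frame : adopted_frame phi xi g sigma c V.
  rewrite /adopted_frame cD; split=> //.
  move=> z Dz; split.
    by rewrite -[RHS]scale1r; apply: (eigen 3 1 z Dz); exact: af_e3 af.
  by rewrite -scaleN1r; apply: (eigen 4 (-1) z Dz); exact: af_e4 af.
have [Bf [Bs QB pde]] := chart_pde lsB tg X1g X2g Y1g Y2g Fs FB FK hE qg Qg.
exists c; split=> //; exists V; split=> // U theta tc x1c x2c y1c y2c x12.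
have UD : U = D := cD.
exists (fun z => a1 (F z) * z 0 3 - z 0 0), (fun z => a2 (F z) * z 0 4 - sigma * z 0 0 + Q (F z)).
exists (fun z => a1 (F z)), (fun z => a2 (F z)).
exists (differential (fun z => h1 (F z))), (differential (fun z => h2 (F z))).
exists (fun=> 0), Bf; rewrite UD.
have sF f : smooth_on B f -> smooth_on D (fun z => f (F z)) by move=> fs; exact: (smooth_comp Do FB fs Fs).
have a1F := sF a1 a1s; have a2F := sF a2 a2s.
have sc k : smooth_on D (fun z => z 0 k) by exact: smooth_coord.
have h1F := sF h1 h1g.1; have h2F := sF h2 h2g.1.
split.
- split=> //.
    by apply: (smoothB Do); [exact: (smoothM Do)|exact: sc].
  apply: (smoothD Do); last exact: sF Qg.1.
  apply: (smoothB Do); first exact: (smoothM Do).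
  by apply: (smoothM Do); [exact: smooth_cst|exact: sc].
- split; [exact: (smooth_differential Do h1F)|exact: (smooth_differential Do h2F)| |exact: Bs].
  by apply: (@smooth_sub _ _ setT) => //; exact: smooth_cst openT _.
- move=> z Dz.
  have [t0 t1 t2 t3 t4] := chart_coframe_coords lsB tg X1g X2g Y1g Y2g Fs FB FK hE Dz.
  split=> //; split=> //; rewrite /theta /metric_dual (V0 z Dz).
  apply: (etrans (lower_col _ (ls_sym lsc Dz))).
  apply/colP => j; rewrite mxE (eta_entry lsc j Dz).
  by [].
- move=> z Dz; split; first by rewrite addr0.
  by rewrite (QB z Dz).
split.
- move=> X _ z Dz.
  exact: (chart_nabla_null lsB af tg X1g X2g Y1g Y2g Fs FB FK gunit hE covV h1g h2g X Dz).
- move=> z Dz.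
  exact: (chart_tauE lsB tg X1g X2g Y1g Y2g Fs FB FK hE h1g h2g Dz).
- exact: (closed_differential Do h1F).
- exact: (closed_differential Do h2F).
move=> z Dz; have p0 (k : 'I_2) : partial k (fun=> 0 : R) = (fun=> 0).
  by apply/funext => w; exact: partial_cst.
rewrite !p0 mulr0 addr0 add0r; exact: pde.
Qed.
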